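(* For every basis element $\phi_{\pi,j}$ with $\pi_\infty=\lambda$, \[ \big\langle\Theta(\phi_{\pi,j})(\lambda,B),\,p_{\lambda,\vec{E}_B}\big\rangle=W(\phi_{\pi,j},B). \]
   Context: Let $m\ge n$, $A$ a positive definite symmetric integral $m\times m$ matrix, $B$ a positive definite symmetric integral $n\times n$ matrix, $V_{A,C}(\mathbb{R})=\{X\in M_{m\times n}(\mathbb{R}):X^{\intercal}AX=C\}$ with invariant probability measure $\mu_C$. Fix $\vec{E}\in V_{A,I_n}(\mathbb{R})$, $\sqrt{B}\in GL_n(\mathbb{R})$ with $\sqrt{B}^{\intercal}\sqrt{B}=B$, $\vec{E}_B=\vec{E}\sqrt{B}$; $O_{A,\vec{E}}(\mathbb{R})$ the stabilizer of $\vec{E}$ in $O_A(\mathbb{R})$. $\mathcal{L}_{A,B}$ is the set of pairs $(X,L)$, $X\in V_{A,B}(\mathbb{R})$, $L\subset\mathbb{Q}^m$ a lattice with $L\otimes\mathbb{Z}_p=g_p\mathbb{Z}_p^m$ for some $g_p\in O_A(\mathbb{Q}_p)$ for each prime $p$; $O_A(\mathbb{A}_{\mathbb{Q}})$ acts by $(g_\infty,(g_p))(X,L)=(g_\infty X,L')$ with $L'\otimes\mathbb{Z}_p=g_p(L\otimes\mathbb{Z}_p)$, and $\alpha\mapsto\alpha(\vec{E}_B,\mathbb{Z}^m)$ identifies $O_A(\mathbb{Q})\backslash O_A(\mathbb{A}_{\mathbb{Q}})/O_{A,\vec{E}}(\mathbb{R})O_A(\prod_p\mathbb{Z}_p)$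 with $O_A(\mathbb{Q})\backslash\mathcal{L}_{A,B}$. $\{\phi_{\pi,j}\}$ is an orthonormal basis of $L^2$ of this space (probability measure), each $\phi_{\pi,j}$ in an irreducible automorphic representation $\pi$ of $O_A(\mathbb{A}_{\mathbb{Q}})$ whose archimedean type is $\lambda$, meaning that for fixed finite part, $g_\infty\vec{E}_B\mapsto\phi_{\pi,j}$ is the restriction to $V_{A,B}(\mathbb{R})$ of an element of $\mathcal{H}(\lambda)$. Here: $GL_n(\mathbb{C})\times O_A(\mathbb{C})$ acts on polynomials on $M_{m\times n}(\mathbb{C})$ by $P(X)\mapsto P(\sigma^{-1}Xh)$; $\mathcal{H}$ is the space annihilated by $\Delta_{ij}=\sum_{k,l}(A^{-1})_{kl}\partial^2/\partial x_{ki}\partial x_{lj}$; $\mathcal{H}(\lambda)$ is an $O_A(\mathbb{C})$-isotypic component, $\mathcal{H}(\lambda)^*$ its dual; $p_{\lambda,\vec{E}_B}\in\mathcal{H}(\lambda)$ is the unique element with $\int_{V_{A,B}(\mathbb{R})}q\,\overline{p_{\lambda,\vec{E}_B}}\,d\mu_B=q(\vec{E}_B)$ for all $q\in\mathcal{H}(\lambda)$. For $Z$ in the Siegel upper half space and $\alpha=(\alpha_\infty,(\alpha_p))\in O_A(\mathbb{A}_{\mathbb{Q}})$, $\langle\theta(\alpha,\lambda,Z),f\rangle=\sum_{H\in M_{m\times n}(\mathbb{Q})}e^{i\pi\,\mathrm{tr}(ZH^{\intercal}AH)}f(\alpha_\infty^{-1}H)\prod_p\mathbf{1}[\alpha_p^{-1}H\in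 M_{m\times n}(\mathbb{Z}_p)]$; $\Theta(\phi)(\lambda,Z)=\int_{O_A(\mathbb{Q})\backslash O_A(\mathbb{A}_{\mathbb{Q}})}\theta(\alpha,\lambda,Z)\overline{\phi(\alpha)}\,d\alpha$ (probability Haar measure), and $\Theta(\phi)(\lambda,B)\in\mathcal{H}(\lambda)^*$ is its $B$-th Fourier coefficient, i.e. the coefficient of $e^{i\pi\,\mathrm{tr}(BZ)}$ (the contribution of the terms $H$ with $H^{\intercal}AH=B$). The Weyl sum is $W(\phi,B)=\sum_{\mathcal{Q}\in O_A(\mathbb{Q})\backslash\mathcal{S}_B}\phi(\mathcal{Q})/|O_{\mathcal{Q}}(\mathbb{Q})|$, where $\mathcal{S}_B=\{(X,L)\in\mathcal{L}_{A,B}:\text{all columns of }X\text{ lie in }L\}$ and $|O_{\mathcal{Q}}(\mathbb{Q})|$ is the size of the stabilizer in $O_A(\mathbb{Q})$ of a representative of $\mathcal{Q}$.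
   Formalization: Corrected: the Haar measure dα gives O_A(R)×∏O_A(Z_p) (not the quotient) mass one, and since Θ is conjugate-linear in φ the identity is proved for real-valued φ, and for complex φ as ⟨Θ(conj φ)(λ,B),p⟩ = W(φ,B). *)

(* Defs.v *)
From HB Require Import structures.
From mathcomp Require Import all_boot all_order all_algebra.
From mathcomp Require Import generic_quotient ring_quotient.
From mathcomp Require Import ring finmap.
From mathcomp Require mpoly.
Import (canonicals) mpoly.
From mathcomp Require Import all_classical all_reals all_analysis.
From mathcomp Require Import complex.
Set Implicit Arguments. Unset Strict Implicit. Unset Printing Implicit Defensive.
Import Order.TTheory GRing.Theory Num.Theory.
Import numFieldNormedType.Exports.
Local Open Scope classical_set_scope.
Local Open Scope ring_scope.

Definition prime_idx : Type := {p : nat | prime p}.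

Section Padic.
Variable p : prime_idx.
Local Notation P := ((val p)%:R : rat).

(* Z_(p), the localization of Z at p *)
Definition zloc : pred rat := fun x => ~~ (val p %| `|denq x|)%N.

Let p_prime : prime (val p) := valP p.
Let P0 : P != 0.
Proof. by rewrite pnatr_eq0 -lt0n prime_gt0. Qed.
Let PX0 k : P ^+ k != 0. Proof. by rewrite expf_neq0. Qed.

Lemma zlocP x : reflect (exists2 b : nat, ~~ (val p %| b)%N &
  exists z : int, x * b%:R = z%:~R) (zloc x).
Proof.
apply: (iffP idP) => [xz|[b pb [z xb]]].
  exists `|denq x|%N => //; exists (numq x).
  by rewrite numqE -absz_denq.
apply: contra pb => pd; apply: dvdn_trans pd _.
have e : numq x * (b : int) = z * denq x.
  apply/eqP; rewrite -(eqr_int rat) !rmorphM /= -xb numqE mulrAC.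
  by rewrite -mulrA.
rewrite -(Gauss_dvdr (n := `|numq x|)%N); last first.
  by rewrite coprime_sym coprime_num_den.
have := congr1 absz e; rewrite !abszM /= => ->.
exact: dvdn_mull.
Qed.

Lemma zloc_int (z : int) : zloc z%:~R.
Proof.
by apply/zlocP; exists 1%N; [rewrite dvdn1 neq_ltn prime_gt1 ?orbT|exists z; rewrite mulr1].
Qed.

Lemma zloc0 : zloc 0. Proof. exact: (zloc_int 0). Qed.
Lemma zloc1 : zloc 1. Proof. exact: (zloc_int 1). Qed.

Lemma zlocM x y : zloc x -> zloc y -> zloc (x * y).
Proof.
move=> /zlocP[b pb [z xb]] /zlocP[c pc [t yc]]; apply/zlocP; exists (b * c)%N.
  by rewrite Euclid_dvdM// negb_or pb.
by exists (z * t); rewrite natrM mulrACA xb yc rmorphM.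
Qed.

Lemma zlocD x y : zloc x -> zloc y -> zloc (x + y).
Proof.
move=> /zlocP[b pb [z xb]] /zlocP[c pc [t yc]]; apply/zlocP; exists (b * c)%N.
  by rewrite Euclid_dvdM// negb_or pb.
exists (z * c%:Z + t * b%:Z); rewrite natrM rmorphD !rmorphM/= -xb -yc.
by rewrite -!pmulrn; ring.
Qed.

Lemma zlocN x : zloc (- x) = zloc x.
Proof. by rewrite /zloc denqN. Qed.

Lemma zlocB x y : zloc x -> zloc y -> zloc (x - y).
Proof. by move=> hx hy; rewrite zlocD// zlocN. Qed.

Lemma zlocX x k : zloc x -> zloc (x ^+ k).
Proof. by move=> hx; elim: k => [|k IH]; rewrite ?expr0 ?zloc1// exprS zlocM. Qed.

Lemma zlocPX k : zloc (P ^+ k).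
Proof. by apply: zlocX; exact: (zloc_int (val p)). Qed.

Lemma zloc_inv x : ~~ zloc x -> zloc x^-1.
Proof.
rewrite negbK => pd; apply/zlocP.
have x0 : x != 0 by apply: contraL pd => /eqP ->; exact: zloc0.
exists `|numq x|%N.
  apply/negP => pn; have := coprime_num_den x.
  move/coprimeP => /(_ _)[]; rewrite ?absz_gt0 ?numq_eq0//.
  move=> [u v] /= e; have : (val p %| 1)%N by rewrite -e dvdn_sub// dvdn_mull.
  by rewrite dvdn1 => /eqP p1; move: p_prime; rewrite p1.
exists (sgz (numq x) * denq x).
rewrite [_%:R]pmulrn abszEsg !rmorphM /= numqE.
by field.
Qed.

Lemma zloc_bound x : exists e, zloc (x * P ^+ e).
Proof.
have d0 : (0 < `|denq x|)%N by rewrite absz_gt0 denq_eq0.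
exists (logn (val p) `|denq x|); apply/zlocP.
have [q pq dE] := pfactor_coprime p_prime d0.
exists q; first by rewrite -prime_coprime.
exists (numq x); rewrite numqE -mulrA -natrX -natrM mulnC -dE.
by rewrite [_%:R]pmulrn absz_denq.
Qed.

(* Q_p is constructed as the ring of p-adic Cauchy sequences of rationals modulo
   the ideal of null sequences. *)
Definition pcauchy : {pred nat -> rat} := fun x => `[< forall k, exists N : nat,
  forall i j, (N <= i)%N -> (N <= j)%N -> zloc ((x i - x j) / P ^+ k) >].

Lemma pcauchyP x : reflect (forall k, exists N : nat,
  forall i j, (N <= i)%N -> (N <= j)%N -> zloc ((x i - x j) / P ^+ k)) (x \in pcauchy).
Proof. exact: asboolP. Qed.

Lemma pcauchy_cst (r : rat) : (cst r : nat -> rat) \in pcauchy.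
Proof. by apply/pcauchyP => k; exists 0%N => i j _ _; rewrite /cst subrr mul0r zloc0. Qed.

Lemma pcauchy_bound x : x \in pcauchy ->
  exists e N, forall i, (N <= i)%N -> zloc (x i * P ^+ e).
Proof.
move=> /pcauchyP /(_ 0%N)[N hN]; have [e he] := zloc_bound (x N).
exists e, N => i Ni; rewrite -(subrK (x N) (x i)) mulrDl zlocD// zlocM ?zlocPX//.
by have := hN i N Ni (leqnn _); rewrite expr0 divr1.
Qed.

Lemma pcauchy_subring : subring_closed pcauchy.
Proof.
split; first exact: pcauchy_cst.
  move=> x y /pcauchyP hx /pcauchyP hy; apply/pcauchyP => k.
  have [[M hM] [N hN]] := (hx k, hy k).
  exists (maxn M N) => i j; rewrite !geq_max => /andP[Mi Ni] /andP[Mj Nj].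
  have -> : (x - y) i - (x - y) j = (x i - x j) - (y i - y j).
    by rewrite !fctE opprD addrACA -opprD.
  by rewrite mulrBl zlocB ?hM ?hN.
move=> x y cx cy; apply/pcauchyP => k.
have [[e [M' he]] [f [N' hf]]] := (pcauchy_bound cx, pcauchy_bound cy).
move: cx cy => /pcauchyP/(_ (k + f)%N)[M hM] /pcauchyP/(_ (k + e)%N)[N hN].
exists (maxn (maxn M N) (maxn M' N')) => i j.
rewrite !geq_max => /andP[/andP[Mi Ni] /andP[M'i N'i]] /andP[/andP[Mj Nj] /andP[M'j N'j]].
have -> : ((x * y) i - (x * y) j) / P ^+ k =
    (x i * P ^+ e) * ((y i - y j) / P ^+ (k + e)) +
    (x i - x j) / P ^+ (k + f) * (y j * P ^+ f).
  by rewrite !fctE !exprD; field; rewrite !PX0.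
by rewrite zlocD// zlocM// ?he ?hf ?hN ?hM.
Qed.

HB.instance Definition _ := GRing.isSubringClosed.Build (nat -> rat) pcauchy
  pcauchy_subring.

Record padic_seq := PadicSeq {padic_fun :> nat -> rat; _ : padic_fun \in pcauchy}.
HB.instance Definition _ := [isSub for padic_fun].
HB.instance Definition _ := [Choice of padic_seq by <:].
HB.instance Definition _ := [SubChoice_isSubComNzRing of padic_seq by <:].

Definition pnull : {pred padic_seq} := fun x => `[< forall k, exists N : nat,
  forall i, (N <= i)%N -> zloc (x i / P ^+ k) >].

Lemma pnullP (x : padic_seq) : reflect (forall k, exists N : nat,
  forall i, (N <= i)%N -> zloc (x i / P ^+ k)) (x \in pnull).
Proof. exact: asboolP. Qed.

Lemma pnull_ideal : idealr_closed pnull.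
Proof.
split.
- by apply/pnullP => k; exists 0%N => i _; rewrite /= mul0r zloc0.
- apply/negP => /pnullP/(_ 1%N)[N /(_ N (leqnn _))]; rewrite /= div1r expr1.
  move=> /zlocP[b pb [z zb]].
  have : P * z%:~R = b%:R by rewrite -zb mulrA divff// mul1r.
  rewrite -[P]/((val p)%:~R) -rmorphM/= -[b%:R]/(b%:~R) => /eqP; rewrite eqr_int => /eqP e.
  by move/negP: pb; apply; have := congr1 absz e; rewrite abszM /= => <-; exact: dvdn_mulr.
- move=> a u v /pnullP hu /pnullP hv; apply/pnullP => k.
  have [e [M he]] := pcauchy_bound (valP a).
  have [[N hN] [N' hN']] := (hu (k + e)%N, hv k).
  exists (maxn M (maxn N N')) => i; rewrite !geq_max => /and3P[Mi Ni N'i].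
  have -> : (a * u + v : padic_seq) i / P ^+ k =
      (a i * P ^+ e) * (u i / P ^+ (k + e)) + v i / P ^+ k.
    have -> : (a * u + v : padic_seq) i = a i * u i + v i by [].
    by rewrite exprD; field; rewrite !PX0.
  by rewrite zlocD ?hN'// zlocM ?he ?hN.
Qed.

HB.instance Definition _ := isIdealr.Build padic_seq pnull pnull_ideal.

Definition padic : Type := {ideal_quot pnull}.
HB.instance Definition _ := GRing.ComNzRing.on padic.

Local Open Scope quotient_scope.

Definition to_padic (x : padic_seq) : padic := \pi_{ideal_quot pnull} x.

Lemma padicW (u : padic) : exists x, u = to_padic x.
Proof. by exists (repr u); rewrite /to_padic reprK. Qed.

Lemma to_padic_eq x y : to_padic x = to_padic y <-> x - y \in pnull.
Proof.
rewrite Quotient.idealrBE; split=> [h|/eqP//]; exact/eqP.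
Qed.

Lemma to_padicD x y : to_padic (x + y) = to_padic x + to_padic y.
Proof. exact: (rmorphD (\pi_{ideal_quot pnull})). Qed.
Lemma to_padicM x y : to_padic (x * y) = to_padic x * to_padic y.
Proof. exact: (rmorphM (\pi_{ideal_quot pnull})). Qed.
Lemma to_padic1 : to_padic 1 = 1.
Proof. exact: (rmorph1 (\pi_{ideal_quot pnull})). Qed.
Lemma to_padic0 : to_padic 0 = 0.
Proof. exact: (rmorph0 (\pi_{ideal_quot pnull})). Qed.

Lemma padic_inv_ex (u : padic) : u != 0 -> exists v, v * u = 1.
Proof.
have [x ->] := padicW u; rewrite -to_padic0 => /eqP nx.
have /existsNP[k xk] : ~ forall k, exists N : nat,
    forall i, (N <= i)%N -> zloc (x i / P ^+ k).
  by move=> h; apply: nx; apply/to_padic_eq; rewrite subr0; exact/pnullP.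
have [N hN] := (pcauchyP _ (valP x)) k.
have nz i : (N <= i)%N -> ~~ zloc (x i / P ^+ k).
  move=> Ni; apply/negP => xi; apply: xk; exists N => j Nj.
  by rewrite -(subrK (x i) (x j)) mulrDl zlocD// hN.
have x0 i : (N <= i)%N -> x i != 0.
  by move=> /nz; apply: contraNneq => ->; rewrite mul0r zloc0.
have xV i : (N <= i)%N -> zloc (P ^+ k / x i).
  by move=> /nz/zloc_inv; rewrite invf_div.
have yc : (fun i => (x i)^-1) \in pcauchy.
  apply/pcauchyP => K; have [M hM] := (pcauchyP _ (valP x)) (K + (k + k))%N.
  exists (maxn M N) => i j; rewrite !geq_max => /andP[Mi Ni] /andP[Mj Nj].
  have -> : ((x i)^-1 - (x j)^-1) / P ^+ K =
      (x j - x i) / P ^+ (K + (k + k)) * (P ^+ k / x i) * (P ^+ k / x j).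
    by rewrite !exprD; field; rewrite !PX0 !x0.
  by apply: zlocM; [apply: zlocM; [exact: hM|exact: xV]|exact: xV].
exists (to_padic (PadicSeq yc)); rewrite -to_padicM -to_padic1; apply/to_padic_eq.
apply/pnullP => K; exists N => i Ni.
have -> : (PadicSeq yc * x - 1) i = (x i)^-1 * x i - 1 by [].
by rewrite mulVf ?x0// subrr mul0r zloc0.
Qed.

Definition padic_inv (u : padic) : padic := 
  if u == 0 then 0 else xget 0 [set v : padic | v * u = 1].

Lemma padic_mulVf u : u != 0 -> padic_inv u * u = 1.
Proof.
move=> u0; rewrite /padic_inv (negbTE u0).
by case: xgetP => // /(_ _)h; have [v /h] := padic_inv_ex u0.
Qed.

Lemma padic_inv0 : padic_inv 0 = 0. Proof. by rewrite /padic_inv eqxx. Qed.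

HB.instance Definition _ := GRing.ComNzRing_isField.Build padic padic_mulVf padic_inv0.

(* Z_p *)
Definition padic_int : set padic :=
  [set u | exists2 x : padic_seq, u = to_padic x & forall i, zloc (x i)].

Lemma padic_int1 : padic_int 1.
Proof. by exists 1; rewrite ?to_padic1// => i; exact: zloc1. Qed.

Lemma padic_int0 : padic_int 0.
Proof. by exists 0; rewrite ?to_padic0// => i; exact: zloc0. Qed.

Lemma padic_intD u v : padic_int u -> padic_int v -> padic_int (u + v).
Proof.
move=> [x -> hx] [y -> hy]; exists (x + y); rewrite ?to_padicD// => i.
by rewrite zlocD.
Qed.

Lemma padic_intM u v : padic_int u -> padic_int v -> padic_int (u * v).
Proof.
move=> [x -> hx] [y -> hy]; exists (x * y); rewrite ?to_padicM// => i.
by rewrite zlocM.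
Qed.

Definition padic_of_rat (r : rat) : padic := to_padic (PadicSeq (pcauchy_cst r)).

Lemma padic_of_rat_zmod : zmod_morphism padic_of_rat.
Proof.
move=> x y; rewrite /padic_of_rat.
have <- : PadicSeq (pcauchy_cst x) - PadicSeq (pcauchy_cst y) =
  PadicSeq (pcauchy_cst (x - y)) by exact/val_inj.
exact: (rmorphB (\pi_{ideal_quot pnull})).
Qed.

Lemma padic_of_rat_monoid : monoid_morphism padic_of_rat.
Proof.
split=> [|x y]; rewrite -?to_padic1 -?to_padicM;
  by congr to_padic; exact/val_inj.
Qed.

HB.instance Definition _ := GRing.isZmodMorphism.Build rat padic padic_of_rat
  padic_of_rat_zmod.
HB.instance Definition _ := GRing.isMonoidMorphism.Build rat padic padic_of_rat
  padic_of_rat_monoid.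

Lemma padic_of_ratE (r : rat) : padic_of_rat r = ratr r.
Proof. exact: (fmorph_eq_rat padic_of_rat). Qed.

Lemma padic_int_ratr (r : rat) : zloc r -> padic_int (ratr r).
Proof. by move=> hr; rewrite -padic_of_ratE; exists (PadicSeq (pcauchy_cst r)). Qed.

End Padic.

Definition zmx (K : pzRingType) (a b : nat) (M : 'M[int]_(a, b)) : 'M[K]_(a, b) :=
  map_mx (fun z : int => z%:~R) M.

Definition qmx (K : unitRingType) (a b : nat) (M : 'M[rat]_(a, b)) : 'M[K]_(a, b) :=
  map_mx (@ratr K) M.

Definition cmx (R : realType) (a b : nat) (M : 'M[R]_(a, b)) : 'M[R[i]]_(a, b) :=
  map_mx (fun x : R => x%:C%C) M.

Definition padic_int_mx (p : prime_idx) (a b : nat) : set 'M[padic p]_(a, b) :=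
  [set M | forall i j, padic_int (M i j)].

Definition pos_def (R : realType) (k : nat) (S : 'M[R]_k) : Prop :=
  S^T = S /\ forall x : 'cV[R]_k, x != 0 -> 0 < (x^T *m S *m x) 0 0.

(* V_{A,C}(K) *)
Definition repr_var (K : pzRingType) (m n : nat) (A : 'M[int]_m) (C : 'M[K]_n) :
  set 'M[K]_(m, n) := [set X | X^T *m zmx K A *m X = C].

(* O_A(K); over a subring such as Z_p inside Q_p, membership of the entries is
   stated separately, and the inverse A^-1 g^T A is automatically integral since
   det g = 1 or -1. *)
Definition orth (K : pzRingType) (m : nat) (A : 'M[int]_m) : set 'M[K]_m :=
  [set g | g^T *m zmx K A *m g = zmx K A].

Section Adelic.
Variables (R : realType) (m : nat) (A : 'M[int]_m).

Lemma orth1 (K : pzRingType) : orth A (1%:M : 'M[K]_m).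
Proof. by rewrite /orth /= trmx1 mul1mx mulmx1. Qed.

Lemma orthM (K : comPzRingType) (g h : 'M[K]_m) :
  orth A g -> orth A h -> orth A (g *m h).
Proof.
rewrite /orth /= => gA hA; rewrite trmx_mul !mulmxA.
by rewrite -(mulmxA h^T) -(mulmxA h^T) gA.
Qed.

Lemma orth_qmx (K : fieldType) (q : 'M[rat]_m) :
  (forall r s : rat, ratr (r + s) = ratr r + ratr s :> K) ->
  (forall r s : rat, ratr (r * s) = ratr r * ratr s :> K) ->
  orth A q -> orth A (qmx K q).
Proof.
move=> rD rM; rewrite /orth /= => /(congr1 (@qmx K m m)).
have r0 : ratr 0 = 0 :> K by exact: (ratr_int K 0).
have qM (M N : 'M[rat]_m) : qmx K (M *m N) = qmx K M *m qmx K N.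
  apply/matrixP => i j; rewrite !mxE (big_morph _ rD r0).
  by apply: eq_bigr => k _; rewrite rM !mxE.
have qZ : qmx K (zmx rat A) = zmx K A.
  by apply/matrixP => i j; rewrite !mxE ratr_int.
have qT : qmx K q^T = (qmx K q)^T by apply/matrixP => i j; rewrite !mxE.
by rewrite !qM qZ qT.
Qed.

Lemma padic_int_mxM (p : prime_idx) (a b c : nat) (M : 'M[padic p]_(a, b))
    (N : 'M[padic p]_(b, c)) :
  padic_int_mx M -> padic_int_mx N -> padic_int_mx (M *m N).
Proof.
move=> hM hN i j; rewrite mxE; elim/big_ind: _ => [|x y hx hy|k _].
- exact: padic_int0.
- exact: padic_intD.
- exact: padic_intM.
Qed.

(* O_A(A_Q): the restricted product over the primes, with respect to the
   subgroups O_A(Z_p), times the archimedean factor O_A(R). *)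
Record adelic_orth : Type := AdelicOrth {
  arch : 'M[R]_m;
  fin : forall p : prime_idx, 'M[padic p]_m;
  arch_orth : orth A arch;
  fin_orth : forall p, orth A (fin p);
  fin_int : exists N : nat, forall p, (N < val p)%N -> padic_int_mx (fin p) }.

Lemma adelic_mul_int (a b : adelic_orth) :
  exists N : nat, forall p, (N < val p)%N -> padic_int_mx (fin a p *m fin b p).
Proof.
have [[M hM] [N hN]] := (fin_int a, fin_int b).
exists (maxn M N) => p; rewrite gtn_max => /andP[Mp Np].
by apply: padic_int_mxM; [exact: hM|exact: hN].
Qed.

Definition adelic_mul (a b : adelic_orth) : adelic_orth :=
  @AdelicOrth (arch a *m arch b) (fun p => fin a p *m fin b p)
    (orthM (arch_orth a) (arch_orth b))
    (fun p => orthM (fin_orth a p) (fin_orth b p)) (adelic_mul_int a b).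

(* O_A(Q) and its diagonal embedding *)
Definition rat_orth : Type := {g : 'M[rat]_m | orth A g}.

Lemma orth_qmx_arch (g : 'M[rat]_m) : orth A g -> orth A (qmx R g).
Proof. by apply: orth_qmx => r s; rewrite (rmorphD, rmorphM). Qed.

Lemma orth_qmx_fin (g : 'M[rat]_m) (p : prime_idx) :
  orth A g -> orth A (qmx (padic p) g).
Proof. by apply: orth_qmx => r s; rewrite -!padic_of_ratE (rmorphD, rmorphM). Qed.

Lemma qmx_int (g : 'M[rat]_m) :
  exists N : nat, forall p, (N < val p)%N -> padic_int_mx (qmx (padic p) g).
Proof.
exists (\max_(ij : 'I_m * 'I_m) `|denq (g ij.1 ij.2)|%N) => p hp i j.
rewrite mxE; apply: padic_int_ratr; apply/negP => /dvdn_leq.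
rewrite absz_gt0 denq_eq0 => /(_ isT); apply/negP; rewrite -ltnNge.
apply: leq_ltn_trans hp.
exact: (leq_bigmax (F := fun ij : 'I_m * 'I_m => `|denq (g ij.1 ij.2)|%N) (i, j)).
Qed.

Definition diag (g : rat_orth) : adelic_orth :=
  @AdelicOrth (qmx R (proj1_sig g)) (fun p => qmx (padic p) (proj1_sig g))
    (orth_qmx_arch (proj2_sig g)) (fun p => orth_qmx_fin p (proj2_sig g))
    (qmx_int (proj1_sig g)).

HB.instance Definition _ := gen_eqMixin adelic_orth.
HB.instance Definition _ := gen_choiceMixin adelic_orth.
HB.instance Definition _ :=
  isPointed.Build adelic_orth (diag (exist _ 1%:M (orth1 rat))).

(* The adelic topology, i.e. the one induced by M_m(A_Q): the sets N Zhat, for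
   N > 0, form a basis of neighbourhoods of 0 in the finite adeles. *)
Definition adelic_open : set (set adelic_orth) := [set U | forall a, U a ->
  exists2 e : R, 0 < e & exists2 N : nat, (0 < N)%N &
  forall b : adelic_orth,
    (forall i j, `|arch b i j - arch a i j| < e) ->
    (forall p i j, padic_int ((fin b p i j - fin a p i j) / N%:R)) -> U b].

Definition adelic_borel := g_sigma_algebraType adelic_open.

(* O_A(R) x prod_p O_A(Z_p) *)
Definition maximal_compact : set adelic_borel :=
  [set a | forall p, padic_int_mx (fin a p)].

(* Haar measure, normalized to be a probability measure on the compact open
   subgroup O_A(R) x prod_p O_A(Z_p). *)
Definition is_haar (mu : {measure set adelic_borel -> \bar R}) : Prop :=
  mu maximal_compact = 1%E /\
  forall (a : adelic_orth) (S : set adelic_borel), measurable S ->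
    mu (adelic_mul a @^-1` S) = mu S.

(* A Borel set of representatives of O_A(Q)\O_A(A_Q). As O_A(Q) is a countable
   discrete subgroup, integrating an O_A(Q)-invariant function over
   O_A(Q)\O_A(A_Q) amounts to integrating it over such a set. *)
Definition is_fundamental_domain (D : set adelic_borel) : Prop :=
  measurable D /\
  forall a : adelic_orth, exists! g : rat_orth, D (adelic_mul (diag g) a).

End Adelic.

Section ComplexIntegral.
Local Open Scope ereal_scope.

Definition cintegral (d : measure_display) (T : measurableType d) (R : realType)
    (mu : {measure set T -> \bar R}) (D : set T) (f : T -> R[i]) : R[i] :=
  Complex (Rintegral mu D (fun x => complex.Re (f x)))
          (Rintegral mu D (fun x => complex.Im (f x))).

Definition rsum (R : realType) (T : choiceType) (S : set T) (f : T -> R) : R :=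
  (fine (\esum_(x in S) (Num.max (f x) 0)%:E) -
   fine (\esum_(x in S) (Num.max (- f x) 0)%:E))%R.

(* The unconditional sum, for absolutely summable families *)
Definition csum (R : realType) (T : choiceType) (S : set T) (f : T -> R[i]) : R[i] :=
  Complex (rsum S (fun x => complex.Re (f x))) (rsum S (fun x => complex.Im (f x))).

End ComplexIntegral.

(* exp(i pi z) *)
Definition expipi (R : realType) (z : R[i]) : R[i] :=
  Complex (expR (- pi * complex.Im z) * cos (pi * complex.Re z))
          (expR (- pi * complex.Im z) * sin (pi * complex.Re z)).

Definition siegel (R : realType) (n : nat) : set 'M[R[i]]_n :=
  [set Z | Z^T = Z /\ pos_def (map_mx (@complex.Im R) Z)].

Section Harmonic.
Variables (R : realType) (m n : nat) (A : 'M[int]_m).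
Local Notation C := (R[i]).

(* Polynomials on M_{m x n}(C), in the variables x_{ki}. *)
Definition mxpoly : Type := mpoly.mpoly (m * n) C.

Definition peval (P : mxpoly) (X : 'M[C]_(m, n)) : C :=
  mpoly.meval (fun k => mxvec X 0 k) P.

Definition generic_mx : 'M[mxpoly]_(m, n) :=
  \matrix_(k, i) mpoly.mpolyX C (mpoly.mnm1 (mxvec_index k i)).

(* (s, h) . P (X) = P (s^-1 X h) *)
Definition pact (s : 'M[C]_m) (h : 'M[C]_n) (P : mxpoly) : mxpoly :=
  let Y := map_mx (@mpoly.mpolyC (m * n) C) (invmx s) *m generic_mx
           *m map_mx (@mpoly.mpolyC (m * n) C) h in
  mpoly.comp_mpoly [tuple mxvec Y 0 k | k < m * n] P.

Definition laplacian (i j : 'I_n) (P : mxpoly) : mxpoly :=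
  \sum_(k < m) \sum_(l < m) invmx (zmx C A) k l *:
    mpoly.mderiv (mxvec_index k i) (mpoly.mderiv (mxvec_index l j) P).

Definition harmonic : set mxpoly := [set P | forall i j, laplacian i j P = 0].

Definition subspace (U : set mxpoly) : Prop :=
  U 0 /\ forall (a : C) P Q, U P -> U Q -> U (a *: P + Q).

Definition submodule (U : set mxpoly) : Prop :=
  subspace U /\ forall (s : 'M[C]_m) P, orth A s -> U P -> U (pact s 1%:M P).

Definition irreducible_harmonic (U : set mxpoly) : Prop :=
  [/\ submodule U, U `<=` harmonic, U <> [set 0] &
      forall U', submodule U' -> U' `<=` U -> U' = [set 0] \/ U' = U].

Definition module_iso (U U' : set mxpoly) : Prop := exists f : mxpoly -> mxpoly,
  [/\ set_bij U U' f,
      forall (a : C) P Q, U P -> U Q -> f (a *: P + Q) = a *: f P + f Q &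
      forall (s : 'M[C]_m) P, orth A s -> U P ->
        f (pact s 1%:M P) = pact s 1%:M (f P)].

(* H(lambda), where lambda is the isomorphism class of the irreducible
   O_A(C)-submodule lam of H: the span of all submodules isomorphic to lam. *)
Definition isotypic (lam : set mxpoly) : set mxpoly := [set P |
  forall S, subspace S ->
    (forall U, irreducible_harmonic U -> module_iso lam U -> U `<=` S) -> S P].

End Harmonic.

Section Lattices.
Variables (R : realType) (m n : nat) (A : 'M[int]_m) (B : 'M[int]_n).

Definition std_lattice : set 'cV[rat]_m := [set v | forall i, v i 0 \is a Num.int].

Definition is_lattice (L : set 'cV[rat]_m) : Prop :=
  exists2 M : 'M[rat]_m, M \in unitmx & L = [set M *m z | z in std_lattice].

(* L (x) Z_p, as a Z_p-submodule of Q_p^m *)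
Definition localize (p : prime_idx) (L : set 'cV[rat]_m) : set 'cV[padic p]_m :=
  [set w | exists k (c : 'I_k -> padic p) (v : 'I_k -> 'cV[rat]_m),
    [/\ forall i, padic_int (c i), forall i, L (v i) &
        w = \sum_i c i *: qmx (padic p) (v i)]].

Definition genus (L : set 'cV[rat]_m) : Prop := is_lattice L /\
  forall p : prime_idx, exists2 g : 'M[padic p]_m, orth A g &
    localize L = [set g *m z | z in @padic_int_mx p m 1].

Definition framed_lattice : Type := ('M[R]_(m, n) * set 'cV[rat]_m)%type.

(* L_{A,B} *)
Definition in_LAB : set framed_lattice :=
  [set Q | repr_var A (zmx R B) Q.1 /\ genus Q.2].

(* A lattice L' is the intersection of Q^m with all the L' (x) Z_p, hence this is
   the lattice L' with L' (x) Z_p = g_p (L (x) Z_p) for all p. *)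
Definition adelic_act (a : adelic_orth R A) (Q : framed_lattice) : framed_lattice :=
  (arch a *m Q.1, [set v | forall p, exists2 w,
     localize (p := p) Q.2 w & qmx (padic p) v = fin a p *m w]).

Definition rat_act (g : 'M[rat]_m) (Q : framed_lattice) : framed_lattice :=
  (qmx R g *m Q.1, [set g *m v | v in Q.2]).

Definition rat_invariant (f : framed_lattice -> R[i]) : Prop :=
  forall g Q, orth A g -> in_LAB Q -> f (rat_act g Q) = f Q.

(* S_B *)
Definition in_SB : set framed_lattice := [set Q | in_LAB Q /\
  forall j, exists2 v, Q.2 v & col j Q.1 = qmx R v].

Definition rat_orbit (Q : framed_lattice) : set framed_lattice :=
  [set rat_act g Q | g in [set g | orth A g]].

Definition rat_stab (Q : framed_lattice) : set 'M[rat]_m :=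
  [set g | orth A g /\ rat_act g Q = Q].

Definition weyl_sum (f : framed_lattice -> R[i]) : R[i] :=
  \sum_(O \in [set rat_orbit Q | Q in in_SB])
    let Q := xget (0, set0) O in f Q / #|` fset_set (rat_stab Q)|%:R.

End Lattices.

Section Automorphic.
Variables (R : realType) (m n : nat) (A : 'M[int]_m) (B : 'M[int]_n).
Variables (mu : {measure set (adelic_borel R A) -> \bar R}).
Variables (D : set (adelic_borel R A)) (EB : 'M[R]_(m, n)).
Local Notation C := (R[i]).
Local Notation G := (adelic_borel R A).

Definition normsq (z : C) : R := complex.Re z ^+ 2 + complex.Im z ^+ 2.

Definition L2normsq (F : G -> C) : \bar R := (\int[mu]_(a in D) (normsq (F a))%:E)%E.

(* L^2(O_A(Q)\O_A(A_Q)), as a set of functions (not of classes of functions) *)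
Definition L2 : set (G -> C) := [set F |
  [/\ forall g (a : G), F (adelic_mul (diag R g) a) = F a,
      measurable_fun setT (fun a : G => complex.Re (F a)),
      measurable_fun setT (fun a : G => complex.Im (F a)) &
      (L2normsq F < +oo)%E]].

(* The inner product for the invariant probability measure on O_A(Q)\O_A(A_Q) *)
Definition L2dot (F F' : G -> C) : C :=
  cintegral mu D (fun a : G => F a * (F' a)^*) / (fine (mu D))%:C%C.

Definition closed_invariant (S : set (G -> C)) : Prop :=
  [/\ S `<=` L2, S (fun=> 0),
      forall (c : C) F F', S F -> S F' -> S (fun a => c * F a + F' a),
      forall b F, S F -> S (fun a => F (adelic_mul a b)) &
      forall F, L2 F -> (forall e : R, 0 < e ->
         exists2 F', S F' & (L2normsq (fun a => F a - F' a)%R < e%:E)%E) -> S F].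

(* O_A is anisotropic, so O_A(Q)\O_A(A_Q) is compact and the irreducible
   automorphic representations are the irreducible closed invariant subspaces
   of L^2, under right translation. *)
Definition irreducible_automorphic (S : set (G -> C)) : Prop :=
  [/\ closed_invariant S, exists2 F, S F & L2normsq F <> 0%E &
      forall S', closed_invariant S' -> S' `<=` S ->
        (forall F, S' F -> L2normsq F = 0%E) \/ S' = S].

(* a |-> f (a . (E_B, Z^m)) *)
Definition pullback (f : framed_lattice R m n -> C) : G -> C :=
  fun a => f (adelic_act a (EB, @std_lattice m)).

Definition has_arch_type (lam : set (mxpoly R m n)) (f : framed_lattice R m n -> C) :
  Prop := forall L, genus A L -> exists2 q, isotypic A lam q &
    forall X, repr_var A (zmx R B) X -> f (X, L) = peval q (cmx X).

Definition automorphic_basis (I : eqType) (phi : I -> framed_lattice R m n -> C) : Prop :=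
  [/\ forall i, rat_invariant A B (phi i) /\ L2 (pullback (phi i)),
      forall i j, L2dot (pullback (phi i)) (pullback (phi j)) = (i == j)%:R,
      forall f, rat_invariant A B f -> L2 (pullback f) ->
        (forall i, L2dot (pullback f) (pullback (phi i)) = 0) ->
        L2normsq (pullback f) = 0%E &
      forall i, (exists2 Pi, irreducible_automorphic Pi & Pi (pullback (phi i))) /\
        exists2 lam, irreducible_harmonic A lam & has_arch_type lam (phi i)].

(* The part <theta(a, lambda, Z), f> coming from the terms H in S; the whole
   series is the case S = setT. *)
Definition theta_terms (S : set 'M[rat]_(m, n)) (a : G) (Z : 'M[C]_n)
    (f : mxpoly R m n) : C :=
  csum S (fun H : 'M[rat]_(m, n) =>
    expipi (\tr (Z *m qmx C (H^T *m zmx rat A *m H)))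
    * peval f (cmx (invmx (arch a) *m qmx R H))
    * (`[< forall p, padic_int_mx (invmx (fin a p) *m qmx (padic p) H) >])%:R).

Definition Theta_terms (S : set 'M[rat]_(m, n)) (f : framed_lattice R m n -> C)
    (Z : 'M[C]_n) (q : mxpoly R m n) : C :=
  cintegral mu D (fun a : G => theta_terms S a Z q * (pullback f a)^*).

(* <Theta(f)(lambda, B), q>: the coefficient of exp(i pi tr(B Z)), i.e. of the
   contribution of the terms H with H^T A H = B. *)
Definition Theta_coef (f : framed_lattice R m n -> C) (q : mxpoly R m n) : C :=
  xget 0 [set c | forall Z, siegel Z ->
    Theta_terms (repr_var A (zmx rat B)) f Z q = c * expipi (\tr (zmx C B *m Z))].

End Automorphic.

(* The invariant probability measure on V_{A,C}(R), as a Borel measure on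
   M_{m x n}(R) *)
Definition mx_borel (R : realType) (m n : nat) :=
  g_sigma_algebraType (@open 'M[R]_(m, n)).

Definition invariant_probability (R : realType) (m n : nat) (A : 'M[int]_m)
    (C : 'M[R]_n) (mu : probability (mx_borel R m n) R) : Prop :=
  mu (repr_var A C) = 1%E /\
  forall (g : 'M[R]_m) (S : set (mx_borel R m n)), orth A g -> measurable S ->
    mu (mulmx g @^-1` S) = mu S.

(* p_{lambda, X0} *)
Definition reproducing (R : realType) (m n : nat) (A : 'M[int]_m) (C : 'M[R]_n)
    (mu : probability (mx_borel R m n) R) (lam : set (mxpoly R m n))
    (X0 : 'M[R]_(m, n)) (p : mxpoly R m n) : Prop :=
  isotypic A lam p /\ forall q, isotypic A lam q ->
    cintegral mu (repr_var A C) (fun X => peval q (cmx X) * (peval p (cmx X))^*) =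
    peval q (cmx X0).

(* Main.v *)
Require Import Defs.
From HB Require Import structures.
From mathcomp Require Import all_boot all_order all_algebra.
From mathcomp Require Import ring lra zify finmap.
From mathcomp Require mpoly.
Import (canonicals) mpoly.
From mathcomp Require Import all_classical all_reals all_analysis measurable_realfun.
From mathcomp Require Import complex.
Set Implicit Arguments. Unset Strict Implicit. Unset Printing Implicit Defensive.
Import Order.TTheory GRing.Theory Num.Theory.
Import numFieldNormedType.Exports.
Local Open Scope classical_set_scope.
Local Open Scope ring_scope.

(** The integral of the B-th theta coefficient against phi unfolds. For an adelic
point a, the matrices H contributing to it are the points (H, lat a) of S_B, where
lat a is the lattice of a; grouping them by O_A(Q)-orbit turns the integral over
O_A(Q)\O_A(A_Q) into a sum over the orbits of (X, L), weighted by the reciprocal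
order of the stabilizer, of the integral of p(u^-1 X) phi(u E_B, L) over all adelic
u with lattice L, a set of measure 1. By uniqueness of the invariant mean on
V_{A,B}(R), the Hermitian symmetry p(u^-1 E_B) = conj p(u E_B) of the reproducing
kernel and its reproducing property, this last integral is phi(X, L).

The sums involved are finite: orthonormality forces the fundamental domain to have
finite volume, while each class of lattices in the genus occupies a volume at
least the reciprocal of Minkowski's bound on the order of a finite group of
integral matrices. *)

(** * Integrality in Q_p *)

(** The constant in the identity is 1 because of the normalization: the Haar measure gives mass 1 to
    [maximal_compact], and the adeles with a prescribed lattice form a left translate of it,
    whatever the volume of the fundamental domain. Such a fibre is stable under O_A(R) embedded with
    trivial finite part, so it serves as a probability space with O_A(R)-action. The real group gets
    no Haar measure of its own: means over V_{A,B}(R) are compared with means over a fibre.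

    Finiteness is also forced by the encodings: the sum in [weyl_sum] takes the value 0 on an
    infinite support, and a signed sum is exchanged with an integral only under integrability. No
    reduction theory enters. Finiteness of each stabilizer separately would still allow infinitely
    many classes of small total volume, so a bound uniform over all lattices is required; it comes
    from reduction modulo 3, where modulus 2 would fail because -1 is congruent to 1. *)

Section PadicIntegers.
Variable p : prime_idx.
Local Notation P := ((val p)%:R : rat).

Lemma zloc_nat (k : nat) : zloc p k%:R.
Proof. exact: (zloc_int p k). Qed.

Lemma ratr_padicD (r s : rat) : ratr (r + s) = ratr r + ratr s :> padic p.
Proof. by rewrite -!padic_of_ratE rmorphD. Qed.
Lemma ratr_padicN (r : rat) : ratr (- r) = - ratr r :> padic p.
Proof. by rewrite -!padic_of_ratE rmorphN. Qed.
Lemma ratr_padicM (r s : rat) : ratr (r * s) = ratr r * ratr s :> padic p.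
Proof. by rewrite -!padic_of_ratE rmorphM. Qed.
Lemma ratr_padic_eq0 (r : rat) : (ratr r == 0 :> padic p) = (r == 0).
Proof. by rewrite -padic_of_ratE fmorph_eq0. Qed.
Lemma ratr_padic_nat (k : nat) : ratr k%:R = k%:R :> padic p.
Proof. by rewrite -padic_of_ratE rmorph_nat. Qed.

Lemma padic_intN (u : padic p) : padic_int u -> padic_int (- u).
Proof.
move=> hu; rewrite -mulN1r; apply: padic_intM => //.
have -> : -1 = ratr (-1) :> padic p by rewrite ratr_padicN (ratr_padic_nat 1).
by apply: padic_int_ratr; rewrite zlocN zloc1.
Qed.

Lemma padic_intB (u v : padic p) : padic_int u -> padic_int v -> padic_int (u - v).
Proof. by move=> hu hv; apply: padic_intD => //; exact: padic_intN. Qed.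

Lemma padic_int_sign (k : nat) : padic_int ((-1) ^+ k : padic p).
Proof.
elim: k => [|k IH]; first by rewrite expr0; exact: padic_int1.
by rewrite exprS mulN1r; exact: padic_intN.
Qed.

Lemma padic_int_nat (k : nat) : padic_int (k%:R : padic p).
Proof. by rewrite -ratr_padic_nat; apply: padic_int_ratr; exact: zloc_nat. Qed.

Lemma padic_int_sum (I : Type) (s : seq I) (F : I -> padic p) :
  (forall i, padic_int (F i)) -> padic_int (\sum_(i <- s) F i).
Proof.
move=> h; elim/big_ind: _ => // [|x y]; first exact: padic_int0.
exact: padic_intD.
Qed.

Lemma padic_int_prod (I : Type) (s : seq I) (F : I -> padic p) :
  (forall i, padic_int (F i)) -> padic_int (\prod_(i <- s) F i).
Proof.
move=> h; elim/big_ind: _ => // [|x y]; first exact: padic_int1.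
exact: padic_intM.
Qed.

(** Membership in Z_p asks for a representative with every term in Z_(p); freezing the terms before
    N at the value [x N] changes the sequence by a null sequence only. *)
Lemma padic_int_eventually (x : padic_seq p) :
  (exists N : nat, forall i, (N <= i)%N -> zloc p (x i)) -> padic_int (to_padic x).
Proof.
move=> [N hN].
have yc : (fun i => x (maxn N i)) \in pcauchy p.
  apply/pcauchyP => k; have [M hM] := (pcauchyP _ _ (valP x)) k.
  by exists M => i j Mi Mj; apply: hM; rewrite leq_max ?Mi ?Mj orbT.
exists (PadicSeq yc); last by move=> i; apply: hN; rewrite leq_maxl.
apply/to_padic_eq/pnullP => k; exists N => i Ni.
have -> : (x - PadicSeq yc) i = x i - x (maxn N i) by [].
by rewrite (maxn_idPr Ni) subrr mul0r zloc0.
Qed.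

Lemma padic_int_rat (r : rat) : padic_int (ratr r : padic p) <-> zloc p r.
Proof.
split=> [|/padic_int_ratr//].
rewrite -padic_of_ratE => -[x /to_padic_eq /pnullP /(_ 0%N)[N /(_ N (leqnn _))]].
rewrite expr0 divr1 => h /(_ N) h'; rewrite -[r](subrK (x N)).
by apply: zlocD.
Qed.

Lemma padic_rat_approx (u : padic p) : exists r : rat, padic_int (u - ratr r).
Proof.
have [x ->] := padicW u; have [N hN] := (pcauchyP _ _ (valP x)) 0%N.
exists (x N); rewrite -padic_of_ratE /padic_of_rat.
set c := PadicSeq _.
have -> : to_padic x - to_padic c = to_padic (x - c).
  by apply/eqP; rewrite subr_eq -to_padicD subrK.
apply: padic_int_eventually; exists N => i Ni.
have -> : (x - c) i = x i - x N by [].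
by have := hN i N Ni (leqnn _); rewrite expr0 divr1.
Qed.

Lemma padic_denominator (u : padic p) :
  exists2 N : nat, (0 < N)%N & padic_int (u * N%:R).
Proof.
have [r hr] := padic_rat_approx u.
exists `|denq r|%N; first by rewrite absz_gt0 denq_eq0.
rewrite -[u](subrK (ratr r)) mulrDl; apply: padic_intD.
  by apply: padic_intM => //; exact: padic_int_nat.
rewrite -ratr_padic_nat -ratr_padicM; apply: padic_int_ratr.
by rewrite [X in _ * X]pmulrn absz_denq -numqE zloc_int.
Qed.

(** Partial fractions: for r = z / (b p^e) with b prime to p, a Bezout relation u b + v p^e = 1
    gives s = z u / p^e, and r - s = z v / b. This is the approximation that lets one rational
    vector be prescribed at p while staying integral at all other primes. *)
Lemma zloc_approx (r : rat) :
  exists2 s : rat, zloc p (r - s) & forall q : prime_idx, q <> p -> zloc q s.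
Proof.
have [e /zlocP[b pb [z hz]]] := zloc_bound p r.
have pp : prime (val p) := valP p.
have b0 : (b%:R : rat) != 0 by rewrite pnatr_eq0; apply: contraNneq pb => ->; exact: dvdn0.
have P0 : P ^+ e != 0 by rewrite expf_neq0 // pnatr_eq0 -lt0n prime_gt0.
have cop : coprimez b%:Z ((val p) ^ e)%N%:Z.
  rewrite /coprimez /gcdz /= -[_ == _]/(coprime b (val p ^ e)).
  by rewrite coprimeXr // coprime_sym prime_coprime.
have [[u v] /= huv] := coprimezP _ _ cop.
have huv' : u%:~R * b%:R + v%:~R * P ^+ e = 1 :> rat.
  by rewrite -natrX -[in RHS](rmorph1 (intr : int -> rat)) -huv rmorphD /= !rmorphM.
have rE : r = z%:~R / (b%:R * P ^+ e) by rewrite -hz; field; rewrite b0 P0.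
exists (z%:~R * u%:~R / P ^+ e).
  apply/zlocP; exists b => //; exists (z * v).
  rewrite rE rmorphM /=.
  have -> : v%:~R = (1 - u%:~R * b%:R) / P ^+ e.
    by apply: (canRL (mulfK P0)); apply/eqP; rewrite eq_sym subr_eq addrC huv'.
  by field; rewrite b0 P0.
move=> q qp; apply/zlocP; exists (val p ^ e)%N.
  rewrite Euclid_dvdX ?(valP q)//; apply/negP => /andP[].
  rewrite dvdn_prime2 ?(valP q)// => /eqP qE _; apply: qp; exact: val_inj.
by exists (z * u); rewrite natrX divfK// rmorphM.
Qed.

End PadicIntegers.

Lemma zloc_all_int (r : rat) : (forall p, zloc p r) -> r \is a Num.int.
Proof.
move=> h; have d0 : (0 < `|denq r|)%N by rewrite absz_gt0 denq_eq0.
have d1 : (`|denq r| = 1)%N.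
  apply/eqP; rewrite eqn_leq d0 andbT leqNgt; apply/negP => d1.
  have := h (exist (fun k => prime k) _ (pdiv_prime d1)).
  by rewrite /zloc /= pdiv_dvd.
rewrite Qint_def; apply/eqP.
by rewrite -absz_denq d1.
Qed.

Section PadicMatrices.
Variable p : prime_idx.

Lemma qmx_padicE a b (M : 'M[rat]_(a, b)) :
  qmx (padic p) M = map_mx (@padic_of_rat p) M.
Proof. by apply/matrixP => i j; rewrite !mxE padic_of_ratE. Qed.

Lemma qmx_padicM a b c (M : 'M[rat]_(a, b)) (N : 'M[rat]_(b, c)) :
  qmx (padic p) (M *m N) = qmx _ M *m qmx _ N.
Proof. by rewrite !qmx_padicE map_mxM. Qed.

Lemma qmx_padic_inv a (M : 'M[rat]_a) : qmx (padic p) (invmx M) = invmx (qmx _ M).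
Proof. by rewrite !qmx_padicE map_invmx. Qed.

Lemma qmx_padic_unit a (M : 'M[rat]_a) : (qmx (padic p) M \in unitmx) = (M \in unitmx).
Proof. by rewrite qmx_padicE map_unitmx. Qed.

Lemma padic_int_mxD a b (M N : 'M[padic p]_(a, b)) :
  padic_int_mx M -> padic_int_mx N -> padic_int_mx (M + N).
Proof. by move=> hM hN i j; rewrite mxE; apply: padic_intD. Qed.

Lemma padic_int_mxZ a b c (M : 'M[padic p]_(a, b)) :
  padic_int c -> padic_int_mx M -> padic_int_mx (c *: M).
Proof. by move=> hc hM i j; rewrite mxE; apply: padic_intM. Qed.

Lemma padic_int_mx1 a : padic_int_mx (1%:M : 'M[padic p]_a).
Proof. by move=> i j; rewrite mxE; case: eqP => _; [exact: padic_int1|exact: padic_int0]. Qed.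

Lemma padic_int_det a (M : 'M[padic p]_a) : padic_int_mx M -> padic_int (\det M).
Proof.
move=> h; apply: padic_int_sum => s; apply: padic_intM; last exact: padic_int_prod.
exact: padic_int_sign.
Qed.

Lemma padic_int_adj a (M : 'M[padic p]_a) : padic_int_mx M -> padic_int_mx (\adj M).
Proof.
move=> h i j; rewrite mxE; apply: padic_intM; first exact: padic_int_sign.
by apply: padic_int_det => k l; rewrite !mxE.
Qed.

Lemma padic_mx_denominator a b (M : 'M[padic p]_(a, b)) :
  exists2 N : nat, (0 < N)%N & padic_int_mx (N%:R *: M).
Proof.
have /choice[N hN] (ij : 'I_a * 'I_b) :
    exists N : nat, (0 < N)%N /\ padic_int (M ij.1 ij.2 * N%:R).
  by have [N N0 h] := padic_denominator (M ij.1 ij.2); exists N.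
exists (\prod_ij N ij)%N; first by apply: prodn_gt0 => ij; have [] := hN ij.
move=> i j; rewrite mxE (bigD1 (i, j)) //= natrM mulrAC.
apply: padic_intM; last exact: padic_int_nat.
by rewrite mulrC; have [_] := hN (i, j).
Qed.

End PadicMatrices.

(** * Lattices and adelic isometries *)

Section IntegralForm.
Variables (R : realType) (m : nat) (A : 'M[int]_m).
Hypothesis hA : pos_def (zmx R A).

Lemma pos_def_unit k (S : 'M[R]_k) : pos_def S -> S \in unitmx.
Proof.
move=> [_ pS]; rewrite unitmxE unitfE; apply/negP => /det0P[v v0 vS].
have v0' : v^T != 0 by rewrite -trmx0 (inj_eq (can_inj trmxK)).
by have := pS v^T v0'; rewrite trmxK vS mul0mx mxE ltxx.
Qed.

Lemma form_det_neq0 : \det A != 0.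
Proof.
have := pos_def_unit hA; rewrite unitmxE unitfE.
by rewrite (det_map_mx (intr : int -> R)) intr_eq0.
Qed.

Lemma zmx_unit_num (K : numFieldType) : zmx K A \in unitmx.
Proof.
by rewrite unitmxE unitfE (det_map_mx (intr : int -> K)) intr_eq0 form_det_neq0.
Qed.

Lemma zmx_unit_padic p : zmx (padic p) A \in unitmx.
Proof.
have -> : zmx (padic p) A = qmx (padic p) (zmx rat A).
  by apply/matrixP => i j; rewrite !mxE ratr_int.
by rewrite qmx_padic_unit zmx_unit_num.
Qed.

Section Field.
Variable K : fieldType.
Hypothesis AK : zmx K A \in unitmx.

Lemma orth_unit (g : 'M[K]_m) : orth A g -> g \in unitmx.
Proof. by move=> gA; move: AK; rewrite -gA !unitmx_mul => /andP[]. Qed.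

Lemma orthV (g : 'M[K]_m) : orth A g -> orth A (invmx g).
Proof.
move=> gA; have gu := orth_unit gA; rewrite /orth /= -{1}gA.
by rewrite !mulmxA -trmx_mul mulmxV// trmx1 mul1mx mulmxK.
Qed.

(** Expresses the inverse linearly in the entries of g, from which measurability of inversion
    follows. *)
Lemma orth_invE (g : 'M[K]_m) : orth A g -> invmx g = invmx (zmx K A) *m g^T *m zmx K A.
Proof.
move=> gA; have gu := orth_unit gA.
rewrite -[RHS](mulmxK gu) -(mulmxA _ g^T) -(mulmxA _ (g^T *m _)) gA.
by rewrite mulVmx// mul1mx.
Qed.

Lemma orth_det (g : 'M[K]_m) : orth A g -> \det g * \det g = 1.
Proof.
move=> /(congr1 determinant); rewrite !det_mulmx det_tr mulrAC => h.
apply: (mulIf (x := \det (zmx K A))); first by rewrite -unitfE -unitmxE.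
by rewrite mul1r.
Qed.

Lemma orth_repr_var n (C : 'M[K]_n) (g : 'M[K]_m) (X : 'M[K]_(m, n)) :
  orth A g -> repr_var A C X -> repr_var A C (g *m X).
Proof.
rewrite /orth /repr_var /= => gA XA; rewrite trmx_mul !mulmxA.
by rewrite -(mulmxA X^T) -(mulmxA X^T) gA.
Qed.

End Field.

Lemma orth_int_inv p (g : 'M[padic p]_m) :
  orth A g -> padic_int_mx g -> padic_int_mx (invmx g).
Proof.
move=> gA gi; have := orth_det (zmx_unit_padic p) gA => d2.
have gu := orth_unit (zmx_unit_padic p) gA.
rewrite /invmx gu; apply: padic_int_mxZ; last exact: padic_int_adj.
have d0 : \det g != 0 by rewrite -unitfE -unitmxE.
have -> : (\det g)^-1 = \det g by apply: (mulIf d0); rewrite mulVf.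
exact: padic_int_det.
Qed.

(** A relation on components rather than a function: the integrality proofs stored in the record are
    irrelevant to every use of the inverse. *)
Definition adelic_inv_spec (a b : adelic_orth R A) : Prop :=
  arch b = invmx (arch a) /\ forall p, fin b p = invmx (fin a p).

Lemma adelic_inv_ex (a : adelic_orth R A) : exists b, adelic_inv_spec a b.
Proof.
have h1 : orth A (invmx (arch a)) by apply: orthV (arch_orth a); exact: zmx_unit_num.
have h2 p : orth A (invmx (fin a p)).
  by apply: orthV (fin_orth a p); exact: zmx_unit_padic.
have h3 : exists N : nat, forall p, (N < val p)%N -> padic_int_mx (invmx (fin a p)).
  have [N hN] := fin_int a; exists N => p /hN.
  exact/orth_int_inv/fin_orth.
by exists (@AdelicOrth R m A _ _ h1 h2 h3).
Qed.

Lemma adelic_denominator (a : adelic_orth R A) :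
  exists2 N : nat, (0 < N)%N & forall p, padic_int_mx (N%:R *: fin a p).
Proof.
have [N hN] := fin_int a.
have /choice[M hM] (p : prime_idx) : exists M : nat, (0 < M)%N /\
   padic_int_mx (M%:R *: fin a p).
  by have [M M0 h] := padic_mx_denominator (fin a p); exists M.
(* Only the primes up to the integrality bound need a denominator; the value 1 at the other indices
   makes their product a product over [k < N.+1]. *)
pose M' (k : nat) := if insub k is Some p then M p else 1%N.
exists (\prod_(k < N.+1) M' k)%N.
  by apply: prodn_gt0 => k; rewrite /M'; case: insubP => // p _ _; have [] := hM p.
move=> p; have [pN|/hN pi] := leqP (val p) N; last first.
  by apply: padic_int_mxZ => //; exact: padic_int_nat.
rewrite (bigD1 (Ordinal (pN : (val p < N.+1)%N))) //= /M' valK mulnC natrM -scalerA.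
by apply: padic_int_mxZ; [exact: padic_int_nat|have [] := hM p].
Qed.

End IntegralForm.

(** * Lattices of Q^m and their localizations *)

Section Lattice.
Variable m : nat.
Local Notation std := (@std_lattice m).

Lemma std_localP (v : 'cV[rat]_m) :
  std v <-> forall p, padic_int_mx (qmx (padic p) v).
Proof.
split=> [h p i j|h i].
  by rewrite ord1 mxE; have /intrP[z ->] := h i; apply: padic_int_ratr; exact: zloc_int.
by apply: zloc_all_int => p; apply/padic_int_rat; have := h p i 0; rewrite mxE.
Qed.

Lemma localize_image p (M : 'M[rat]_m) :
  localize (p := p) [set M *m z | z in std] =
  [set qmx (padic p) M *m z | z in @padic_int_mx p m 1].
Proof.
apply/seteqP; split=> w.
  move=> [k [c [v [hc hv ->]]]].
  have /choice[z hz] i : exists z, std z /\ M *m z = v i.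
    by have [z] := hv i; exists z.
  exists (\sum_i c i *: qmx (padic p) (z i)).
    move=> i j; rewrite summxE; apply: padic_int_sum => l; rewrite mxE.
    apply: padic_intM => //; have [/std_localP/(_ p)] := hz l; exact.
  rewrite mulmx_sumr; apply: eq_bigr => i _; have [_ <-] := hz i.
  by rewrite qmx_padicM scalemxAr.
move=> [z zi <-]; exists m, (fun i => z i 0), (fun i => M *m delta_mx i 0); split=> //.
  move=> i; exists (delta_mx i 0) => // j; rewrite mxE.
  by case: (_ && _).
rewrite -[LHS]/(_) {1}[z]matrix_sum_delta mulmx_sumr; apply: eq_bigr => i _.
rewrite big_ord1 qmx_padicM -scalemxAr; congr (_ *: (_ *m _)).
by rewrite qmx_padicE map_delta_mx.
Qed.

Lemma localize_std p : localize (p := p) std = @padic_int_mx p m 1.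
Proof.
have -> : std = [set 1%:M *m z | z in std].
  by apply/seteqP; split=> [v hv|v [z hz <-]]; [exists v => //|]; rewrite mul1mx.
rewrite localize_image; apply/seteqP; split=> w.
  by move=> [z zi <-]; rewrite qmx_padicE map_mx1 mul1mx.
by exists w => //; rewrite qmx_padicE map_mx1 mul1mx.
Qed.

(** Cramer's rule; it measures how a determinant shrinks when a reduced vector replaces a basis
    vector. *)
Lemma det_replace_col (K : comPzRingType) (T : 'M[K]_m) (v : 'cV[K]_m) i :
  \det (\matrix_(k, l) if l == i then v k 0 else T k l) = (\adj T *m v) i 0.
Proof.
rewrite (expand_det_col _ i) mxE; apply: eq_bigr => k _.
rewrite !mxE eqxx mulrC; congr (_ * _); rewrite /cofactor; congr (_ * \det _).
by apply/matrixP => a b; rewrite !mxE eq_sym (negbTE (neq_lift _ _)).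
Qed.

Section Subgroup.
Variable L : set 'cV[rat]_m.
Hypothesis L0 : L 0.
Hypothesis LB : forall u v, L u -> L v -> L (u - v).

Lemma subgroupD u v : L u -> L v -> L (u + v).
Proof. by move=> Lu Lv; rewrite -[v]opprK; apply: LB => //; rewrite -sub0r; apply: LB. Qed.

Lemma subgroupZ (z : int) u : L u -> L (z%:~R *: u).
Proof.
move=> Lu; have LN (k : nat) : L (k%:R *: u).
  elim: k => [|k IH]; first by rewrite scale0r.
  by rewrite -natr1 scalerDl scale1r; exact: subgroupD.
case: z => k; first exact: LN.
by rewrite NegzE mulrNz scaleNr -sub0r; apply: LB => //; exact: LN.
Qed.

Lemma subgroup_mul (T : 'M[rat]_m) z :
  (forall i, L (col i T)) -> std z -> L (T *m z).
Proof.
move=> LT sz.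
have -> : T *m z = \sum_i z i 0 *: col i T.
  apply/matrixP => k l; rewrite !mxE summxE; apply: eq_bigr => j _.
  by rewrite !mxE mulrC ord1.
elim/big_ind: _ => // [|i _]; first exact: subgroupD.
by have /intrP[c ->] := sz i; exact: subgroupZ.
Qed.

(* A basis is given by any matrix of minimal nonzero determinant with columns in
   L: reducing an element of L modulo its columns and substituting the result
   for one of them would decrease the determinant. *)
Lemma is_lattice_subgroup (N : nat) : (0 < N)%N ->
  (forall v, L v -> std (N%:R *: v)) -> (forall v, std v -> L (N%:R *: v)) ->
  is_lattice L.
Proof.
move=> N0 LN NL; have N0' : N%:R != 0 :> rat by rewrite pnatr_eq0 -lt0n.
pose bas (T : 'M[rat]_m) := forall i, L (col i T).
pose P d := `[< exists T (M : 'M[int]_m), [/\ bas T, zmx rat M = N%:R *: T &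
   `|\det M|%N = d] >] && (0 < d)%N.
have exP : exists d, P d.
  exists ((N ^ 2) ^ m)%N; rewrite /P !expn_gt0 N0 /= andbT; apply/asboolP.
  exists (N%:R%:M), ((N ^ 2)%N%:Z%:M); split.
  - move=> i; have -> : col i (N%:R%:M) = N%:R *: delta_mx i 0 :> 'cV[rat]_m.
      apply/matrixP => k l; rewrite !mxE ord1 !eqxx andbT.
      by case: eqP; rewrite ?mulr1 ?mulr0.
    by apply: NL => j; rewrite mxE; case: (_ && _).
  - apply/matrixP => k l; rewrite !mxE; case: eqP; rewrite ?mulr0n ?mulr0 ?mulr1n//.
    by move=> _; rewrite -[LHS]/((N ^ 2)%N%:R) natrX.
  - by rewrite det_scalar abszX.
case: (ex_minnP exP) => d /andP[/asboolP[T [M [bT MT Md]]] d0] dmin.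
have detT : N%:R ^+ m * \det T = (\det M)%:~R.
  by rewrite -detZ -MT (det_map_mx (intr : int -> rat)).
have Tu : T \in unitmx.
  rewrite unitmxE unitfE; apply: contraTneq d0 => T0.
  move: detT; rewrite T0 mulr0 => /esym/eqP; rewrite intr_eq0 => /eqP M0.
  by rewrite -Md M0.
exists T => //; apply/seteqP; split=> v; last first.
  by move=> [z sz <-]; exact: subgroup_mul.
move=> Lv; pose x := invmx T *m v; exists x; last by rewrite mulKVmx.
move=> i; apply/intrP; exists (Num.floor (x i 0)).
pose f : 'cV[rat]_m := \col_k (Num.floor (x k 0))%:~R.
pose y := x - f; have Lv' : L (T *m y).
  rewrite mulmxBr mulKVmx//; apply: LB => //; apply: subgroup_mul => // k.
  by rewrite mxE; apply/intrP; eexists.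
have yE : y i 0 = x i 0 - (Num.floor (x i 0))%:~R.
  by rewrite /y mxE; congr (_ + _); rewrite 2!mxE.
have yi : 0 <= y i 0 < 1.
  rewrite yE subr_ge0 ltrBlDl; have /andP[-> h] := floor_itv (x i 0).
  by move: h; rewrite intrD.
suff : y i 0 = 0 by rewrite yE => /eqP; rewrite subr_eq0 => /eqP.
apply/eqP; case/andP: yi => yi0 yi1; rewrite eq_le yi0 andbT leNgt; apply/negP => yp.
pose T' : 'M[rat]_m := \matrix_(k, l) if l == i then (T *m y) k 0 else T k l.
have detT' : \det T' = \det T * y i 0.
  by rewrite det_replace_col mulmxA mul_adj_mx mul_scalar_mx mxE.
have bT' l : L (col l T').
  have [->|li] := eqVneq l i.
    have -> : col i T' = T *m y => //.
    by apply/matrixP => k j; rewrite !mxE eqxx ord1.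
  have -> : col l T' = col l T => //.
  by apply/matrixP => k j; rewrite !mxE (negbTE li).
have /choice[M' hM'] (kl : 'I_m * 'I_m) : exists z : int, N%:R * T' kl.1 kl.2 = z%:~R.
  by have /intrP := LN _ (bT' kl.2) kl.1; rewrite !mxE.
pose M'' : 'M[int]_m := \matrix_(k, l) M' (k, l).
have MT' : zmx rat M'' = N%:R *: T' by apply/matrixP => k l; rewrite !mxE -hM' !mxE.
have detM' : (\det M'')%:~R = (\det M)%:~R * y i 0 :> rat.
  by rewrite -(det_map_mx (intr : int -> rat)) -[map_mx _ _]/(zmx _ _) MT' detZ detT' mulrA detT.
have absM : (`|\det M''|%N)%:R = d%:R * y i 0 :> rat.
  by rewrite -Md !natr_absz !intr_norm detM' normrM (ger0_norm yi0).
have d0' : 0 < d%:R :> rat by rewrite ltr0n.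
have : (d <= `|\det M''|)%N.
  apply: dmin; apply/andP; split; first by apply/asboolP; exists T', M''.
  by rewrite -(ltr_nat rat) absM mulr_gt0.
by rewrite -(ler_nat rat) absM leNgt gtr_pMr// yi1.
Qed.

End Subgroup.
End Lattice.

Lemma invmxM (K : comUnitRingType) n (g h : 'M[K]_n) :
  g \in unitmx -> h \in unitmx -> invmx (g *m h) = invmx h *m invmx g.
Proof.
move=> gu hu; have ghu : g *m h \in unitmx by rewrite unitmx_mul gu.
by rewrite -[RHS](mulKmx ghu) -mulmxA mulKVmx// mulmxV// mulmx1.
Qed.

(** * Adelic isometries parametrize the genus *)

Section AdelicLattice.
Variables (R : realType) (m : nat) (A : 'M[int]_m).
Hypothesis hA : pos_def (zmx R A).
Local Notation G := (adelic_orth R A).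
Local Notation std := (@std_lattice m).

(* the lattice of Q^m with completions [fin a p Z_p^m] *)
Definition lat (a : G) : set 'cV[rat]_m :=
  [set v | forall p, padic_int_mx (invmx (fin a p) *m qmx (padic p) v)].

Lemma fin_unit (a : G) p : fin a p \in unitmx.
Proof. exact (orth_unit (zmx_unit_padic hA p) (fin_orth a p)). Qed.

Lemma arch_unit (a : G) : arch a \in unitmx.
Proof. exact (orth_unit (zmx_unit_num hA R) (arch_orth a)). Qed.

Lemma adelic_actE n (a : G) (X : 'M[R]_(m, n)) :
  adelic_act a (X, std) = (arch a *m X, lat a).
Proof.
rewrite /adelic_act /=; congr pair; apply/seteqP; split=> v hv p.
  have [w] := hv p; rewrite localize_std => wi ->.
  by rewrite mulKmx// fin_unit.
exists (invmx (fin a p) *m qmx (padic p) v); first by rewrite localize_std; exact: hv.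
by rewrite mulKVmx// fin_unit.
Qed.

Lemma adelic_denominators (a : G) : exists2 N : nat, (0 < N)%N &
  forall p, padic_int_mx (N%:R *: fin a p) /\ padic_int_mx (N%:R *: invmx (fin a p)).
Proof.
have [b [_ hb]] := adelic_inv_ex hA a.
have [M M0 hM] := adelic_denominator a.
have [N N0 hN] := adelic_denominator b.
exists (M * N)%N => [|p]; first by rewrite muln_gt0 M0.
split; [rewrite mulnC|rewrite -hb]; rewrite natrM -scalerA;
  by apply: padic_int_mxZ; first exact: padic_int_nat.
Qed.

Lemma qmx_padicZ p k (N : nat) (v : 'cV[rat]_k) :
  qmx (padic p) (N%:R *: v) = N%:R *: qmx (padic p) v.
Proof. by apply/matrixP => i j; rewrite !mxE ratr_padicM ratr_padic_nat. Qed.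

Lemma lat0 (a : G) : lat a 0.
Proof.
move=> p; rewrite qmx_padicE map_mx0 mulmx0 => i j; rewrite mxE; exact: padic_int0.
Qed.

Lemma latB (a : G) u v : lat a u -> lat a v -> lat a (u - v).
Proof.
move=> hu hv p i j; rewrite qmx_padicE map_mxB -!qmx_padicE mulmxBr mxE [X in _ + X]mxE.
by apply: padic_intB; [exact: hu|exact: hv].
Qed.

Lemma lat_is_lattice (a : G) : is_lattice (lat a).
Proof.
have [N N0 hN] := adelic_denominators a.
apply: (is_lattice_subgroup (lat0 a) (@latB a) N0) => v hv.
  apply/std_localP => p; have [h _] := hN p.
  rewrite qmx_padicZ -[qmx _ v](mulKVmx (fin_unit a p)) scalemxAl.
  by apply: padic_int_mxM => //; exact: hv.
move=> p; have [_ h] := hN p.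
by rewrite qmx_padicZ -scalemxAr scalemxAl; apply: padic_int_mxM => //;
  move/std_localP: hv; exact.
Qed.

(** The content is in the inclusion from right to left: a p-adic vector has to be generated by
    rational vectors that satisfy the lattice condition at all primes simultaneously. *)
Lemma localize_lat (a : G) p :
  localize (p := p) (lat a) = [set fin a p *m z | z in @padic_int_mx p m 1].
Proof.
apply/seteqP; split=> w.
  move=> [k [c [v [hc hv ->]]]].
  exists (\sum_i c i *: (invmx (fin a p) *m qmx (padic p) (v i))).
    move=> i j; rewrite summxE; apply: padic_int_sum => l; rewrite mxE.
    by apply: padic_intM => //; exact: hv.
  rewrite mulmx_sumr; apply: eq_bigr => i _.
  by rewrite -scalemxAr mulKVmx// fin_unit.
move=> [z zi wE]; have [N N0 hN] := adelic_denominators a.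
have N0' : N%:R != 0 :> padic p.
  by rewrite -ratr_padic_nat ratr_padic_eq0 pnatr_eq0 -lt0n.
(* [w / N] is congruent modulo [Z_p^m] to a rational vector [r] that is integral
   away from p. *)
have /choice[r hr] (i : 'I_m) : exists s : rat, padic_int (w i 0 / N%:R - ratr s) /\
    forall q : prime_idx, q <> p -> zloc q s.
  have [s hs] := padic_rat_approx (w i 0 / N%:R).
  have [t st tq] := zloc_approx p s; exists t; split=> //.
  rewrite -[w i 0 / _](subrK (ratr s)) -addrA; apply: padic_intD => //.
  by rewrite -ratr_padicN -ratr_padicD; apply: padic_int_ratr.
pose v : 'cV[rat]_m := N%:R *: \col_i r i.
pose d : 'cV[padic p]_m := \col_i (w i 0 / N%:R - ratr (r i)).
have di : padic_int_mx d by move=> i j; rewrite mxE; have [] := hr i.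
have wvd : w = qmx (padic p) v + N%:R *: d.
  apply/matrixP => i j; rewrite ord1 qmx_padicZ !mxE -mulrDr addrC subrK.
  by rewrite mulrCA divff// mulr1.
have Lv : lat a v.
  move=> q; have [_ h] := hN q; have [qp|qp] := pselect (q = p).
    subst q; have -> : qmx (padic p) v = w - N%:R *: d by rewrite wvd addrK.
    rewrite mulmxBr -wE mulKmx ?fin_unit// -scalemxAr scalemxAl.
    move=> i j; rewrite mxE [X in _ + X]mxE; apply: padic_intB; first exact: zi.
    by apply: padic_int_mxM.
  rewrite qmx_padicZ -scalemxAr scalemxAl; apply: padic_int_mxM => // i j.
  by rewrite !mxE; apply: padic_int_ratr; have [_] := hr i; exact.
have LNe i : lat a (N%:R *: delta_mx i 0).
  move=> q; have [_ h] := hN q.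
  rewrite qmx_padicZ -scalemxAr scalemxAl; apply: padic_int_mxM => // k l.
  by rewrite !mxE; apply: padic_int_ratr; case: (_ && _); [exact: zloc1|exact: zloc0].
(* The generators are the rational approximation [v], with coefficient 1, and the m vectors N e_j,
   whose p-adic coefficients [d j 0] absorb the error. *)
exists m.+1, (fun i => if unlift ord0 i is Some j then d j 0 else 1),
  (fun i => if unlift ord0 i is Some j then N%:R *: delta_mx j 0 else v); split.
- by move=> i; case: (unlift ord0 i) => [j|]; [exact (di j 0)|exact: padic_int1].
- by move=> i; case: (unlift ord0 i) => [j|]; [exact (LNe j)|exact Lv].
rewrite big_ord_recl unlift_none scale1r {1}wvd; congr (_ + _).
rewrite {1}[d]matrix_sum_delta scaler_sumr; apply: eq_bigr => i _.
rewrite big_ord1 liftK qmx_padicZ [qmx _ (delta_mx _ _)]qmx_padicE map_delta_mx.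
by rewrite !scalerA mulrC.
Qed.

Lemma genus_lat (a : G) : genus A (lat a).
Proof.
split; first exact: lat_is_lattice.
by move=> p; exists (fin a p); [exact: fin_orth|exact: localize_lat].
Qed.

Lemma image_padic_int p (g h : 'M[padic p]_m) : g \in unitmx ->
  [set h *m z | z in @padic_int_mx p m 1] `<=`
  [set g *m z | z in @padic_int_mx p m 1] -> padic_int_mx (invmx g *m h).
Proof.
move=> gu sub i j.
have [|z zi gz] := sub (h *m delta_mx j 0).
  by exists (delta_mx j 0) => // k l; rewrite mxE; case: (_ && _); [exact: padic_int1|exact: padic_int0].
have := zi i 0; rewrite -[z](mulKmx gu) gz mulmxA -colE mxE; exact.
Qed.

(** Integrality in one direction suffices: an isometry has determinant 1 or -1, so an integral one
    has an integral inverse. *)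
Lemma lat_eqP (a b : G) :
  lat a = lat b <-> forall p, padic_int_mx (invmx (fin a p) *m fin b p).
Proof.
split=> [ab p|h].
  apply: image_padic_int; first exact: fin_unit.
  by rewrite -!localize_lat ab.
have h' p : padic_int_mx (invmx (fin b p) *m fin a p).
  have := orth_int_inv hA _ (h p); rewrite invmxM ?invmxK; last first.
  - by rewrite fin_unit.
  - by rewrite unitmx_inv fin_unit.
  apply; apply: orthM (fin_orth b p); apply: orthV (fin_orth a p).
  exact (zmx_unit_padic hA p).
apply/seteqP; split=> v hv p.
  rewrite -[qmx _ v](mulKVmx (fin_unit a p)) (mulmxA (invmx (fin b p))).
  exact (padic_int_mxM (h' p) (hv p)).
rewrite -[qmx _ v](mulKVmx (fin_unit b p)) (mulmxA (invmx (fin a p))).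
exact (padic_int_mxM (h p) (hv p)).
Qed.

(** The local isometries are chosen independently of each other. They satisfy the restricted product
    condition because [g p] and the rational basis [M] of L span the same Z_p-module, and [M] is
    p-integral for all large p. *)
Lemma genus_latP (L : set 'cV[rat]_m) : genus A L -> exists a, lat a = L.
Proof.
move=> [[M Mu LE] gL].
pose g p := projT1 (cid2 (gL p)).
have gA p : orth A (g p) by rewrite /g; case: cid2.
have gE p : localize (p := p) L = [set g p *m z | z in @padic_int_mx p m 1].
  by rewrite /g; case: cid2.
have gu p : g p \in unitmx := orth_unit (zmx_unit_padic hA p) (gA p).
have gM p : [set g p *m z | z in @padic_int_mx p m 1] =
    [set qmx (padic p) M *m z | z in @padic_int_mx p m 1].
  by rewrite -gE LE localize_image.
have gi : exists N : nat, forall p, (N < val p)%N -> padic_int_mx (g p).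
  have [N hN] := qmx_int M; exists N => p /hN Mi.
  rewrite -[g p](mulKVmx (_ : qmx (padic p) M \in unitmx)) ?qmx_padic_unit//.
  apply: padic_int_mxM => //; apply: image_padic_int; rewrite ?qmx_padic_unit//.
  by rewrite gM.
exists (@AdelicOrth R m A 1%:M g (orth1 A R) gA gi); rewrite LE.
apply/seteqP; split=> v; last first.
  move=> [z /std_localP zi <-] p /=; have : [set g p *m z | z in @padic_int_mx p m 1]
      (qmx (padic p) (M *m z)).
    by rewrite gM; exists (qmx (padic p) z) => //; rewrite qmx_padicM.
  by move=> [y yi <-]; rewrite (mulKmx (gu p)); exact yi.
move=> hv; exists (invmx M *m v); last by rewrite mulKVmx.
apply/std_localP => p; have : [set qmx (padic p) M *m z | z in @padic_int_mx p m 1]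
    (qmx (padic p) v).
  rewrite -gM; exists (invmx (g p) *m qmx (padic p) v); first exact: (hv p).
  exact (mulKVmx (gu p) _).
move=> [z zi Mz]; have Mpu : qmx (padic p) M \in unitmx by rewrite qmx_padic_unit.
by rewrite qmx_padicM -Mz qmx_padic_inv (mulKmx Mpu).
Qed.

Lemma qmx_archM a b c (M : 'M[rat]_(a, b)) (N : 'M[rat]_(b, c)) :
  qmx R (M *m N) = qmx R M *m qmx R N.
Proof. exact: map_mxM. Qed.

Lemma lat_diag (g : rat_orth A) (a : G) :
  lat (adelic_mul (diag R g) a) = [set proj1_sig g *m v | v in lat a].
Proof.
have gu : proj1_sig g \in unitmx.
  exact (orth_unit (zmx_unit_num hA rat) (proj2_sig g)).
have gpu p : qmx (padic p) (proj1_sig g) \in unitmx by rewrite qmx_padic_unit.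
apply/seteqP; split=> v /=.
  move=> hv; exists (invmx (proj1_sig g) *m v); last by rewrite mulKVmx.
  move=> p; have := hv p; rewrite /= (invmxM (gpu p) (fin_unit a p)).
  by rewrite qmx_padicM qmx_padic_inv mulmxA.
move=> [w hw <-] p; rewrite /= (invmxM (gpu p) (fin_unit a p)).
by rewrite qmx_padicM mulmxA (mulmxKV (gpu p)); exact: (hw p).
Qed.

End AdelicLattice.

(** * Finiteness of representations and stabilizers *)

Section PositiveForms.
Variables (R : realType) (k : nat) (S : 'M[R]_k).
Hypothesis hS : pos_def S.

Lemma pos_def_ge0 (x : 'cV[R]_k) : 0 <= (x^T *m S *m x) 0 0.
Proof.
have [->|x0] := eqVneq x 0; first by rewrite mulmx0 mxE.
by case: hS => _ /(_ x x0)/ltW.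
Qed.

(* Positivity at [x - y] and [x + y], where [S y] is the i-th basis vector. *)
Lemma pos_def_coord_le (x : 'cV[R]_k) i :
  `|x i 0| *+ 2 <= (x^T *m S *m x) 0 0 + invmx S i i.
Proof.
have Su := pos_def_unit hS; have [symS _] := hS.
pose y : 'cV[R]_k := invmx S *m delta_mx i 0.
have Sy : S *m y = delta_mx i 0 by rewrite mulKVmx.
have xSy : x^T *m S *m y = (x i 0)%:M.
  by rewrite -mulmxA Sy -colE; apply/matrixP => a b; rewrite !ord1 !mxE eqxx.
have ySx : y^T *m S *m x = (x i 0)%:M.
  have <- : (x^T *m S *m y)^T = y^T *m S *m x by rewrite !trmx_mul trmxK symS mulmxA.
  by rewrite xSy tr_scalar_mx.
have ySy : y^T *m S *m y = (invmx S i i)%:M.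
  rewrite -mulmxA Sy -colE; apply/matrixP => a b.
  have yi : y i 0 = invmx S i i by rewrite /y -colE mxE.
  by rewrite !ord1 mxE mxE [RHS]mxE eqxx mulr1n -yi.
have e t : 0 <= (x^T *m S *m x) 0 0 - t * x i 0 - t * x i 0 + t * t * invmx S i i.
  have := pos_def_ge0 (x - t *: y).
  have -> : (x - t *: y)^T = x^T - t *: y^T by rewrite linearB linearZ.
  rewrite 2!mulmxBl !mulmxBr -!scalemxAl -!scalemxAr.
  rewrite xSy ySx ySy scalerA !mxE eqxx !mulr1n.
  by rewrite opprD opprK !addrA.
have := e 1; have := e (-1); rewrite !mulN1r !mul1r !opprK => h1 h2.
move: ((x^T *m S *m x) 0 0) (invmx S i i) (x i 0) h1 h2 => q s u h1 h2.
by rewrite mulr2n; have [|] := ger0P u => _; lra.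
Qed.

End PositiveForms.

Section FiniteRepresentations.
Variables (R : realType) (m : nat) (A : 'M[int]_m).
Hypothesis hA : pos_def (zmx R A).

Lemma repr_var_bounded n (C : 'M[R]_n) : exists2 b : R, 0 <= b &
  forall X, repr_var A C X -> forall i j, `|X i j| <= b.
Proof.
exists (\sum_j `|C j j| + \sum_i `|invmx (zmx R A) i i|).
  by apply: addr_ge0; apply: sumr_ge0.
move=> X XC i j; have := pos_def_coord_le hA (col j X) i.
have -> : ((col j X)^T *m zmx R A *m col j X) 0 0 = C j j.
  rewrite -XC !colE trmx_mul !mulmxA -(mulmxA _ X^T) -!mulmxA !mulmxA.
  rewrite -(mulmxA _ X^T) -(mulmxA _ (X^T *m _)) trmx_delta -rowE -colE.
  by rewrite !mxE.
rewrite mxE => h.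
have h1 : C j j <= \sum_j `|C j j|.
  rewrite (bigD1 j)//= ; apply: le_trans (ler_norm _) _.
  by rewrite lerDl sumr_ge0.
have h2 : invmx (zmx R A) i i <= \sum_i `|invmx (zmx R A) i i|.
  rewrite (bigD1 i)//= ; apply: le_trans (ler_norm _) _.
  by rewrite lerDl sumr_ge0.
have := normr_ge0 (X i j); lra.
Qed.

Lemma qmx_repr_var n (C : 'M[rat]_n) (X : 'M[rat]_(m, n)) :
  repr_var A C X -> repr_var A (qmx R C) (qmx R X).
Proof.
rewrite /repr_var /= => <-; rewrite !qmx_archM; congr (_ *m _ *m _).
  by apply/matrixP => i j; rewrite !mxE.
by apply/matrixP => i j; rewrite !mxE ratr_int.
Qed.

Lemma finite_repr_var n (C : 'M[rat]_n) (N : nat) : (0 < N)%N ->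
  finite_set [set X : 'M[rat]_(m, n) | repr_var A C X /\
    forall i j, N%:R * X i j \is a Num.int].
Proof.
move=> N0; have N0' : N%:R != 0 :> rat by rewrite pnatr_eq0 -lt0n.
have [b b0 hb] := repr_var_bounded (qmx R C).
pose c := (Num.bound (N%:R * b)).
(* The entries of N X are integers in [-c, c]; shifted by c they become elements of
   ['I_(c + c).+1]. *)
pose f (Y : 'M['I_(c + c).+1]_(m, n)) : 'M[rat]_(m, n) :=
  \matrix_(i, j) (((Y i j : nat)%:R - c%:R) / N%:R).
apply: (@sub_finite_set _ _ (f @` setT)); last exact/finite_image/finite_finset.
move=> X /= [XC Xi].
have hX i j : `|N%:R * X i j| <= c%:R.
  have h1 := hb _ (qmx_repr_var XC) i j.
  have h2 : N%:R * b < c%:R.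
    by apply: archi_boundP; rewrite mulr_ge0.
  rewrite -(ler_rat R) ratr_nat ltW//; apply: le_lt_trans h2.
  by rewrite ratr_norm rmorphM /= ratr_nat normrM normr_nat ler_wpM2l//; rewrite mxE in h1.
have /choice[Y hY] (ij : 'I_m * 'I_n) : exists y : 'I_(c + c).+1,
    (y : nat)%:R - c%:R = N%:R * X ij.1 ij.2.
  case: ij => i j /=; have /intrP[z zE] := Xi i j; have := hX i j; rewrite zE.
  rewrite -intr_norm -[c%:R]/(c%:~R) ler_int => zc.
  have lt : (`|(z + c)%R|%N < (c + c).+1)%N by lia.
  exists (Ordinal lt) => /=; rewrite natr_absz ger0_norm; last by lia.
  by rewrite intrD addrK.
exists (\matrix_(i, j) Y (i, j)) => //.
by apply/matrixP => i j; rewrite !mxE hY /= mulrAC mulfV// mul1r.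
Qed.

End FiniteRepresentations.

(** * Torsion congruent to 1 modulo 3 is trivial *)

Section Minkowski.
Variable m : nat.
Local Notation M := 'M[int]_m.
Definition dvdmx3 (a : nat) (Y : M) := forall i j, (3 ^+ a %| Y i j)%Z.

Lemma dvdmx3M a b Y Z : dvdmx3 a Y -> dvdmx3 b Z -> dvdmx3 (a + b) (Y * Z).
Proof.
move=> hY hZ i j; rewrite -[Y * Z]/(Y *m Z) mxE; apply: rpred_sum => k _.
by rewrite exprD dvdz_mul.
Qed.

Lemma dvdmx3D a Y Z : dvdmx3 a Y -> dvdmx3 a Z -> dvdmx3 a (Y + Z).
Proof. by move=> hY hZ i j; rewrite mxE rpredD. Qed.

Lemma dvdmx3W a b Y : (a <= b)%N -> dvdmx3 b Y -> dvdmx3 a Y.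
Proof. by move=> ab h i j; apply: dvdz_trans (h i j); exact: dvdz_exp2l. Qed.

Lemma dvdmx3_eq0 Y : (forall a, dvdmx3 a Y) -> Y = 0.
Proof.
move=> h; apply/matrixP => i j; rewrite mxE; apply/eqP; apply: contraT => y0.
have := h `|Y i j|%N i j; rewrite dvdzE abszX => /dvdn_leq.
rewrite absz_gt0 => /(_ y0); rewrite leqNgt => /negP; case.
exact: ltn_expl.
Qed.

Lemma exprD1_order2 (Y : M) l : exists Z, (1 + Y) ^+ l = 1 + Y *+ l + Y * Y * Z.
Proof.
elim: l => [|l [Z IH]]; first by exists 0; rewrite expr0 mulr0n mulr0 !addr0.
exists (Z + 1 *+ l + Y * Z); rewrite exprS IH.
rewrite !mulrDl !mulrDr !mul1r !mulr1 mulrnAr mulrnAr mulr1 mulrS !mulrA.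
move: (1 : M) (Y *+ l) (Y * Y * Z) (Y * Y *+ l) (Y * Y * Y * Z) => a b c d e.
by apply/matrixP => i j; rewrite !mxE; ring.
Qed.

(** By induction on a, Y is divisible by every power 3^(a+1). Expanding (1 + Y)^l = 1 shows that l Y
    is a multiple of Y^2, hence divisible by 3^(2a+2), and l cancels when it is not 3. For l = 3 the
    exact expansion 3 Y = -(3 Y^2 + Y^3) is divisible by 3^(a+3), which still leaves a gain of one
    power after division by 3. *)
Lemma minkowski_prime (Y : M) l :
  prime l -> (1 + Y) ^+ l = 1 -> dvdmx3 1 Y -> Y = 0.
Proof.
move=> pl Yl Y1; suff h a : dvdmx3 a.+1 Y.
  by apply: dvdmx3_eq0 => a; apply: dvdmx3W (h a).
elim: a => // a IH; have [l3|l3] := eqVneq l 3.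
  have e : Y *+ 3 = - ((Y * Y) *+ 3 + Y * Y * Y).
    move: Yl; rewrite l3 !exprS expr0 mulr1 !mulrDl !mulrDr !mul1r !mulr1 => /eqP.
    rewrite -subr_eq0 => /eqP h; apply/eqP; rewrite -addr_eq0 -[X in _ == X]h.
    rewrite !mulrA; apply/eqP; rewrite !mulrS !mulr0n !addr0.
    move: (1 : M) (Y * Y) (Y * Y * Y) => b c d.
    by apply/matrixP => i j; rewrite !mxE; ring.
  move=> i j; have h3 : dvdmx3 a.+3 ((Y * Y) *+ 3 + Y * Y * Y).
    apply: dvdmx3D; last first.
      by apply: (@dvdmx3W _ (a.+1 + a.+1 + a.+1)); [lia|do 2?apply: dvdmx3M].
    have -> : Y * Y *+ 3 = (3%:R%:M : M) * (Y * Y).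
      by rewrite -[RHS]/(_ *m _) mul_scalar_mx scaler_nat.
    apply: (@dvdmx3W _ (1 + (a.+1 + a.+1))); first by lia.
    apply: dvdmx3M; last exact: dvdmx3M.
    by move=> u v; rewrite mxE; case: eqP => _; rewrite ?mulr1n ?mulr0n ?dvdz0.
  have := h3 i j; rewrite -(opprK (_ + _)) -e mxE rpredN mulmxnE -[Y i j *+ 3]mulr_natr.
  by rewrite exprSr dvdz_mul2r.
have [Z hZ] := exprD1_order2 Y l.
have e : Y *+ l = - (Y * Y * Z).
  apply/eqP; rewrite -addr_eq0; move: hZ; rewrite Yl -addrA => /eqP.
  by rewrite -[X in X == _]addr0 (inj_eq (addrI 1)) eq_sym.
move=> i j; have hh : dvdmx3 a.+2 (Y * Y * Z).
  apply: (@dvdmx3W _ (a.+1 + a.+1 + 0)); first by lia.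
  by apply: dvdmx3M => [|u v]; [exact: dvdmx3M|rewrite expr0 dvd1z].
have := hh i j; rewrite -(opprK (Y * Y * Z)) -e mxE rpredN mulmxnE -[Y i j *+ l]mulr_natr.
rewrite Gauss_dvdzl// /coprimez /gcdz abszX.
rewrite (natz l) -[_ == _]/(coprime (3 ^ a.+2) l) coprimeXl// prime_coprime//.
by rewrite dvdn_prime2// eq_sym.
Qed.

(** Descent on the exponent: for a prime l dividing j, g^(j/l) is congruent to 1 and has l-th power
    1, so the prime case makes it 1 and j/l replaces j. *)
Lemma minkowski_torsion (g : M) j : (0 < j)%N -> g ^+ j = 1 -> dvdmx3 1 (g - 1) -> g = 1.
Proof.
elim/ltn_ind: j => j IH j0 gj g1.
have [j1|j1] := leqP j 1.
  by have -> : g = g ^+ j by rewrite (_ : j = 1)%N ?expr1//; lia.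
have pl := pdiv_prime j1; set l := pdiv j in pl.
have jE : (j = (j %/ l) * l)%N by rewrite divnK// pdiv_dvd.
have hk k : dvdmx3 1 (g ^+ k - 1).
  elim: k => [|k IHk]; first by rewrite expr0 subrr => u v; rewrite mxE dvdz0.
  rewrite exprS -[X in g * X](subrK 1) mulrDr mulr1 -addrA; apply: dvdmx3D => //.
  by apply: (@dvdmx3M 0 1) => // u v; rewrite expr0 dvd1z.
have : g ^+ (j %/ l) - 1 = 0.
  by apply: (minkowski_prime pl) => //; rewrite addrC subrK -exprM -jE.
move=> /eqP; rewrite subr_eq0 => /eqP h; apply: (IH (j %/ l)%N) => //.
  by rewrite ltn_Pdiv// prime_gt1.
by rewrite divn_gt0 ?prime_gt0// dvdn_leq// pdiv_dvd.
Qed.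

End Minkowski.

Lemma rat_mx_denominator a b (M : 'M[rat]_(a, b)) :
  exists2 N : nat, (0 < N)%N & exists M' : 'M[int]_(a, b), N%:R *: M = zmx rat M'.
Proof.
pose N := (\prod_(ij : 'I_a * 'I_b) `|denq (M ij.1 ij.2)|)%N; exists N.
  by apply: prodn_gt0 => ij; rewrite absz_gt0 denq_eq0.
have /choice[f hf] (ij : 'I_a * 'I_b) : exists z : int, N%:R * M ij.1 ij.2 = z%:~R.
  apply/intrP; rewrite /N (bigD1 ij)//= natrM mulrAC rpredM//; last exact: natr_int.
  by rewrite [X in X * _]pmulrn absz_denq mulrC -numqE; exact: intr_int.
by exists (\matrix_(i, j) f (i, j)); apply/matrixP => i j; rewrite !mxE -hf.
Qed.

Lemma zmx_inj (K : numDomainType) a b : injective (@zmx K a b).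
Proof.
move=> M N /matrixP MN; apply/matrixP => i j; have := MN i j; rewrite !mxE.
exact: intr_inj.
Qed.

Lemma zmxM (K : pzRingType) a b c (M : 'M[int]_(a, b)) (N : 'M[int]_(b, c)) :
  zmx K (M *m N) = zmx K M *m zmx K N.
Proof. exact: (map_mxM (intr : int -> K)). Qed.

Lemma zmxB (K : pzRingType) a b (M N : 'M[int]_(a, b)) :
  zmx K (M - N) = zmx K M - zmx K N.
Proof. exact: (map_mxB (intr : int -> K)). Qed.

(** * Stabilizers of lattices *)

Section LatticeStabilizer.
Variables (R : realType) (m : nat) (A : 'M[int]_m).
Hypothesis hA : pos_def (zmx R A).

Definition lat_stab (L : set 'cV[rat]_m) : set 'M[rat]_m :=
  [set g | orth A g /\ [set g *m v | v in L] = L].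

Let unitA : zmx rat A \in unitmx := zmx_unit_num hA rat.

Lemma lat_image_comp (g h : 'M[rat]_m) (L : set 'cV[rat]_m) :
  [set g *m v | v in [set h *m v | v in L]] = [set g *m h *m v | v in L].
Proof.
apply/seteqP; split=> v.
  by move=> [w [u Lu <-] <-]; exists u; rewrite ?mulmxA.
by move=> [u Lu <-]; exists (h *m u); [exists u|rewrite mulmxA].
Qed.

Lemma lat_image1 (L : set 'cV[rat]_m) : [set 1%:M *m v | v in L] = L.
Proof.
apply/seteqP; split=> [v [w Lw <-]|v Lv]; first by rewrite mul1mx.
by exists v; rewrite ?mul1mx.
Qed.

Lemma lat_stab1 L : lat_stab L 1%:M.
Proof. by split; [exact: orth1|exact: lat_image1]. Qed.

Lemma lat_stabM L g h : lat_stab L g -> lat_stab L h -> lat_stab L (g *m h).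
Proof.
move=> [gA gL] [hA' hL]; split; first exact: orthM.
by rewrite -lat_image_comp hL.
Qed.

Lemma lat_stabV L g : lat_stab L g -> lat_stab L (invmx g).
Proof.
move=> [gA gL]; have gu := orth_unit unitA gA; split; first exact: orthV.
by rewrite -[in LHS]gL lat_image_comp mulVmx// lat_image1.
Qed.

(** Written in a basis of the lattice, the stabilizer becomes a group of integral matrices, where
    reduction modulo 3 makes sense. *)
Lemma lat_stab_int (M g : 'M[rat]_m) : M \in unitmx ->
  lat_stab [set M *m z | z in @std_lattice m] g ->
  exists k : 'M[int]_m, zmx rat k = invmx M *m g *m M.
Proof.
move=> Mu [_ gL].
have /choice[k hk] (ij : 'I_m * 'I_m) : exists z : int,
    (invmx M *m g *m M) ij.1 ij.2 = z%:~R.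
  case: ij => i j /=.
  have : [set M *m z | z in @std_lattice m] (g *m (M *m delta_mx j 0)).
    rewrite -gL; exists (M *m delta_mx j 0) => //; exists (delta_mx j 0) => // l.
    by rewrite mxE; case: (_ && _).
  move=> [z sz zE]; have /intrP[c cE] := sz i; exists c; rewrite -cE.
  rewrite -[z](mulKmx Mu) zE !mulmxA -colE [RHS]mxE; congr (_ i j).
exists (\matrix_(i, j) k (i, j)); apply/matrixP => i j.
by rewrite [in LHS]mxE [in LHS]mxE -hk.
Qed.

Lemma finite_lat_stab L : is_lattice L -> finite_set (lat_stab L).
Proof.
move=> [M Mu ->]; have [N1 N1p [M1 E1]] := rat_mx_denominator M.
have [N2 N2p [M2 E2]] := rat_mx_denominator (invmx M).
have N0 : (0 < N1 * N2)%N by rewrite muln_gt0 N1p.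
apply: sub_finite_set (finite_repr_var hA (zmx rat A) N0) => g gL; split.
  by case: gL.
move=> i j; have [k kE] := lat_stab_int Mu gL.
have gE : g = M *m zmx rat k *m invmx M by rewrite kE !mulmxA mulmxK// mulmxV// mul1mx.
have e : (N1 * N2)%:R *: g = zmx rat (M1 *m k *m M2).
  by rewrite !zmxM -E1 -E2 gE natrM -!scalemxAl -!scalemxAr scalerA.
by have /matrixP/(_ i j) := e; rewrite !mxE => ->; exact: intr_int.
Qed.

(** Pigeonhole: the powers of g stay in a finite set, so two of them agree, and invertibility
    cancels the smaller one. *)
Lemma lat_stab_order L g : is_lattice L -> lat_stab L g ->
  exists2 j, (0 < j)%N & g ^+ j = 1.
Proof.
move=> lL gL; have gX j : lat_stab L (g ^+ j).
  elim: j => [|j IH]; first by rewrite expr0; exact: lat_stab1.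
  by rewrite exprS; exact: lat_stabM.
have gu := orth_unit unitA (proj1 gL).
have gI i j : g ^+ i = g ^+ (i + j) -> g ^+ j = 1.
  elim: i => [|i IH]; first by rewrite expr0 add0n.
  rewrite addSn !exprS => h; apply: IH.
  by rewrite -[g ^+ i](mulKmx gu) -[g ^+ (i + j)](mulKmx gu); congr (_ *m _).
apply: contrapT => ngj.
pose pw (j : nat) : 'M[rat]_m := g ^+ j.
have pwI : {in pw @^-1` lat_stab L &, injective pw}.
  move=> i j _ _ ij; apply/eqP; apply: contrapT => nij; apply: ngj.
  have [lt|lt|e] := ltngtP i j; last by case: nij; apply/eqP.
    by exists (j - i)%N; [rewrite subn_gt0|apply: (gI i); rewrite subnKC// ltnW].
  by exists (i - j)%N; [rewrite subn_gt0|apply: (gI j); rewrite subnKC// ltnW].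
have := @finite_preimage nat 'M[rat]_m (lat_stab L) pw pwI (finite_lat_stab lL).
have -> : pw @^-1` lat_stab L = setT by apply/seteqP; split=> // j _; exact (gX j).
exact: infinite_nat.
Qed.

(* Reduction modulo 3 is injective on a finite group of integral matrices. *)
Lemma lat_stab_card L (F : {fset 'M[rat]_m}) : is_lattice L ->
  [set` F] `<=` lat_stab L -> (#|` F| <= #|{: 'M['I_3]_m}|)%N.
Proof.
move=> lL FL; have [M Mu LE] := lL.
have /choice[k hk] g : exists k : 'M[int]_m, lat_stab L g -> zmx rat k = invmx M *m g *m M.
  have [gL|ngL] := pselect (lat_stab L g); last by exists 0.
  by have [k kE] := lat_stab_int (g := g) Mu (eq_ind _ (fun L => lat_stab L g) gL _ LE); exists k.
pose r (g : 'M[rat]_m) : 'M['I_3]_m := \matrix_(i, j) inord `|(k g i j %% 3)%Z|%N.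
have rI g h : lat_stab L g -> lat_stab L h -> r g = r h -> g = h.
  move=> gL hL rgh.
  have d : dvdmx3 1 (k g - k h).
    move=> i j; rewrite !mxE expr1 -eqz_mod_dvd; apply/eqP.
    have /matrixP/(_ i j) := rgh; rewrite !mxE => /(congr1 val).
    have m3 (z : int) : (0 <= z %% 3)%Z /\ ((z %% 3)%Z < 3).
      by rewrite modz_ge0// ltz_mod.
    have [a1 a2] := m3 (k g i j); have [b1 b2] := m3 (k h i j).
    by rewrite /= !inordK => [|//|//]; lia.
  have hV := lat_stabV hL; have ghL := lat_stabM gL hV.
  have hu := orth_unit unitA (proj1 hL).
  have [j j0 ghj] := lat_stab_order lL ghL.
  have kX i : zmx rat (k (g *m invmx h) ^+ i) = invmx M *m (g *m invmx h) ^+ i *m M.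
    elim: i => [|i IH].
      rewrite !expr0 mulmx1 mulVmx//; exact: (map_mx1 (intr : int -> rat)).
    rewrite !exprS zmxM IH (hk _ ghL) -!mulmxA; congr (_ *m (_ *m _)).
    by rewrite !mulmxA mulmxK.
  (* Since [k] is conjugation by [M], it is multiplicative on the stabilizer: k(g h^-1) is torsion,
     and k(g h^-1) - 1 = (k g - k h) k(h^-1) is divisible by 3. *)
  have : k (g *m invmx h) = 1.
    apply: (@minkowski_torsion _ _ j) => //.
      apply: (@zmx_inj rat); rewrite kX ghj mulmx1 mulVmx//.
      exact/esym/(map_mx1 (intr : int -> rat)).
    have -> : k (g *m invmx h) - 1 = (k g - k h) * k (invmx h).
      apply: (@zmx_inj rat); rewrite zmxM !zmxB (hk _ ghL) (hk _ gL) (hk _ hL) (hk _ hV).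
      rewrite mulmxBl !mulmxA !(mulmxK Mu) -(mulmxA _ h) (mulmxV hu) mulmx1 mulVmx//.
      by congr (_ - _); exact: (map_mx1 (intr : int -> rat)).
    by apply: (@dvdmx3M _ 1 0) => // u v; rewrite expr0 dvd1z.
  move=> k1; have := hk _ ghL; rewrite k1 => h1.
  have : g *m invmx h = 1%:M.
    rewrite -[LHS](mulKVmx Mu) -[X in _ *m X](mulmxK Mu) -h1.
    by rewrite -[zmx _ 1]/(map_mx (intr : int -> rat) 1%:M) map_mx1 mul1mx mulmxV.
  by move=> gh; rewrite -[g](mulmxKV hu) gh mul1mx.
rewrite -(size_map r) -(card_uniqP _); first exact: max_card.
rewrite map_inj_in_uniq ?fset_uniq// => g h gF hF; apply: rI; exact: FL.
Qed.

End LatticeStabilizer.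

(** * Haar measure and unfolding *)

Section AdelicMeasure.
Variables (R : realType) (m : nat) (A : 'M[int]_m).
Hypothesis hA : pos_def (zmx R A).
Local Notation G := (adelic_borel R A).
Local Notation SQ := [set g : 'M[rat]_m | orth A g].

Lemma adelic_ext (a b : adelic_orth R A) :
  arch a = arch b -> (forall p, fin a p = fin b p) -> a = b.
Proof.
case: a b => [a1 a2 a3 a4 a5] [b1 b2 b3 b4 b5] /= e1 e2.
have e2' : a2 = b2 by exact: functional_extensionality_dep.
by subst b1 b2; congr AdelicOrth; exact: Prop_irrelevance.
Qed.

Lemma adelic_mulK (a b c : adelic_orth R A) : adelic_inv_spec a b ->
  adelic_mul b (adelic_mul a c) = c /\ adelic_mul a (adelic_mul b c) = c.
Proof.
move=> [e1 e2]; split; apply: adelic_ext => [|p] /=; rewrite ?e1 ?e2.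
- exact (mulKmx (arch_unit hA a) _).
- exact (mulKmx (fin_unit hA a p) _).
- exact (mulKVmx (arch_unit hA a) _).
- exact (mulKVmx (fin_unit hA a p) _).
Qed.

(** A total extension of [diag], the identity off O_A(Q), so that sums over O_A(Q) are indexed by
    the countable type ['M[rat]_m] instead of a type of proofs. *)
Definition rat_lift (g : 'M[rat]_m) : adelic_orth R A :=
  diag R (match pselect (orth A g) with
          | left h => exist _ g h | right _ => exist _ 1%:M (orth1 A rat) end).

Lemma rat_liftE (g : rat_orth A) : rat_lift (proj1_sig g) = diag R g.
Proof.
rewrite /rat_lift; case: pselect => [h|]; last by case: g.
by congr diag; case: g h => g gA h /=; congr exist; exact: Prop_irrelevance.
Qed.

Lemma rat_lift_inv g : orth A g -> adelic_inv_spec (rat_lift g) (rat_lift (invmx g)).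
Proof.
move=> gA; have gA' := orthV (zmx_unit_num hA rat) gA.
rewrite (rat_liftE (exist _ g gA)) (rat_liftE (exist _ _ gA')).
by split=> [|p] /=; [rewrite /qmx map_invmx|rewrite qmx_padic_inv].
Qed.

Definition rat_trans (g : 'M[rat]_m) (a : G) : G := adelic_mul (rat_lift g) a.

Lemma rat_transK g a : orth A g ->
  rat_trans (invmx g) (rat_trans g a) = a /\ rat_trans g (rat_trans (invmx g) a) = a.
Proof. by move=> gA; apply: adelic_mulK; exact: rat_lift_inv. Qed.

Lemma arch_rat_trans g a : orth A g -> arch (rat_trans g a) = qmx R g *m arch a.
Proof. by move=> gA; rewrite /rat_trans (rat_liftE (exist _ g gA)). Qed.

Lemma lat_rat_trans g (a : G) : orth A g -> lat (rat_trans g a) = [set g *m v | v in lat a].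
Proof. by move=> gA; rewrite /rat_trans (rat_liftE (exist _ g gA)) lat_diag. Qed.

Lemma adelic_open_measurable (U : set G) : adelic_open U -> measurable U.
Proof. exact: sub_sigma_algebra. Qed.

(** Left multiplication is continuous: Lipschitz at the real place, while at the finite places the
    common denominator M of a is absorbed by shrinking the congruence neighbourhood from N to M
    N. *)
Lemma measurable_adelic_mul (a : adelic_orth R A) :
  measurable_fun setT (adelic_mul a : G -> G).
Proof.
apply: (@measurability _ _ G G setT (adelic_mul a) (@adelic_open R m A)) => // _ [U oU <-]; rewrite setTI.
apply: adelic_open_measurable => b /= Ub.
have [e e0 [N N0 hU]] := oU _ Ub.
have [M M0 hM] := adelic_denominator a.
(* Strictly larger than every absolute row sum of [arch a], thanks to the summand 1, which also
   makes it positive. *)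
pose s := 1 + \sum_i \sum_j `|arch a i j|.
have s0 : 0 < s by rewrite ltr_pwDl// sumr_ge0// => i _; rewrite sumr_ge0.
exists (e / s); first by rewrite divr_gt0.
exists (M * N)%N => [|c hc1 hc2]; first by rewrite muln_gt0 M0.
apply: hU => /= [i j|p i j].
  rewrite !mxE -sumrB.
  have h k : `|arch a i k * arch c k j - arch a i k * arch b k j| <= `|arch a i k| * (e / s).
    by rewrite -mulrBr normrM ler_wpM2l// ltW.
  apply: le_lt_trans (ler_norm_sum _ _ _) _.
  apply: le_lt_trans (ler_sum _ (fun k _ => h k)) _.
  rewrite -mulr_suml mulrA ltr_pdivrMr// mulrC ltr_pM2l// /s.
  have : \sum_k `|arch a i k| <= \sum_k \sum_l `|arch a k l|.
    rewrite [leRHS](bigD1 i)//= lerDl sumr_ge0// => l _; exact: sumr_ge0.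
  lra.
have N0' : N%:R != 0 :> padic p by rewrite -ratr_padic_nat ratr_padic_eq0 pnatr_eq0 -lt0n.
have M0' : M%:R != 0 :> padic p by rewrite -ratr_padic_nat ratr_padic_eq0 pnatr_eq0 -lt0n.
rewrite !mxE -sumrB mulr_suml; apply: padic_int_sum => k.
have -> : (fin a p i k * fin c p k j - fin a p i k * fin b p k j) / N%:R =
   (M%:R *: fin a p) i k * ((fin c p k j - fin b p k j) / (M * N)%:R).
  rewrite mxE natrM invfM -mulrBr (mulrCA _ M%:R^-1) (mulrA (_ * _)).
  by rewrite [_ * _ * M%:R^-1]mulrAC (mulfV M0') mul1r mulrA.
by apply: padic_intM; [exact: hM|exact: hc2].
Qed.

Lemma measurable_arch i j : measurable_fun setT (fun a : G => arch a i j).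
Proof.
apply: (measurability _ (RGenOInfty.measurableE R)) => // _ [_ [x ->] <-]; rewrite setTI.
apply: adelic_open_measurable => a /=; rewrite in_itv /= andbT => xa.
exists (arch a i j - x); first by rewrite subr_gt0.
exists 1%N => // b hb _; rewrite in_itv /= andbT.
have := hb i j; rewrite ltr_norml => /andP[h _]; move: h; lra.
Qed.

Definition lat_fiber (L : set 'cV[rat]_m) : set G := [set a | lat a = L].

(** The fibre is open: if N clears the denominators of a^-1 and b is congruent to a modulo N at
    every prime, then a^-1 b is integral everywhere and b has the lattice of a. *)
Lemma measurable_lat_fiber L : measurable (lat_fiber L).
Proof.
apply: adelic_open_measurable => a /= aL.
have [N N0 hN] := adelic_denominators hA a.
exists 1; first exact: ltr01.
exists N; first exact: N0.
move=> b _ hb; rewrite /lat_fiber /= -aL; apply/esym/(lat_eqP hA) => p.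
have N0' : N%:R != 0 :> padic p by rewrite -ratr_padic_nat ratr_padic_eq0 pnatr_eq0 -lt0n.
have -> : fin b p = fin a p + N%:R *: \matrix_(i, j) ((fin b p i j - fin a p i j) / N%:R).
  by apply/matrixP => i j; rewrite !mxE mulrC (divfK N0') addrC subrK.
rewrite mulmxDr (mulVmx (fin_unit hA a p)) -scalemxAr scalemxAl.
apply: padic_int_mxD; first exact: padic_int_mx1.
by apply: padic_int_mxM; [have [] := hN p|move=> i j; rewrite mxE; exact: hb].
Qed.

Variable mu : {measure set G -> \bar R}.
Hypothesis hmu : is_haar mu.

(** The fibre over [lat a] is the left translate by a of [maximal_compact], whose volume is
    normalized to 1. *)
Lemma measure_lat_fiber L : genus A L -> mu (lat_fiber L) = 1%E.
Proof.
move=> /(genus_latP hA)[a aL]; have [b ab] := adelic_inv_ex hA a.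
have [_ bE] := ab; have [muU inv] := hmu.
have mU : measurable (@maximal_compact R m A).
  have -> : @maximal_compact R m A = lat_fiber (lat (rat_lift 1%:M)).
    rewrite (rat_liftE (exist _ _ (orth1 A rat))); apply/seteqP; split=> c hc.
      apply/esym/(lat_eqP hA) => p /=; rewrite qmx_padicE map_mx1 invmx1 mul1mx; exact: hc.
    move=> p; move/esym: hc => /(lat_eqP hA)/(_ p) /=.
    by rewrite qmx_padicE map_mx1 invmx1 mul1mx.
  exact: measurable_lat_fiber.
rewrite -muU -(inv b _ mU); congr (mu _); apply/seteqP; split=> c /=.
  by rewrite /lat_fiber /= -aL => /esym/(lat_eqP hA) h p; rewrite /= bE; exact: h.
by move=> h; rewrite /lat_fiber /= -aL; apply/esym/(lat_eqP hA) => p; rewrite -bE; exact: h.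
Qed.

Lemma integral_adelic_mul (a : adelic_orth R A) (D : set G) (f : G -> \bar R) :
  measurable D -> measurable_fun D f -> (forall x, D x -> (0 <= f x)%E) ->
  (\int[mu]_(x in adelic_mul a @^-1` D) f (adelic_mul a x) = \int[mu]_(x in D) f x)%E.
Proof.
move=> mD mf f0.
have := ge0_integral_pushforward (measurable_adelic_mul a) mu mD mf.
move=> <-; last by move=> x; rewrite inE; exact: f0.
apply: eq_measure_integral => [|mphi B mB _]; first exact: measurable_adelic_mul.
by rewrite /pushforward; have [_] := hmu; exact.
Qed.

Variable D : set G.
Hypothesis hD : is_fundamental_domain D.

(** The sum over O_A(Q) as a series over the codes of rational matrices, with term 0 at codes
    outside O_A(Q), so that monotone convergence applies. *)
Let Fn (f : G -> \bar R) (n : nat) (a : G) : \bar R :=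
  if pickle_inv n is Some g then (if g \in SQ then f (rat_trans g a) else 0)%E else 0%E.

Let FnE (f : G -> \bar R) a : (forall x, 0 <= f x)%E ->
  (\esum_(g in SQ) f (rat_trans g a) = \sum_(0 <= n <oo) Fn f n a)%E.
Proof.
move=> f0; rewrite nneseries_esum; last first.
  by move=> n _; rewrite /Fn; case: pickle_inv => // g; case: ifP.
have inj : {in SQ &, injective (@choice.pickle 'M[rat]_m)}.
  by move=> g h _ _; exact: (pcan_inj (@choice.pickleK 'M[rat]_m)).
transitivity (\esum_(n in @choice.pickle 'M[rat]_m @` SQ) Fn f n a)%E.
  rewrite (reindex_esum _ _ _ _ (inj_bij inj)); apply: eq_esum => g gQ.
  by rewrite /Fn pickleK_inv mem_set.
have -> : [set n : nat | xpredT n] = setT by apply/seteqP; split.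
rewrite esum_mkcond; apply: eq_esum => n _.
case: ifPn => // /negP nn; rewrite /Fn; case e : (pickle_inv n) => [g|//].
case: ifPn => // gQ; exfalso; apply: nn; rewrite inE; exists g; first exact: set_mem.
by have := @pickle_invK 'M[rat]_m n; rewrite e.
Qed.

Let Fn_ge0 (f : G -> \bar R) n a : (forall x, 0 <= f x)%E -> (0 <= Fn f n a)%E.
Proof. by move=> f0; rewrite /Fn; case: pickle_inv => // g; case: ifP. Qed.

Let measurable_Fn (f : G -> \bar R) n : measurable_fun setT f -> measurable_fun setT (Fn f n).
Proof.
move=> mf; rewrite /Fn; case: pickle_inv => [g|]; last exact: measurable_cst.
case: (g \in SQ); last exact: measurable_cst.
exact: (measurableT_comp mf (measurable_adelic_mul (rat_lift g))).
Qed.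

Lemma measurable_unfold (f : G -> \bar R) : measurable_fun setT f ->
  (forall x, 0 <= f x)%E ->
  measurable_fun setT (fun a => \esum_(g in SQ) f (rat_trans g a))%E.
Proof.
move=> mf f0; under eq_fun do rewrite FnE//.
apply: (ge0_emeasurable_sum (P := xpredT)) => [k x _ _|k _]; first exact: Fn_ge0.
exact: measurable_Fn.
Qed.

(** Existence and uniqueness of representatives make the translates g D a partition of the adelic
    group, and Haar invariance turns the integral of f(g a) over D into that of f over g D. *)
Lemma integral_unfold (f : G -> \bar R) : measurable_fun setT f ->
  (forall x, 0 <= f x)%E ->
  (\int[mu]_(a in D) (\esum_(g in SQ) f (rat_trans g a)) = \int[mu]_a f a)%E.
Proof.
move=> mf f0; have [mD fD] := hD.
under eq_integral do rewrite FnE//.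
rewrite integral_nneseries//; last 2 first.
- by move=> n; apply: measurable_funS (measurable_Fn n mf).
- by move=> n x _; exact: Fn_ge0.
pose E n : set G := if pickle_inv n is Some g then
  (if g \in SQ then rat_trans (invmx g) @^-1` D else set0) else set0.
have mE n : measurable (E n).
  rewrite /E; case: pickle_inv => [g|//]; case: ifP => // _.
  by rewrite -[X in measurable X]setTI; exact: measurable_adelic_mul.
have EP n a : E n a -> exists2 g : rat_orth A, pickle_inv n = Some (proj1_sig g) &
    D (rat_trans (invmx (proj1_sig g)) a).
  rewrite /E; case e: pickle_inv => [g|//]; case: ifPn => // /set_mem gQ h.
  by exists (exist _ g gQ).
have trE : trivIset setT E.
  apply/trivIsetP => i j _ _ /eqP ij; apply/seteqP; split=> // a [/EP[g gi ga] /EP[h hj ha]].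
  have gV := orthV (zmx_unit_num hA rat) (proj2_sig g).
  have hV := orthV (zmx_unit_num hA rat) (proj2_sig h).
  have [k [_ ku]] := fD a; have := ku (exist _ _ gV); have := ku (exist _ _ hV).
  rewrite -!rat_liftE /= => /(_ ha) -> /(_ ga) /(congr1 (@proj1_sig _ _)) /= gh.
  have e : sval g = sval h by rewrite -[LHS]invmxK -gh invmxK.
  apply: ij; have := @pickle_invK 'M[rat]_m i; have := @pickle_invK 'M[rat]_m j.
  by rewrite gi hj e /= => -> ->.
have cupE : \bigcup_n E n = setT.
  apply/seteqP; split=> // a _; have [k [kD _]] := fD a.
  have kV := orthV (zmx_unit_num hA rat) (proj2_sig k).
  exists (choice.pickle (invmx (proj1_sig k))) => //; rewrite /E pickleK_inv mem_set//=.
  by rewrite invmxK /rat_trans rat_liftE.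
rewrite -[in RHS]cupE ge0_integral_bigcup//; last first.
  by rewrite cupE.
apply: eq_eseriesr => n _; rewrite /Fn /E; case: pickle_inv => [g|]; last first.
  by rewrite integral0 integral_set0.
case: ifPn => [/set_mem gQ|_]; last by rewrite integral0 integral_set0.
have mgD : measurable (rat_trans (invmx g) @^-1` D).
  by rewrite -[X in measurable X]setTI; exact: measurable_adelic_mul.
rewrite -(integral_adelic_mul (rat_lift g) mgD)//; last by apply: measurable_funS mf.
congr (integral _ _ _); apply/seteqP; split=> a /=.
  by have [-> _] := rat_transK a gQ.
by rewrite -/(rat_trans g a); have [-> _] := rat_transK a gQ.
Qed.

End AdelicMeasure.

Lemma esum_finite_support (R : realType) (T : choiceType) (S F : set T) (h : T -> R) :
  finite_set F -> F `<=` S -> (forall x, 0 <= h x) ->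
  (forall x, S x -> ~ F x -> h x = 0) ->
  (\esum_(x in S) (h x)%:E = (\sum_(x <- fset_set F) h x)%:E)%E.
Proof.
move=> finF FS h0 hF; transitivity (\esum_(x in F) (h x)%:E)%E.
  rewrite esum_mkcond [RHS]esum_mkcond; apply: eq_esum => x _.
  case: ifPn => [/set_mem Sx|nS]; case: ifPn => [/set_mem Fx|nF] //.
    by rewrite hF// => Fx; move/negP: nF; apply; rewrite mem_set.
  by move/negP: nS; case; rewrite mem_set//; exact: FS.
rewrite esum_fset//; last by move=> x _; rewrite lee_fin.
by rewrite fsbig_finite// sumEFin.
Qed.

(** * Complex integrals, and unfolding of complex functions *)

Section ComplexIntegrals.
Variables (R : realType) (d : measure_display) (T : measurableType d).
Variables (mu : {measure set T -> \bar R}) (D : set T).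
Hypothesis mD : measurable D.
Local Notation C := R[i].

Definition cintegrable (f : T -> C) : Prop :=
  mu.-integrable D (EFin \o (fun x => complex.Re (f x))) /\
  mu.-integrable D (EFin \o (fun x => complex.Im (f x))).

Lemma eq_cintegral (f g : T -> C) : (forall x, D x -> f x = g x) ->
  cintegral mu D f = cintegral mu D g.
Proof.
by move=> fg; congr Complex; apply: eq_Rintegral => x; rewrite inE => /fg ->.
Qed.

Lemma cintegrableD f g : cintegrable f -> cintegrable g ->
  cintegrable (fun x => f x + g x).
Proof.
move=> [f1 f2] [g1 g2]; split.
  apply: eq_integrable (integrableD mD f1 g1) => // x _ /=.
  by rewrite -EFinD; congr EFin; case: (f x) (g x) => a b [].
apply: eq_integrable (integrableD mD f2 g2) => // x _ /=.
by rewrite -EFinD; congr EFin; case: (f x) (g x) => a b [].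
Qed.

Lemma cintegralD f g : cintegrable f -> cintegrable g ->
  cintegral mu D (fun x => f x + g x) = cintegral mu D f + cintegral mu D g.
Proof.
move=> [f1 f2] [g1 g2]; rewrite /cintegral; apply/eqP; rewrite eq_complex /=.
rewrite -!RintegralD//; apply/andP; split; apply/eqP; apply: eq_Rintegral => x _;
  by case: (f x) (g x) => a b [].
Qed.

Lemma cintegrableZ c f : cintegrable f -> cintegrable (fun x => c * f x).
Proof.
case: c => u v [f1 f2]; split.
  apply: eq_integrable (integrableB mD (integrableZl mD u f1) (integrableZl mD v f2)) => //.
  by move=> x _ /=; rewrite -!EFinM -EFinB; congr EFin; case: (f x).
apply: eq_integrable (integrableD mD (integrableZl mD u f2) (integrableZl mD v f1)) => //.
by move=> x _ /=; rewrite -!EFinM -EFinD; congr EFin; case: (f x) => a b /=; rewrite [v * _]mulrC.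
Qed.

Lemma cintegralZ c f : cintegrable f ->
  cintegral mu D (fun x => c * f x) = c * cintegral mu D f.
Proof.
case: c => u v [f1 f2]; rewrite /cintegral; apply/eqP; rewrite eq_complex /=.
have f1u := integrableZl mD u f1; have f2v := integrableZl mD v f2.
have f2u := integrableZl mD u f2; have f1v := integrableZl mD v f1.
rewrite -!RintegralZl// -RintegralB// -RintegralD//.
apply/andP; split; apply/eqP; apply: eq_Rintegral => x _; case: (f x) => a b //=.
Qed.

Lemma cintegrable0 : cintegrable (fun=> 0).
Proof. by split; exact: integrable0. Qed.

Lemma cintegrable_sum (I : Type) (s : seq I) (P : pred I) (F : I -> T -> C) :
  (forall i, P i -> cintegrable (F i)) ->
  cintegrable (fun x => \sum_(i <- s | P i) F i x) /\
  cintegral mu D (fun x => \sum_(i <- s | P i) F i x) =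
  \sum_(i <- s | P i) cintegral mu D (F i).
Proof.
move=> iF; elim: s => [|i s [IH1 IH2]].
  have e : (fun x => \sum_(i <- [::] | P i) F i x) = (fun=> 0).
    by apply/funext => x; rewrite big_nil.
  rewrite e big_nil; split; first exact: cintegrable0.
  by rewrite /cintegral /= /Rintegral integral0.
have e : (fun x => \sum_(i <- i :: s | P i) F i x) = if P i then
    (fun x => F i x + \sum_(i <- s | P i) F i x) else (fun x => \sum_(i <- s | P i) F i x).
  by case: ifP => Pi; apply/funext => x; rewrite big_cons Pi.
rewrite e big_cons; case: ifP => Pi //; split.
  by apply: cintegrableD => //; exact: iF.
by rewrite cintegralD ?IH2//; exact: iF.
Qed.

End ComplexIntegrals.

Section Unfolding.
Variables (R : realType) (m : nat) (A : 'M[int]_m).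
Hypothesis hA : pos_def (zmx R A).
Local Notation G := (adelic_borel R A).
Local Notation SQ := [set g : 'M[rat]_m | orth A g].
Variable mu : {measure set G -> \bar R}.
Hypothesis hmu : is_haar mu.
Variable D : set G.
Hypothesis hD : is_fundamental_domain D.
Variable T : G -> set 'M[rat]_m.
Hypothesis finT : forall a, finite_set (T a).
Hypothesis TQ : forall a, T a `<=` SQ.

Let mD : measurable D := proj1 hD.

Let Tsum (f : G -> R) a := \sum_(g <- fset_set (T a)) f (rat_trans g a).

Let unfold_real_ge0 (f : G -> R) : mu.-integrable setT (EFin \o f) ->
  (forall a, 0 <= f a) ->
  (forall a g, SQ g -> ~ T a g -> f (rat_trans g a) = 0) ->
  mu.-integrable D (EFin \o Tsum f) /\ Rintegral mu D (Tsum f) = Rintegral mu setT f.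
Proof.
move=> intf f0 fT.
have mf := measurable_int mu intf.
have f0' (x : G) : (0 <= (EFin \o f) x)%E by rewrite lee_fin.
have e (a : G) : (\esum_(g in SQ) (EFin \o f) (rat_trans g a) = (Tsum f a)%:E)%E.
  exact: (@esum_finite_support R _ SQ (T a) (fun g => f (rat_trans g a))) (finT a) (@TQ a) _ (fT a).
have ie := integral_unfold hA hmu hD mf f0'.
have ie' : (\int[mu]_(a in D) (Tsum f a)%:E = \int[mu]_a (f a)%:E)%E.
  by rewrite -ie; apply: eq_integral => a _; rewrite e.
have T0 a : 0 <= Tsum f a by apply: sumr_ge0.
split; last by rewrite /Rintegral ie'.
apply/integrableP; split.
  have := measurable_funS (@measurableT _ _) (@subsetT _ D) (measurable_unfold mf f0').
  by under eq_fun do rewrite e.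
under eq_integral => a _ do rewrite /= ger0_norm ?T0//.
rewrite ie'; have /integrableP[_] := intf; apply: le_lt_trans.
by under [leRHS]eq_integral => a _ do rewrite /= ger0_norm ?f0//.
Qed.

(** The positive and negative parts of f vanish wherever f does, so the same finite sets [T a]
    support both and the nonnegative case applies to each. *)
Lemma unfold_real (f : G -> R) : mu.-integrable setT (EFin \o f) ->
  (forall a g, SQ g -> ~ T a g -> f (rat_trans g a) = 0) ->
  mu.-integrable D (EFin \o (fun a => \sum_(g <- fset_set (T a)) f (rat_trans g a))) /\
  Rintegral mu D (fun a => \sum_(g <- fset_set (T a)) f (rat_trans g a)) =
  Rintegral mu setT f.
Proof.
move=> intf fT.
have mf : measurable_fun setT f by apply/measurable_EFinP; exact: (measurable_int mu intf).
pose fp x := Num.max (f x) 0; pose fn x := Num.max (- f x) 0.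
have ip : mu.-integrable setT (EFin \o fp).
  apply: le_integrable intf => //=.
    by apply/measurable_EFinP; apply: measurable_maxr => //; exact: measurable_cst.
  move=> x _; rewrite lee_fin /fp ger0_norm ?le_max ?lexx ?orbT//.
  by rewrite ge_max ler_norm normr_ge0.
have inn : mu.-integrable setT (EFin \o fn).
  apply: le_integrable intf => //=.
    apply/measurable_EFinP; apply: measurable_maxr => //.
    exact: measurableT_comp.
  move=> x _; rewrite lee_fin /fn ger0_norm ?le_max ?lexx ?orbT//.
  by rewrite ge_max normr_ge0 -normrN ler_norm.
have [p1 p2] : mu.-integrable D (EFin \o Tsum fp) /\
    Rintegral mu D (Tsum fp) = Rintegral mu setT fp.
  apply: unfold_real_ge0 => // [a|a g gQ nT]; first by rewrite le_max lexx orbT.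
  by rewrite /fp fT// maxxx.
have [n1 n2] : mu.-integrable D (EFin \o Tsum fn) /\
    Rintegral mu D (Tsum fn) = Rintegral mu setT fn.
  apply: unfold_real_ge0 => // [a|a g gQ nT]; first by rewrite le_max lexx orbT.
  by rewrite /fn fT// oppr0 maxxx.
have fE x : f x = fp x - fn x.
  by rewrite /fp /fn; case: (leP (f x) 0); case: (leP (- f x) 0); lra.
have FE a : Tsum f a = Tsum fp a - Tsum fn a.
  by rewrite /Tsum -sumrB; apply: eq_bigr => g _; rewrite fE.
rewrite -/(Tsum f); split.
  apply: eq_integrable (integrableB mD p1 n1) => // a _ /=.
  by rewrite FE EFinB.
transitivity (Rintegral mu D (fun a => Tsum fp a - Tsum fn a)).
  by apply: eq_Rintegral => a _; exact: FE.
rewrite RintegralB// p2 n2 -RintegralB//.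
by apply: eq_Rintegral => x _; rewrite -fE.
Qed.

Lemma unfold_complex (f : G -> R[i]) : cintegrable mu setT f ->
  (forall a g, SQ g -> ~ T a g -> f (rat_trans g a) = 0) ->
  cintegrable mu D (fun a => \sum_(g <- fset_set (T a)) f (rat_trans g a)) /\
  cintegral mu D (fun a => \sum_(g <- fset_set (T a)) f (rat_trans g a)) =
  cintegral mu setT f.
Proof.
move=> [i1 i2] fT.
have [r1 r2] := unfold_real i1 (fun a g gQ nT => congr1 (@complex.Re R) (fT a g gQ nT)).
have [s1 s2] := unfold_real i2 (fun a g gQ nT => congr1 (@complex.Im R) (fT a g gQ nT)).
have ReE a : complex.Re (\sum_(g <- fset_set (T a)) f (rat_trans g a)) =
  \sum_(g <- fset_set (T a)) complex.Re (f (rat_trans g a)) by exact: raddf_sum.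
have ImE a : complex.Im (\sum_(g <- fset_set (T a)) f (rat_trans g a)) =
  \sum_(g <- fset_set (T a)) complex.Im (f (rat_trans g a)) by exact: raddf_sum.
split; first by split; [move: r1|move: s1]; apply: eq_integrable => // a _ /=; rewrite ?ReE ?ImE.
rewrite /cintegral; congr Complex.
  by rewrite -r2; apply: eq_Rintegral => a _; rewrite ReE.
by rewrite -s2; apply: eq_Rintegral => a _; rewrite ImE.
Qed.

End Unfolding.

(** * Finiteness of the class number *)

Section Classes.
Variables (R : realType) (m : nat) (A : 'M[int]_m).
Hypothesis hA : pos_def (zmx R A).
Local Notation G := (adelic_borel R A).
Local Notation SQ := [set g : 'M[rat]_m | orth A g].
Local Notation unitA := (zmx_unit_num hA rat).

Definition lat_class (L : set 'cV[rat]_m) : set (set 'cV[rat]_m) :=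
  [set [set g *m v | v in L] | g in SQ].

Lemma lat_class_id L : lat_class L L.
Proof. by exists 1%:M; [exact: orth1|exact: lat_image1]. Qed.

Lemma lat_class_image g L : orth A g -> lat_class [set g *m v | v in L] = lat_class L.
Proof.
move=> gA; apply/seteqP; split=> M [h hQ <-].
  by exists (h *m g); [exact: orthM|rewrite lat_image_comp].
exists (h *m invmx g); first by apply: orthM => //; exact: (orthV unitA).
by rewrite lat_image_comp mulmxKV// (orth_unit unitA).
Qed.

Definition lat_transp (L L' : set 'cV[rat]_m) : set 'M[rat]_m :=
  [set g | orth A g /\ [set g *m v | v in L] = L'].

Lemma lat_transp_stab L L' g g0 : lat_transp L L' g -> lat_transp L L' g0 ->
  lat_stab A L' (g *m invmx g0).
Proof.
move=> [gA gL] [g0A g0L]; split; first by apply: orthM => //; exact: (orthV unitA).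
by rewrite -[in LHS]g0L lat_image_comp mulmxKV// (orth_unit unitA).
Qed.

Lemma finite_lat_transp L L' : is_lattice L' -> finite_set (lat_transp L L').
Proof.
move=> lL; have [[g0 g0T]|no] := pselect (exists g, lat_transp L L' g); last first.
  by apply: (sub_finite_set _ (finite_set0 _)) => g gT; apply: no; exists g.
apply: sub_finite_set (finite_image (fun s => s *m g0) (finite_lat_stab hA lL)) => g gT.
exists (g *m invmx g0); first exact: lat_transp_stab gT g0T.
by rewrite mulmxKV// (orth_unit unitA)//; case: g0T.
Qed.

Lemma lat_transp_card L L' (F : {fset 'M[rat]_m}) : is_lattice L' ->
  [set` F] `<=` lat_transp L L' -> (#|` F| <= #|{: 'M['I_3]_m}|)%N.
Proof.
move=> lL FT; have [->|[g0 g0F]] := fset_0Vmem F; first by rewrite cardfs0.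
have g0T := FT _ g0F; have g0u := orth_unit unitA (proj1 g0T).
pose F' := [fset g *m invmx g0 | g in F]%fset.
have -> : #|` F| = #|` F'|.
  rewrite card_in_imfset// => g h _ _ /(congr1 (mulmx^~ g0)).
  by rewrite !mulmxKV.
apply: (lat_stab_card hA lL) => _ /imfsetP[g gF ->].
exact: lat_transp_stab (FT _ gF) g0T.
Qed.

Variable mu : {measure set G -> \bar R}.
Hypothesis hmu : is_haar mu.
Variable D : set G.
Hypothesis hD : is_fundamental_domain D.

(* Each class contributes at least the reciprocal of the Minkowski bound to the
   volume of the fundamental domain. *)
Lemma finite_classes : (mu D < +oo)%E -> finite_set (lat_class @` genus A).
Proof.
move=> muD; apply: contrapT => inf; have mD := proj1 hD.
pose c := #|{: 'M['I_3]_m}|.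
have muDf : mu D \is a fin_num by rewrite ge0_fin_numE.
(* Strictly above c mu(D): the fibres over N classes have total volume at least N, whereas unfolding
   bounds this volume by c mu(D). *)
pose N := (Num.truncn (c%:R * fine (mu D))).+1.
have [B BS cB] := infinite_set_fset N inf.
have /choice[rep hrep] (K : set (set 'cV[rat]_m)) : exists L, K \in B ->
    genus A L /\ lat_class L = K.
  have [KB|] := boolP (K \in B); last by exists set0.
  by have [L gL <-] := BS _ KB; exists L.
pose W : set G := \bigcup_(K in [set` B]) lat_fiber (rep K).
have muW : mu W = #|` B|%:R%:E.
  rewrite measure_fin_bigcup//.
  - rewrite fsbig_finite//= set_fsetK.
    rewrite (eq_big_seq (fun=> 1%E)) => [|K KB]; last first.
      by apply: measure_lat_fiber => //; have [] := hrep K KB.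
    by rewrite sumEFin big_const_seq count_predT iter_addr_0.
  - apply/trivIsetP => K K' /= KB K'B KK'; apply/seteqP; split=> // a [/= aK aK'].
    move/eqP: KK'; apply; have [_ <-] := hrep K KB; have [_ <-] := hrep K' K'B.
    by rewrite -aK -aK'.
  - by move=> K _; exact: measurable_lat_fiber.
have mW : measurable W.
  by apply: fin_bigcup_measurable => // K _; exact: measurable_lat_fiber.
pose T (a : G) : set 'M[rat]_m := [set g | orth A g /\ W (rat_trans g a)].
(* All the lattices g (lat a) lie in a single class, so those among the chosen representatives
   coincide; [T a] is therefore contained in one coset of a stabilizer. *)
have Tsub a g0 : T a g0 -> exists2 L', genus A L' & T a `<=` lat_transp (lat a) L'.
  move=> [g0A [K0 /= K0B K0E]]; exists (rep K0); first by have [] := hrep K0 K0B.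
  move=> g [gA [K /= KB KE]]; split=> //.
  move: KE K0E; rewrite /lat_fiber /= !lat_rat_trans// => KE K0E.
  have e : K = K0.
    have [_ <-] := hrep K KB; have [_ <-] := hrep K0 K0B.
    by rewrite -KE -K0E !lat_class_image.
  by rewrite KE e.
have finT a : finite_set (T a).
  have [[g0 /Tsub[L' gL' sub]]|no] := pselect (exists g, T a g).
    by apply: sub_finite_set sub (finite_lat_transp _ _); case: gL'.
  by apply: (sub_finite_set _ (finite_set0 _)) => g gT; apply: no; exists g.
have cardT a : (#|` fset_set (T a)| <= c)%N.
  have [[g0 /Tsub[L' gL' sub]]|no] := pselect (exists g, T a g).
    apply: (@lat_transp_card (lat a) L'); first by case: gL'.
    by rewrite fset_setK.
  have -> : T a = set0 by apply/seteqP; split=> // g gT; apply: no; exists g.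
  by rewrite fset_set0 cardfs0.
have mf : measurable_fun setT (fun a : G => (\1_W a : R)%:E).
  by apply/measurable_EFinP; exact: measurable_indic.
have f0 (a : G) : (0 <= (\1_W a : R)%:E)%E by rewrite lee_fin.
have := integral_unfold hA hmu hD mf f0; rewrite integral_indic// setIT muW => h.
have : (#|` B|%:R%:E <= c%:R%:E * mu D)%E.
  rewrite -h -integral_cst//; apply: ge0_le_integral => //.
  - by move=> a _; apply: esum_ge0.
  - exact: measurable_funS (measurable_unfold mf f0).
  move=> a _; rewrite (@esum_finite_support _ _ _ (T a) (fun g => \1_W (rat_trans g a)))//.
  - rewrite lee_fin; apply: (@le_trans _ _ #|` fset_set (T a)|%:R); last by rewrite ler_nat.
    rewrite -sum1_size natr_sum; apply: ler_sum => g _.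
    by rewrite indicE; case: (_ \in _); rewrite ?ler01.
  - by move=> g [].
  - move=> g gQ nT; rewrite indicE memNset// => Wg; exact: nT.
rewrite -(fineK muDf) -EFinM lee_fin leNgt => /negP; apply.
apply: (@lt_le_trans _ _ N%:R); last by rewrite ler_nat.
exact: truncnS_gt.
Qed.

End Classes.

(** * Transitivity of O_A(R) *)

Section Reflections.
Variables (R : realType) (m : nat) (A : 'M[int]_m).
Hypothesis hA : pos_def (zmx R A).
Local Notation Q := (zmx R A).

(** The reflection in w = u - v, or the identity when w = 0. Equality of the two norms gives q(w) =
    2 <w, u>, so u is moved by exactly w; a vector pairing equally with u and v is orthogonal to w,
    hence fixed. *)
Lemma reflection_orth (u v : 'cV[R]_m) :
  (u^T *m Q *m u) 0 0 = (v^T *m Q *m v) 0 0 ->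
  exists2 h : 'M[R]_m, orth A h & h *m u = v /\
    forall x : 'cV[R]_m, u^T *m Q *m x = v^T *m Q *m x -> h *m x = x.
Proof.
move=> uv; have [->|neq] := eqVneq u v.
  by exists 1%:M; [exact: orth1|split=> [|x _]; rewrite mul1mx].
have [symQ posQ] := hA; pose w := u - v.
have w0 : w != 0 by rewrite subr_eq0.
pose q := (w^T *m Q *m w) 0 0; have q0 : q != 0 by rewrite gt_eqF// posQ.
have qE : w^T *m Q *m w = q%:M by rewrite [LHS]mx11_scalar.
pose h : 'M[R]_m := 1%:M - (2 / q) *: (w *m (w^T *m Q)).
have hx (x : 'cV[R]_m) : h *m x = x - (2 / q * (w^T *m Q *m x) 0 0) *: w.
  set c := (_ 0 0); have cE : w^T *m Q *m x = c%:M by exact: mx11_scalar.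
  by rewrite mulmxBl mul1mx -scalemxAl -(mulmxA w) cE mul_mx_scalar scalerA.
have wQ x : (w^T *m Q *m x) 0 0 = (u^T *m Q *m x) 0 0 - (v^T *m Q *m x) 0 0.
  have -> : w^T = u^T - v^T by rewrite linearB.
  by rewrite 2!mulmxBl mxE [X in _ + X]mxE.
exists h; last split.
- rewrite /orth /=.
  have hT : h^T = 1%:M - (2 / q) *: (Q *m w *m w^T).
    by rewrite linearB linearZ /= trmx1 trmx_mul trmx_mul symQ trmxK.
  rewrite hT mulmxBl mul1mx mulmxBr mulmx1 mulmxBl.
  rewrite -!scalemxAl -!scalemxAr scalerA -!mulmxA (mulmxA w^T Q) (mulmxA (w^T *m Q) w) qE.
  rewrite mul_scalar_mx -!scalemxAr scalerA.
  have -> : 2 / q * (2 / q) * q = 2 / q + 2 / q by field.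
  by rewrite scalerDl opprB addrK subrK.
- rewrite hx; suff -> : 2 / q * (w^T *m Q *m u) 0 0 = 1 by rewrite scale1r opprB addrCA subrr addr0.
  have e : q = 2 * (w^T *m Q *m u) 0 0.
    have vu : (v^T *m Q *m u) 0 0 = (u^T *m Q *m v) 0 0.
      have -> : u^T *m Q *m v = (v^T *m Q *m u)^T by rewrite !trmx_mul trmxK symQ mulmxA.
      by rewrite [RHS]mxE.
    have -> : q = (w^T *m Q *m u) 0 0 - (w^T *m Q *m v) 0 0.
      by rewrite /q {2}/w mulmxBr mxE [X in _ + X]mxE.
    by rewrite !wQ vu uv; ring.
  by rewrite e; field; move: q0; rewrite e mulf_eq0 negb_or => /andP[].
- by move=> x ux; rewrite hx wQ ux subrr mulr0 scale0r subr0.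
Qed.

(* Reflect the columns of X onto those of Y one after the other: the reflection
   that moves a column fixes the columns already in place. *)
Lemma orth_transitive n (C : 'M[R]_n) X Y :
  repr_var A C X -> repr_var A C Y -> exists2 h : 'M[R]_m, orth A h & h *m X = Y.
Proof.
move=> XC YC.
suff hk k : (k <= n)%N -> exists2 h : 'M[R]_m, orth A h &
    forall j : 'I_n, (j < k)%N -> h *m col j X = col j Y.
  have [h hA' hX] := hk n (leqnn n); exists h => //.
  apply/matrixP => i j; have /matrixP/(_ i 0) := hX j (ltn_ord j).
  by rewrite colE mulmxA -colE !mxE.
elim: k => [_|k IH kn]; first by exists 1%:M; [exact: orth1|].
have [h hA' hX] := IH (ltnW kn); pose jk := Ordinal kn.
pose Z := h *m X; have ZC : repr_var A C Z by exact: orth_repr_var.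
have colM (M : 'M[R]_m) (W : 'M[R]_(m, n)) j : M *m col j W = col j (M *m W).
  by rewrite !colE mulmxA.
have gram (W : 'M[R]_(m, n)) i j : repr_var A C W ->
    (col i W)^T *m Q *m col j W = (C i j)%:M.
  move=> WC; rewrite [LHS]mx11_scalar; congr (_%:M); rewrite -WC.
  rewrite !colE trmx_mul trmx_delta -!mulmxA !mulmxA -(mulmxA _ W^T) -(mulmxA _ (W^T *m _)).
  by rewrite -rowE -colE !mxE.
have [|r rA [ru rx]] := reflection_orth (u := col jk Z) (v := col jk Y).
  by rewrite !gram.
exists (r *m h); first exact: orthM.
move=> j; rewrite ltnS leq_eqVlt => /orP[/eqP jk'|lt].
  have -> : j = jk by exact: val_inj.
  by rewrite -mulmxA colM.
rewrite -mulmxA hX//; apply: rx.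
by rewrite -{1}(hX j lt) colM !gram.
Qed.

End Reflections.

(** * Polynomial functions on V_{A,C}(R) *)

Section Polynomials.
Variables (R : realType) (m n : nat).
Local Notation C := R[i].

Lemma cmxM a b c (M : 'M[R]_(a, b)) (N : 'M[R]_(b, c)) : cmx (M *m N) = cmx M *m cmx N.
Proof. exact: (map_mxM (@real_complex R)). Qed.

Lemma cmx_inv a (M : 'M[R]_a) : cmx (invmx M) = invmx (cmx M).
Proof. exact: (map_invmx (@real_complex R)). Qed.

Lemma cmx_orth (A : 'M[int]_m) (g : 'M[R]_m) : orth A g -> orth A (cmx g).
Proof.
rewrite /orth /= => /(congr1 (@cmx R m m)); rewrite !cmxM.
have -> : cmx (zmx R A) = zmx C A.
  by apply/matrixP => i j; rewrite !mxE; exact: (rmorph_int (@real_complex R)).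
by have -> : cmx g^T = (cmx g)^T by apply/matrixP => i j; rewrite !mxE.
Qed.

Lemma peval_pact (s : 'M[C]_m) (h : 'M[C]_n) (P : mxpoly R m n) X :
  peval (pact s h P) X = peval P (invmx s *m X *m h).
Proof.
rewrite /peval /pact mpoly.comp_mpoly_meval; apply: mpoly.meval_eq => k.
rewrite tnth_mktuple; case/mxvec_indexP: k => i j; rewrite !mxvecE.
set v := fun _ => _.
have -> : invmx s *m X *m h = map_mx (mpoly.meval v)
   (map_mx (@mpoly.mpolyC (m * n) C) (invmx s) *m generic_mx R m n
    *m map_mx (@mpoly.mpolyC (m * n) C) h).
  rewrite !map_mxM; congr (_ *m _ *m _); apply/matrixP => a b; rewrite !mxE.
  - by rewrite /= mpoly.mevalC.
  - by rewrite /= mpoly.mevalXU /v mxvecE.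
  - by rewrite /= mpoly.mevalC.
by rewrite [RHS]mxE.
Qed.

Lemma pact_linear s h a (P Q : mxpoly R m n) :
  pact s h (a *: P + Q) = a *: pact s h P + pact s h Q.
Proof. by rewrite /pact linearP. Qed.

(** The span is defined by testing against subspaces S; test P against the preimage of S under the
    action of s, which still contains every copy of [lam] because each copy is a submodule. *)
Lemma isotypic_pact (A : 'M[int]_m) lam (s : 'M[C]_m) (P : mxpoly R m n) :
  orth A s -> isotypic A lam P -> isotypic A lam (pact s 1%:M P).
Proof.
move=> sA iP S [S0 SL] SU; apply: (iP [set P | S (pact s 1%:M P)]).
  split=> [|a P1 P2 h1 h2] /=; first by rewrite /pact linear0.
  rewrite pact_linear; exact (SL a _ _ h1 h2).
move=> U irrU isoU Q UQ /=; apply: (SU U irrU isoU).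
by have [[_ sub] _ _ _] := irrU; exact (sub s Q sA UQ).
Qed.

End Polynomials.

(** * Bounded measurable functions and Fubini *)

Section NiceFunctions.
Variables (R : realType) (d : measure_display) (T : measurableType d) (D : set T).
Local Notation C := R[i].

(** Measurability is global but the bound holds on D only, since polynomials are bounded merely on
    the compact variety. Unlike integrability, this condition is stable under products. *)
Definition cnice (f : T -> C) : Prop :=
  [/\ measurable_fun setT (fun t => complex.Re (f t)),
      measurable_fun setT (fun t => complex.Im (f t)) &
      exists b : R, forall t, D t -> `|complex.Re (f t)| <= b /\ `|complex.Im (f t)| <= b].

Lemma cnice_cst c : cnice (fun=> c).
Proof.
split; [exact: measurable_cst|exact: measurable_cst|].
exists (`|complex.Re c| + `|complex.Im c|) => t _; by rewrite lerDl lerDr !normr_ge0.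
Qed.

Lemma cniceD f g : cnice f -> cnice g -> cnice (fun t => f t + g t).
Proof.
move=> [f1 f2 [b hb]] [g1 g2 [c hc]]; split.
- apply: eq_measurable_fun (measurable_funD f1 g1) => t _ /=.
  by case: (f t) (g t) => ? ? [].
- apply: eq_measurable_fun (measurable_funD f2 g2) => t _ /=.
  by case: (f t) (g t) => ? ? [].
exists (b + c) => t Dt; have [b1 b2] := hb t Dt; have [c1 c2] := hc t Dt.
case: (f t) (g t) b1 b2 c1 c2 => ? ? [? ?] /= b1 b2 c1 c2.
by split; apply: le_trans (ler_normD _ _) _; exact: lerD.
Qed.

Lemma cniceM f g : cnice f -> cnice g -> cnice (fun t => f t * g t).
Proof.
move=> [f1 f2 [b hb]] [g1 g2 [c hc]]; split.
- apply: eq_measurable_fun (measurable_funB (measurable_funM f1 g1) (measurable_funM f2 g2)) => t _ /=.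
  by case: (f t) (g t) => ? ? [].
- apply: eq_measurable_fun (measurable_funD (measurable_funM f1 g2) (measurable_funM f2 g1)) => t _ /=.
  by case: (f t) (g t) => ? ? [].
exists (b * c + b * c) => t Dt; have [b1 b2] := hb t Dt; have [c1 c2] := hc t Dt.
case: (f t) (g t) b1 b2 c1 c2 => ? ? [? ?] /= b1 b2 c1 c2.
split; [apply: le_trans (ler_normB _ _) _|apply: le_trans (ler_normD _ _) _];
  by rewrite !normrM; apply: lerD; exact: ler_pM.
Qed.

Lemma cnice_conj f : cnice f -> cnice (fun t => (f t)^*).
Proof.
move=> [f1 f2 [b hb]]; split.
- by apply: eq_measurable_fun f1 => t _; case: (f t).
- apply: eq_measurable_fun (measurable_funB (measurable_cst (0 : R)) f2) => t _ /=.
  by case: (f t) => ? ? /=; rewrite sub0r.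
exists b => t /hb; case: (f t) => ? ? /= [? ?]; by rewrite normrN.
Qed.

Lemma cnice_sum (I : Type) (s : seq I) (F : I -> T -> C) :
  (forall i, cnice (F i)) -> cnice (fun t => \sum_(i <- s) F i t).
Proof.
move=> h; elim: s => [|i s IH].
  by under eq_fun do rewrite big_nil; exact: cnice_cst.
by under eq_fun do rewrite big_cons; exact: cniceD.
Qed.

Lemma cnice_prod (I : Type) (s : seq I) (F : I -> T -> C) :
  (forall i, cnice (F i)) -> cnice (fun t => \prod_(i <- s) F i t).
Proof.
move=> h; elim: s => [|i s IH].
  by under eq_fun do rewrite big_nil; exact: cnice_cst.
by under eq_fun do rewrite big_cons; exact: cniceM.
Qed.

Lemma cniceX f k : cnice f -> cnice (fun t => f t ^+ k).
Proof.
move=> h; elim: k => [|k IH]; first exact: cnice_cst.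
by under eq_fun do rewrite exprS; exact: cniceM.
Qed.

Lemma cnice_peval m n (Phi : T -> 'M[R]_(m, n)) (q : mxpoly R m n) :
  (forall i j, measurable_fun setT (fun t => Phi t i j)) ->
  (exists b, forall t, D t -> forall i j, `|Phi t i j| <= b) ->
  cnice (fun t => peval q (cmx (Phi t))).
Proof.
move=> mPhi [b hb]; rewrite /peval.
under eq_fun do rewrite mpoly.mevalE.
apply: cnice_sum => u; apply: cniceM; first exact: cnice_cst.
apply: cnice_prod => k; apply: cniceX; case/mxvec_indexP: k => i j.
under eq_fun do rewrite mxvecE mxE.
split; [exact: mPhi|exact: measurable_cst|].
exists b => t Dt /=; rewrite normr0 hb//; split=> //.
exact: le_trans (hb t Dt i j).
Qed.

Lemma cnice_integrable (mu : {measure set T -> \bar R}) f : measurable D ->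
  (mu D < +oo)%E -> cnice f -> cintegrable mu D f.
Proof.
move=> mD muD [f1 f2 [b hb]]; split; apply: measurable_bounded_integrable => //.
- exact: measurable_funS f1.
- by exists b; split; [exact: num_real|move=> M bM t /hb[h _] /=; exact: le_trans h (ltW bM)].
- exact: measurable_funS f2.
- by exists b; split; [exact: num_real|move=> M bM t /hb[_ h] /=; exact: le_trans h (ltW bM)].
Qed.

End NiceFunctions.

(** The measures are arbitrary, so Fubini is applied to their finite restrictions to [D1] and [D2];
    the indicators in [g] convert integrals over these sets into integrals over the whole spaces. *)
Lemma fubini_bounded (R : realType) (d1 d2 : measure_display) (T1 : measurableType d1)
    (T2 : measurableType d2) (m1 : {measure set T1 -> \bar R})
    (m2 : {measure set T2 -> \bar R}) (D1 : set T1) (D2 : set T2)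
    (f : T1 * T2 -> R) (b : R) :
  measurable D1 -> measurable D2 -> (m1 D1 < +oo)%E -> (m2 D2 < +oo)%E ->
  measurable_fun setT f -> (forall x y, D1 x -> D2 y -> `|f (x, y)| <= b) ->
  (\int[m1]_(x in D1) \int[m2]_(y in D2) (f (x, y))%:E =
   \int[m2]_(y in D2) \int[m1]_(x in D1) (f (x, y))%:E)%E.
Proof.
move=> mD1 mD2 oo1 oo2 mf fb.
pose r1 : {finite_measure set T1 -> \bar R} := mfrestr mD1 oo1.
pose r2 : {finite_measure set T2 -> \bar R} := mfrestr mD2 oo2.
pose g (z : T1 * T2) : R := f z * (\1_D1 z.1 * \1_D2 z.2).
have restr1 (h : T1 -> \bar R) : (\int[r1]_x (h \_ D1) x = \int[m1]_(x in D1) h x)%E.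
  rewrite -integral_mkcond; apply: eq_measure_integral => B mB BD.
  by rewrite /r1 /= /mfrestr /mrestr setIidl.
have restr2 (h : T2 -> \bar R) : (\int[r2]_x (h \_ D2) x = \int[m2]_(x in D2) h x)%E.
  rewrite -integral_mkcond; apply: eq_measure_integral => B mB BD.
  by rewrite /r2 /= /mfrestr /mrestr setIidl.
have mg : measurable_fun setT g.
  apply: measurable_funM => //; apply: measurable_funM.
    apply: (measurableT_comp (measurable_indic mD1)); exact: measurable_fst.
  apply: (measurableT_comp (measurable_indic mD2)); exact: measurable_snd.
(* The bound b may be negative if [D1] or [D2] is empty, and g vanishes off their product; the
   maximum with 0 covers both. *)
have gb z : `|g z| <= Num.max b 0.
  case: z => x y; rewrite /g /= !indicE.
  case: (boolP (x \in D1)) => [/set_mem xD|_]; last by rewrite mul0r mulr0 normr0 le_max lexx orbT.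
  case: (boolP (y \in D2)) => [/set_mem yD|_]; last by rewrite !mulr0 normr0 le_max lexx orbT.
  by rewrite !mulr1 le_max fb.
have ig : (r1 \x r2)%E.-integrable setT (EFin \o g).
  apply: measurable_bounded_integrable => //.
    have e : (r1 \x r2)%E setT = (r1 setT * r2 setT)%E by rewrite -setXTT product_measure1E.
    by rewrite /= e -ge0_fin_numE ?mule_ge0// fin_numM// fin_num_measure.
  exists (Num.max b 0); split; first exact: num_real.
  by move=> M bM z _ /=; apply: le_trans (gb z) (ltW bM).
have := Fubini ig.
have -> : (\int[r1]_x \int[r2]_y (EFin \o g) (x, y) =
    \int[m1]_(x in D1) \int[m2]_(y in D2) (f (x, y))%:E)%E.
  rewrite -restr1; apply: eq_integral => x _; rewrite patchE.
  case: (boolP (x \in D1)) => xD.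
    rewrite -restr2; apply: eq_integral => y _; rewrite patchE /= /g /= !indicE xD mul1r.
    by case: (_ \in _); rewrite ?mulr1 ?mulr0.
  rewrite (eq_integral (cst 0%E)) ?integral0// => y _.
  by rewrite /= /g /= indicE (negbTE xD) mul0r mulr0.
have -> : (\int[r2]_y \int[r1]_x (EFin \o g) (x, y) =
    \int[m2]_(y in D2) \int[m1]_(x in D1) (f (x, y))%:E)%E => [|//].
rewrite -restr2; apply: eq_integral => y _; rewrite patchE.
case: (boolP (y \in D2)) => yD.
  rewrite -restr1; apply: eq_integral => x _; rewrite patchE /= /g /= !indicE yD mulr1.
  by case: (_ \in _); rewrite ?mulr1 ?mulr0.
rewrite (eq_integral (cst 0%E)) ?integral0// => x _.
by rewrite /= /g /= !indicE (negbTE yD) !mulr0.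
Qed.

(** * The invariant mean and the reproducing kernel *)

Section EntrywiseMeasurable.
Variables (R : realType) (d : measure_display) (T : measurableType d).

Definition entry_meas a b (M : T -> 'M[R]_(a, b)) : Prop :=
  forall i j, measurable_fun setT (fun t => M t i j).

Lemma entry_meas_cst a b (M : 'M[R]_(a, b)) : entry_meas (fun=> M).
Proof. by move=> i j; exact: measurable_cst. Qed.

Lemma entry_meas_tr a b (M : T -> 'M[R]_(a, b)) : entry_meas M -> entry_meas (fun t => (M t)^T).
Proof. by move=> h i j; under eq_fun do rewrite mxE; exact: h. Qed.

Lemma entry_measM a b c (M : T -> 'M[R]_(a, b)) (N : T -> 'M[R]_(b, c)) :
  entry_meas M -> entry_meas N -> entry_meas (fun t => M t *m N t).
Proof.
move=> hM hN i j; under eq_fun do rewrite mxE.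
by apply: measurable_sum => k; apply: measurable_funM.
Qed.

End EntrywiseMeasurable.

Section MatrixBorel.
Variables (R : realType) (m n : nat).
Local Notation T := (mx_borel R m n).

Lemma entry_meas_id : @entry_meas R _ T m n id.
Proof.
move=> i j; apply: (measurability _ (RGenOInfty.measurableE R)) => // _ [_ [x ->] <-].
rewrite setTI; apply: sub_sigma_algebra.
apply: (@open_comp 'M[R]_(m, n) R (fun M => M i j) `]x, +oo[%classic).
  by move=> M _; exact: coord_continuous.
exact: interval_open.
Qed.

Lemma continuous_mulmx (h : 'M[R]_m) : continuous (mulmx h : 'M[R]_(m, n) -> 'M[R]_(m, n)).
Proof.
move=> X U [P hP sPU]; have FX : ProperFilter (nbhs X) by exact: mx_nbhs_filter.
have c i j : (fun Y : 'M[R]_(m, n) => (h *m Y) i j) Y @[Y --> X] --> (h *m X) i j.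
  have -> : (fun Y : 'M[R]_(m, n) => (h *m Y) i j) = (fun Y => \sum_k h i k * Y k j).
    by apply/funext => Y; rewrite mxE.
  rewrite mxE; elim: (index_enum _) => [|k s IH].
    rewrite big_nil.
    have -> : (fun Y : 'M[R]_(m, n) => \sum_(k <- [::]) h i k * Y k j) = (fun=> 0).
      by apply/funext => Y; rewrite big_nil.
    by move=> W /nbhs_singleton W0; exists (fun _ _ => setT) => [? ?|? _]; [exact: filterT|exact W0].
  rewrite big_cons.
  have -> : (fun Y : 'M[R]_(m, n) => \sum_(l <- k :: s) h i l * Y l j) =
      (fun Y => h i k * Y k j + \sum_(l <- s) h i l * Y l j).
    by apply/funext => Y; rewrite big_cons.
  apply: cvgD => //; apply: cvgM; [exact: cvg_cst|exact: coord_continuous].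
have : nbhs X [set Y | forall ij : 'I_m * 'I_n, P ij.1 ij.2 ((h *m Y) ij.1 ij.2)].
  apply: (@filter_forall _ _ (fun (ij : 'I_m * 'I_n) (Y : 'M[R]_(m, n)) =>
    P ij.1 ij.2 ((h *m Y) ij.1 ij.2)) (nbhs X) FX) => -[i j].
  exact: (c i j _ (hP i j)).
by apply: filterS => Y hY; apply: sPU => i j; exact: (hY (i, j)).
Qed.

Lemma measurable_mulmx (h : 'M[R]_m) : measurable_fun setT (mulmx h : T -> T).
Proof.
apply: (@measurability _ _ T T setT (mulmx h) (@open 'M[R]_(m, n))) => // _ [U oU <-].
rewrite setTI; apply: sub_sigma_algebra; apply: open_comp => // X _.
exact: continuous_mulmx.
Qed.

Lemma measurable_repr_var (A : 'M[int]_m) (C : 'M[R]_n) : measurable (repr_var A C : set T).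
Proof.
have -> : (repr_var A C : set T) = \bigcap_(ij in [set: 'I_n * 'I_n])
    [set X | (X^T *m zmx R A *m X) ij.1 ij.2 = C ij.1 ij.2].
  apply/seteqP; split=> [X XC ij _ /=|X h]; first by rewrite XC.
  by apply/matrixP => i j; exact: (h (i, j)).
apply: fin_bigcap_measurable => // -[i j] _ /=.
have mE : @entry_meas R _ T n n (fun X => X^T *m zmx R A *m X).
  apply: entry_measM entry_meas_id; apply: entry_measM; last exact: entry_meas_cst.
  by apply: entry_meas_tr; exact: entry_meas_id.
have := mE i j measurableT [set C i j] (measurable_set1 _).
by rewrite setTI.
Qed.

End MatrixBorel.

Section InvariantMean.
Variables (R : realType) (m n : nat) (A : 'M[int]_m) (C : 'M[R]_n).
Hypothesis hA : pos_def (zmx R A).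
Local Notation G := (adelic_borel R A).
Local Notation V := (repr_var A C).
Local Notation M := 'M[R]_(m, n).

(** Quantifying over all parametrizations [Phi] lets one F be integrated over V, over the adelic
    group, and over the products on which Fubini is used. *)
Definition nice (F : M -> R) : Prop :=
  (forall (d : measure_display) (T : measurableType d) (Phi : T -> M),
     entry_meas Phi -> measurable_fun setT (fun t => F (Phi t))) /\
  exists b, forall X, V X -> `|F X| <= b.

Lemma arch_elt (h : 'M[R]_m) : orth A h ->
  exists a : adelic_orth R A, arch a = h /\ forall p, fin a p = 1%:M.
Proof.
move=> hO; have h1 p : orth A (1%:M : 'M[padic p]_m) := orth1 A _.
have h2 : exists N : nat, forall p, (N < val p)%N -> padic_int_mx (1%:M : 'M[padic p]_m).
  by exists 0%N => p _; exact: padic_int_mx1.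
by exists (@AdelicOrth R m A h _ hO h1 h2).
Qed.

Lemma lat_arch_elt (a b : adelic_orth R A) : (forall p, fin a p = 1%:M) ->
  lat (adelic_mul a b) = lat b.
Proof.
by move=> a1; apply/seteqP; split=> v h p; have := h p; rewrite /= a1 mul1mx.
Qed.

Lemma entry_meas_arch : @entry_meas R _ G m m (fun a => arch a).
Proof. exact: measurable_arch. Qed.

Lemma entry_meas_arch_inv : @entry_meas R _ G m m (fun a => invmx (arch a)).
Proof.
have -> : (fun a : G => invmx (arch a)) =
    (fun a : G => invmx (zmx R A) *m (arch a)^T *m zmx R A).
  by apply/funext => a; rewrite (orth_invE (zmx_unit_num hA R) (arch_orth a)).
apply: entry_measM; last exact: entry_meas_cst.
apply: entry_measM; first exact: entry_meas_cst.
by apply: entry_meas_tr; exact: entry_meas_arch.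
Qed.

Variable mu : {measure set G -> \bar R}.
Hypothesis hmu : is_haar mu.
Variable L : set 'cV[rat]_m.
Hypothesis gL : genus A L.
Local Notation FL := (lat_fiber L : set G).

Let mFL : measurable FL := measurable_lat_fiber hA L.
Let muFL : mu FL = 1%E := measure_lat_fiber hA hmu gL.
Let muFLoo : (mu FL < +oo)%E. Proof. by rewrite muFL ltry. Qed.

Lemma arch_inv_repr (a : G) X : V X -> V (invmx (arch a) *m X).
Proof.
by move=> VX; apply: orth_repr_var => //; exact: (orthV (zmx_unit_num hA R) (arch_orth a)).
Qed.

(** An adele with trivial finite part maps each fibre of [lat] onto itself, so Haar invariance
    restricts to the fibre. *)
Lemma integral_arch_mul (a : adelic_orth R A) (f : G -> R) : (forall p, fin a p = 1%:M) ->
  measurable_fun setT f -> (exists b, forall u, FL u -> `|f u| <= b) ->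
  (\int[mu]_(u in FL) (f (adelic_mul a u))%:E = \int[mu]_(u in FL) (f u)%:E)%E.
Proof.
move=> a1 mf [b fb].
have pre : (adelic_mul a : G -> G) @^-1` FL = FL.
  by apply/seteqP; split=> u; rewrite /lat_fiber /= lat_arch_elt.
have mfE : measurable_fun setT (EFin \o f) by exact/measurable_EFinP.
have int : mu.-integrable ((adelic_mul a : G -> G) @^-1` FL) ((EFin \o f) \o adelic_mul a).
  rewrite pre; apply: (@measurable_bounded_integrable _ G R mu (f \o adelic_mul a) FL).
  - exact: mFL.
  - exact: muFLoo.
  - have mfa := measurableT_comp mf (measurable_adelic_mul a).
    exact (measurable_funS measurableT (@subsetT _ FL) mfa).
  exists b; split; first exact: num_real.
  move=> c bc u uL /=; apply: le_trans (ltW bc); apply: fb.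
  by rewrite -pre in uL.
have e := @integral_pushforward _ _ G G R _ (measurable_adelic_mul a) mu FL _ mfE int mFL.
rewrite pre in e; transitivity (\int[mu]_(u in FL) ((EFin \o f) \o adelic_mul a) u)%E.
  by [].
rewrite -e; apply: eq_measure_integral => [|mphi S mS _]; first exact: measurable_adelic_mul.
by rewrite /pushforward; have [_ inv] := hmu; exact: inv.
Qed.

(* Any O_A(R)-invariant mean on V is the mean of the u^-1 X0: average
   F(u^-1 X) over both u and X, in the two possible orders. *)
Lemma mean_unique (d : measure_display) (T : measurableType d)
    (rho : {measure set T -> \bar R}) (DT : set T) (Phi : T -> M) (X0 : M) :
  measurable DT -> rho DT = 1%E -> entry_meas Phi -> (forall t, DT t -> V (Phi t)) ->
  (forall h F, orth A h -> nice F ->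
    \int[rho]_(t in DT) (F (h *m Phi t))%:E = \int[rho]_(t in DT) (F (Phi t))%:E)%E ->
  V X0 -> forall F, nice F ->
  (\int[rho]_(t in DT) (F (Phi t))%:E =
   \int[mu]_(u in FL) (F (invmx (arch u) *m X0))%:E)%E.
Proof.
move=> mDT rho1 mPhi VPhi inv VX0 F nF; have [mF [b Fb]] := nF.
pose f (z : G * T) : R := F (invmx (arch z.1) *m Phi z.2).
have mf : measurable_fun setT f.
  apply: mF; apply: entry_measM => i j.
    apply: (measurableT_comp (entry_meas_arch_inv i j)); exact: measurable_fst.
  apply: (measurableT_comp (mPhi i j)); exact: measurable_snd.
have rhooo : (rho DT < +oo)%E by rewrite rho1 ltry.
have fub := @fubini_bounded R _ _ G T mu rho FL DT f b mFL mDT muFLoo rhooo mf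
  (fun u t _ tD => Fb _ (arch_inv_repr u (VPhi t tD))).
set c := (LHS); have l : (\int[mu]_(u in FL) \int[rho]_(t in DT) (f (u, t))%:E = c)%E.
  transitivity (\int[mu]_(u in FL) cst c u)%E.
    apply: eq_integral => u _ /=; apply: (inv (invmx (arch u)) F) => //.
    exact: (orthV (zmx_unit_num hA R) (arch_orth u)).
  by rewrite integral_cst; [rewrite [X in (_ * X)%E]muFL mule1|exact: mFL].
set c' := (RHS); suff r : (\int[rho]_(t in DT) \int[mu]_(u in FL) (f (u, t))%:E = c')%E.
  by rewrite -l fub r.
transitivity (\int[rho]_(t in DT) cst c' t)%E; last first.
  by rewrite integral_cst// rho1 mule1.
apply: eq_integral.
move=> t /set_mem tD /=.
(* By transitivity the point is h X0, and the substitution of h u for u turns u^-1 h X0 into u^-1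
   X0: the inner integral does not depend on t. *)
have [h hO hX] := orth_transitive hA VX0 (VPhi t tD).
have [a [aE a1]] := arch_elt hO.
rewrite /f /= -hX -(@integral_arch_mul a (fun u => F (invmx (arch u) *m (h *m X0))))//.
- apply: eq_integral => u _ /=; rewrite aE.
  rewrite (invmxM (orth_unit (zmx_unit_num hA R) hO) (arch_unit hA u)).
  by rewrite -mulmxA (mulKmx (orth_unit (zmx_unit_num hA R) hO)).
- by apply: mF; apply: entry_measM; [exact: entry_meas_arch_inv|exact: entry_meas_cst].
by exists b => u _; apply/Fb/arch_inv_repr; rewrite hX; exact: VPhi.
Qed.

Variable muB : probability (mx_borel R m n) R.
Hypothesis hmuB : invariant_probability A C muB.

Lemma integral_repr_var_orth (h : 'M[R]_m) F : orth A h -> nice F ->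
  (\int[muB]_(X in V) (F (h *m X))%:E = \int[muB]_(X in V) (F X)%:E)%E.
Proof.
move=> hO [mF [b Fb]]; have mV := @measurable_repr_var R m n A C.
have pre : (mulmx h : mx_borel R m n -> mx_borel R m n) @^-1` V = V.
  apply/seteqP; split=> X /= hX; last exact: orth_repr_var.
  rewrite -[X](mulKmx (orth_unit (zmx_unit_num hA R) hO)).
  by apply: orth_repr_var => //; exact: (orthV (zmx_unit_num hA R) hO).
have mF' : measurable_fun setT (F : mx_borel R m n -> R).
  exact: (mF _ (mx_borel R m n) id (@entry_meas_id R m n)).
have mfE : measurable_fun setT (EFin \o (F : mx_borel R m n -> R)) by exact/measurable_EFinP.
have int : muB.-integrable ((mulmx h : mx_borel R m n -> mx_borel R m n) @^-1` V)
    ((EFin \o F) \o mulmx h).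
  rewrite pre; apply: (@measurable_bounded_integrable _ (mx_borel R m n) R muB (F \o mulmx h) V).
  - exact: mV.
  - by rewrite (le_lt_trans (probability_le1 _ mV))// ltry.
  - have mfh := measurableT_comp mF' (measurable_mulmx h).
    exact (@measurable_funS _ _ (mx_borel R m n) _ setT V _ measurableT
      (@subsetT (mx_borel R m n) V) mfh).
  exists b; split; first exact: num_real.
  by move=> c bc X VX /=; apply: le_trans (ltW bc); apply: Fb; exact: orth_repr_var.
have e := @integral_pushforward _ _ (mx_borel R m n) (mx_borel R m n) R _
  (measurable_mulmx h) muB V _ mfE int mV.
rewrite pre in e; transitivity (\int[muB]_(X in V) ((EFin \o F) \o mulmx h) X)%E.
  by [].
rewrite -e; apply: eq_measure_integral => [|mphi S mS _]; first exact: measurable_mulmx.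
by rewrite /pushforward; have [_ inv] := hmuB; exact: inv.
Qed.

(** Uniqueness applied twice: the mean over u X0 and the mean for [muB] are both invariant, hence
    both equal the mean over u^-1 X0. *)
Lemma mean_arch F X0 : V X0 -> nice F ->
  (\int[mu]_(u in FL) (F (arch u *m X0))%:E = \int[muB]_(X in V) (F X)%:E)%E.
Proof.
move=> VX0 nF; have [mF [b Fb]] := nF.
have Va (u : G) : V (arch u *m X0) by apply: orth_repr_var => //; exact: arch_orth.
have mP : @entry_meas R _ G m n (fun u => arch u *m X0).
  by apply: entry_measM; [exact: entry_meas_arch|exact: entry_meas_cst].
rewrite (@mean_unique _ G mu FL (fun u => arch u *m X0) X0 mFL muFL mP)//.
- apply/esym; apply: (@mean_unique _ (mx_borel R m n) muB V id X0) => //.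
  + exact: measurable_repr_var.
  + by case: hmuB.
  + exact: entry_meas_id.
  by move=> h F' hO nF'; exact: integral_repr_var_orth.
move=> h F' hO [mF' [b' Fb']]; have [a [aE a1]] := arch_elt hO.
rewrite -(@integral_arch_mul a (fun u => F' (arch u *m X0)))//.
- by apply: eq_integral => u _ /=; rewrite aE mulmxA.
- exact: mF'.
by exists b' => u _; exact: Fb'.
Qed.

End InvariantMean.

Lemma cintegral_conj (R : realType) (d : measure_display) (T : measurableType d)
    (mu : {measure set T -> \bar R}) (D : set T) (f : T -> R[i]) : measurable D ->
  cintegrable mu D f -> cintegral mu D (fun x => (f x)^*) = (cintegral mu D f)^*.
Proof.
move=> mD [f1 f2]; rewrite /cintegral; apply/eqP; rewrite eq_complex /=.
apply/andP; split; apply/eqP.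
  by apply: eq_Rintegral => x _; case: (f x).
rewrite -mulN1r -RintegralZl//.
by apply: eq_Rintegral => x _; case: (f x) => a b /=; rewrite mulN1r.
Qed.

(** * The reproducing kernel and the archimedean integral *)

Section Archimedean.
Variables (R : realType) (m n : nat) (A : 'M[int]_m) (C : 'M[R]_n).
Hypothesis hA : pos_def (zmx R A).
Local Notation G := (adelic_borel R A).
Local Notation V := (repr_var A C).
Local Notation M := 'M[R]_(m, n).

Definition cniceV (F : M -> R[i]) : Prop :=
  forall (d : measure_display) (T : measurableType d) (D : set T) (Phi : T -> M),
    entry_meas Phi -> (forall t, D t -> V (Phi t)) -> cnice D (fun t => F (Phi t)).

Lemma cniceV_nice F : cniceV F ->
  nice A C (fun X => complex.Re (F X)) /\ nice A C (fun X => complex.Im (F X)).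
Proof.
move=> nF; have [_ _ [b hb]] := nF _ (mx_borel R m n) V id (@entry_meas_id R m n) (fun _ h => h).
split; split.
(* Only the bound in [cnice] refers to D; with D empty, measurability is obtained for every [Phi],
   with values in V or not. *)
- by move=> d T Phi mPhi; have [] := nF _ T set0 Phi mPhi (fun _ => False_ind _).
- by exists b => X /hb[].
- by move=> d T Phi mPhi; have [] := nF _ T set0 Phi mPhi (fun _ => False_ind _).
- by exists b => X /hb[].
Qed.

Lemma cniceV_peval q (h : 'M[R]_m) : orth A h -> cniceV (fun X => peval q (cmx (h *m X))).
Proof.
move=> hO d T D Phi mPhi VPhi; apply: (@cnice_peval _ _ _ _ _ _ (fun t => h *m Phi t)).
  by apply: entry_measM => //; exact: entry_meas_cst.
have [b _ hb] := repr_var_bounded hA C; exists b => t Dt i j.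
by apply: hb; apply: orth_repr_var => //; exact: VPhi.
Qed.

Lemma cniceVM F F' : cniceV F -> cniceV F' -> cniceV (fun X => F X * F' X).
Proof. by move=> nF nF' d T D Phi mPhi VPhi; apply: cniceM; [exact: nF|exact: nF']. Qed.

Lemma cniceV_conj F : cniceV F -> cniceV (fun X => (F X)^*).
Proof. by move=> nF d T D Phi mPhi VPhi; apply: cnice_conj; exact: nF. Qed.

Variable muB : probability (mx_borel R m n) R.
Hypothesis hmuB : invariant_probability A C muB.

Lemma cintegral_repr_var_orth (h : 'M[R]_m) F : orth A h -> cniceV F ->
  cintegral muB V (fun X => F (h *m X)) = cintegral muB V F.
Proof.
move=> hO /cniceV_nice[n1 n2]; rewrite /cintegral /Rintegral.
have e1 := integral_repr_var_orth hA hmuB hO n1.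
have e2 := integral_repr_var_orth hA hmuB hO n2.
by congr Complex; congr fine; [exact e1|exact e2].
Qed.

Variables (lam : set (mxpoly R m n)) (X0 : M) (p : mxpoly R m n).
Hypothesis VX0 : V X0.
Hypothesis hp : reproducing A C muB lam X0 p.

Lemma isotypic_orth q (h : 'M[R]_m) : orth A h -> isotypic A lam q ->
  isotypic A lam (pact (cmx (invmx h)) 1%:M q) /\
  forall X, peval (pact (cmx (invmx h)) 1%:M q) (cmx X) = peval q (cmx (h *m X)).
Proof.
move=> hO iq; split.
  apply: isotypic_pact => //; apply: cmx_orth; exact: (orthV (zmx_unit_num hA R) hO).
by move=> X; rewrite peval_pact mulmx1 -cmx_inv invmxK -cmxM.
Qed.

Lemma reproducing_orth q (h : 'M[R]_m) : orth A h -> isotypic A lam q ->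
  cintegral muB V (fun X => peval q (cmx (h *m X)) * (peval p (cmx X))^*) =
  peval q (cmx (h *m X0)).
Proof.
move=> hO iq; have [iq' qE] := isotypic_orth hO iq.
have [_ rep] := hp; have := rep _ iq'; rewrite qE => <-.
by apply: eq_cintegral => X _; rewrite qE.
Qed.

(** By the reproducing property both values are pairings of p with a translate of p, and the
    substitution of h^-1 X for X under the invariant measure exchanges the two factors. *)
Lemma reproducing_sym (h : 'M[R]_m) : orth A h ->
  peval p (cmx (invmx h *m X0)) = (peval p (cmx (h *m X0)))^*.
Proof.
move=> hO; have hV := orthV (zmx_unit_num hA R) hO; have [ip _] := hp.
have n1 : cniceV (fun X => peval p (cmx (h *m X)) * (peval p (cmx X))^*).
  apply: cniceVM; first exact: cniceV_peval.
  apply: cniceV_conj; have := cniceV_peval p (orth1 A R).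
  by under eq_fun do rewrite mul1mx.
have mV := @measurable_repr_var R m n A C.
have hu := orth_unit (zmx_unit_num hA R) hO.
rewrite -(reproducing_orth hO ip) -(reproducing_orth hV ip) -(cintegral_repr_var_orth hV n1).
rewrite -cintegral_conj//; last first.
  apply: cnice_integrable => //; first by rewrite (le_lt_trans (probability_le1 _ mV))// ltry.
  apply: (n1 _ (mx_borel R m n) V (fun X => invmx h *m X)).
    by apply: entry_measM; [exact: entry_meas_cst|exact: entry_meas_id].
  by move=> X VX; exact: orth_repr_var.
apply: eq_cintegral => X _; rewrite (mulKVmx hu) rmorphM /= conjCK mulrC.
by [].
Qed.

Variable mu : {measure set G -> \bar R}.
Hypothesis hmu : is_haar mu.
Variable L : set 'cV[rat]_m.
Hypothesis gL : genus A L.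
Local Notation FL := (lat_fiber L : set G).

Lemma cnice_archimedean q X : V X -> @cnice R _ G FL (fun u =>
  peval p (cmx (invmx (arch u) *m X)) * peval q (cmx (arch u *m X0))).
Proof.
move=> VX; have [b _ hb] := repr_var_bounded hA C; apply: cniceM.
  apply: (@cnice_peval _ _ G FL _ _ (fun u => invmx (arch u) *m X)).
    by apply: entry_measM; [exact: (entry_meas_arch_inv hA)|exact: entry_meas_cst].
  by exists b => u _; apply: hb; exact: arch_inv_repr.
apply: (@cnice_peval _ _ G FL _ _ (fun u => arch u *m X0)).
  by apply: entry_measM; [exact: entry_meas_arch|exact: entry_meas_cst].
by exists b => u _; apply: hb; apply: orth_repr_var => //; exact: arch_orth.
Qed.

(** Write X = h X0 and replace u by h u: the integrand becomes p(u^-1 X0) q(h u X0), which the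
    symmetry of p turns into a function of u X0 alone. Its mean is the pairing of q(h Y) with p(Y)
    over V, equal to q(h X0). *)
Lemma archimedean_integral q X : V X -> isotypic A lam q ->
  cintegral mu FL (fun u : G =>
    peval p (cmx (invmx (arch u) *m X)) * peval q (cmx (arch u *m X0))) =
  peval q (cmx X).
Proof.
move=> VX iq; have [h hO hX] := orth_transitive hA VX0 VX.
have [a [aE a1]] := arch_elt hO; have hu := orth_unit (zmx_unit_num hA R) hO.
have [m1 m2 [b hb]] := cnice_archimedean q VX.
have nF : cniceV (fun Y => peval q (cmx (h *m Y)) * (peval p (cmx Y))^*).
  apply: cniceVM; first exact: cniceV_peval.
  apply: cniceV_conj; have := cniceV_peval p (orth1 A R).
  by under eq_fun do rewrite mul1mx.
have [nF1 nF2] := cniceV_nice nF.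
have key (u : G) : peval p (cmx (invmx (arch (adelic_mul a u)) *m X)) *
    peval q (cmx (arch (adelic_mul a u) *m X0)) =
    peval q (cmx (h *m (arch u *m X0))) * (peval p (cmx (arch u *m X0)))^*.
  rewrite /= aE -hX (invmxM hu (arch_unit hA u)) -(mulmxA _ (invmx h)) (mulKmx hu).
  by rewrite (reproducing_sym (arch_orth u)) mulrC !mulmxA.
rewrite -[in RHS]hX -(reproducing_orth hO iq) /cintegral /Rintegral.
congr Complex; congr fine.
  rewrite -(mean_arch hA hmu gL hmuB VX0 nF1).
  rewrite -(integral_arch_mul hA hmu gL a1 m1); last by exists b => u /hb[].
  by apply: eq_integral => u _; rewrite key.
rewrite -(mean_arch hA hmu gL hmuB VX0 nF2).
rewrite -(integral_arch_mul hA hmu gL a1 m2); last by exists b => u /hb[].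
by apply: eq_integral => u _; rewrite key.
Qed.

End Archimedean.

(** * Orbits of rational isometries and the Weyl sum *)

Section FiniteSums.
Variable R : realType.

Lemma rsum_finite_support (T : choiceType) (S F : set T) (f : T -> R) :
  finite_set F -> F `<=` S -> (forall x, S x -> ~ F x -> f x = 0) ->
  rsum S f = \sum_(x <- fset_set F) f x.
Proof.
move=> finF FS fF; rewrite /rsum.
rewrite (esum_finite_support (h := fun x => Num.max (f x) 0) finF FS); last 2 first.
- by move=> x; rewrite le_max lexx orbT.
- by move=> x Sx nF; rewrite fF// maxxx.
rewrite (esum_finite_support (h := fun x => Num.max (- f x) 0) finF FS); last 2 first.
- by move=> x; rewrite le_max lexx orbT.
- by move=> x Sx nF; rewrite fF// oppr0 maxxx.
rewrite /= -sumrB; apply: eq_bigr => x _.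
by case: (leP (f x) 0); case: (leP (- f x) 0); lra.
Qed.

Lemma csum_finite_support (T : choiceType) (S F : set T) (f : T -> R[i]) :
  finite_set F -> F `<=` S -> (forall x, S x -> ~ F x -> f x = 0) ->
  csum S f = \sum_(x <- fset_set F) f x.
Proof.
move=> finF FS fF; rewrite /csum.
rewrite (rsum_finite_support (f := fun x => complex.Re (f x)) finF FS); last first.
  by move=> x Sx nF; rewrite fF.
rewrite (rsum_finite_support (f := fun x => complex.Im (f x)) finF FS); last first.
  by move=> x Sx nF; rewrite fF.
have -> : \sum_(x <- fset_set F) complex.Re (f x) = complex.Re (\sum_(x <- fset_set F) f x).
  by apply/esym; exact: raddf_sum.
have -> : \sum_(x <- fset_set F) complex.Im (f x) = complex.Im (\sum_(x <- fset_set F) f x).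
  by apply/esym; exact: raddf_sum.
by case: (\sum_(x <- _) _).
Qed.

End FiniteSums.

Section Orbits.
Variables (R : realType) (m n : nat) (A : 'M[int]_m) (B : 'M[int]_n).
Hypothesis hA : pos_def (zmx R A).
Local Notation FrL := (framed_lattice R m n).
Local Notation unitA := (zmx_unit_num hA rat).
Local Notation SQ := [set g : 'M[rat]_m | orth A g].

Lemma rat_act_comp g h (Q : FrL) : rat_act g (rat_act h Q) = rat_act (g *m h) Q.
Proof.
case: Q => X L; rewrite /rat_act /= lat_image_comp; congr pair.
by rewrite qmx_archM mulmxA.
Qed.

Lemma rat_act1 (Q : FrL) : rat_act 1%:M Q = Q.
Proof.
case: Q => X L; rewrite /rat_act /= lat_image1; congr pair.
by rewrite /qmx map_mx1 mul1mx.
Qed.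

Lemma genus_image g (L : set 'cV[rat]_m) : orth A g -> genus A L ->
  genus A [set g *m v | v in L].
Proof.
move=> gA /(genus_latP hA)[a <-].
by rewrite -(@lat_rat_trans R m A hA g a gA); exact: genus_lat.
Qed.

Lemma in_LAB_act g (Q : FrL) : orth A g -> in_LAB A B Q -> in_LAB A B (rat_act g Q).
Proof.
move=> gA [h1 h2]; split; last exact: genus_image.
by apply: orth_repr_var => //; exact: orth_qmx_arch.
Qed.

Lemma in_SB_act g (Q : FrL) : orth A g -> in_SB A B Q -> in_SB A B (rat_act g Q).
Proof.
move=> gA [h1 h2]; split; first exact: in_LAB_act.
move=> j; have [v Lv vE] := h2 j; exists (g *m v); first by exists v.
by rewrite /= qmx_archM -vE !colE mulmxA.
Qed.

Lemma rat_orbit_id (Q : FrL) : rat_orbit A Q Q.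
Proof. by exists 1%:M; [exact: orth1|exact: rat_act1]. Qed.

Lemma rat_orbit_act g (Q : FrL) : orth A g -> rat_orbit A (rat_act g Q) = rat_orbit A Q.
Proof.
move=> gA; apply/seteqP; split=> _ [h hQ <-].
  by exists (h *m g); [exact: orthM|rewrite rat_act_comp].
exists (h *m invmx g); first by apply: orthM => //; exact: (orthV unitA).
by rewrite rat_act_comp mulmxKV// (orth_unit unitA).
Qed.

(* the fibre over L of S_B *)
Definition int_repr (L : set 'cV[rat]_m) : set 'M[rat]_(m, n) :=
  [set H | repr_var A (zmx rat B) H /\ forall j, L (col j H)].

Lemma finite_int_repr L : is_lattice L -> finite_set (int_repr L).
Proof.
move=> [M Mu LE]; have [N N0 [M' ME]] := rat_mx_denominator M.
apply: sub_finite_set (finite_repr_var hA (zmx rat B) N0) => H [HB HL]; split=> // i j.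
have := HL j; rewrite LE => -[z sz zE].
have -> : N%:R * H i j = (zmx rat M' *m z) i 0.
  by rewrite -ME -scalemxAl zE !mxE.
rewrite mxE; apply: rpred_sum => k _; apply: rpredM; last exact: sz.
by rewrite mxE; exact: intr_int.
Qed.

Lemma qmxB : qmx R (zmx rat B) = zmx R B.
Proof. by apply/matrixP => i j; rewrite !mxE ratr_int. Qed.

Lemma qmx_inj a b : injective (@qmx R a b).
Proof.
move=> M N /matrixP MN; apply/matrixP => i j; have := MN i j; rewrite !mxE.
exact: (fmorph_inj (@ratr R)).
Qed.

Lemma in_SBP L (H : 'M[rat]_(m, n)) : genus A L ->
  in_SB A B (qmx R H, L) <-> int_repr L H.
Proof.
move=> gL; have cE j : col j (qmx R H) = qmx R (col j H).
  by apply/matrixP => i k; rewrite !mxE.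
split=> [[[HB _] Hc]|[HB HL]].
  split=> [|j]; last by have [v Lv] := Hc j; rewrite /= cE => /qmx_inj ->.
  apply: (@qmx_inj n n); rewrite qmxB -HB /= !qmx_archM; congr (_ *m _ *m _).
    by apply/matrixP => i j; rewrite !mxE.
  by apply/matrixP => i j; rewrite !mxE ratr_int.
split; first by split=> //; rewrite /= -qmxB; exact: qmx_repr_var.
by move=> j; exists (col j H); [exact: HL|exact: cE].
Qed.

Lemma in_SB_rat (Q : FrL) : in_SB A B Q -> exists H, Q.1 = qmx R H.
Proof.
case: Q => X L [_ Hc]; have /choice[v hv] j : exists v, col j X = qmx R v.
  by have [v _] := Hc j; exists v.
exists (\matrix_(i, j) v j i 0); apply/matrixP => i j.
by have /matrixP/(_ i 0) := hv j; rewrite !mxE.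
Qed.

Definition SB_orbits : set (set FrL) := [set rat_orbit A Q | Q in in_SB A B].

(** Each orbit contains a pair whose lattice is the chosen representative of its class, and a fixed
    lattice carries finitely many representations of B. *)
Lemma finite_SB_orbits : finite_set (lat_class A @` genus A) -> finite_set SB_orbits.
Proof.
move=> fc.
have /choice[rep hrep] (K : set (set 'cV[rat]_m)) : exists L,
    (lat_class A @` genus A) K -> genus A L /\ lat_class A L = K.
  have [[L gL <-]|no] := pselect ((lat_class A @` genus A) K); last by exists set0.
  by exists L.
apply: (@sub_finite_set _ _ (\bigcup_(K in lat_class A @` genus A)
   [set rat_orbit A ((qmx R H, rep K) : FrL) | H in int_repr (rep K)])); last first.
  apply: bigcup_finite => // K /hrep[gK _]; apply: finite_image.
  by apply: finite_int_repr; case: gK.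
move=> _ [[X L] QS <-]; have [[_ gL] _] := QS.
have KC : (lat_class A @` genus A) (lat_class A L) by exists L.
exists (lat_class A L) => //; have [gr cr] := hrep _ KC.
have : lat_class A L (rep (lat_class A L)) by rewrite -{1}cr; exact: lat_class_id.
move=> [g gA gE]; have := in_SB_act gA QS; have [H HE] := in_SB_rat QS.
rewrite /rat_act /= in HE *; rewrite gE HE -qmx_archM => QS'.
exists (g *m H); first exact/(in_SBP _ gr).
by rewrite -(rat_orbit_act (qmx R H, L) gA) /rat_act /= gE qmx_archM.
Qed.

Lemma rat_stab_lat (Q : FrL) : rat_stab A Q `<=` lat_stab A Q.2.
Proof. by case: Q => X L g [gA [_ gE]]. Qed.

Lemma finite_rat_stab (Q : FrL) : is_lattice Q.2 -> finite_set (rat_stab A Q).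
Proof. by move=> lL; apply: sub_finite_set (@rat_stab_lat Q) (finite_lat_stab hA lL). Qed.

Definition rat_transp (Q Q' : FrL) : set 'M[rat]_m := [set g | orth A g /\ rat_act g Q = Q'].

Lemma card_rat_transp (Q Q' : FrL) g0 : is_lattice Q'.2 -> rat_transp Q Q' g0 ->
  finite_set (rat_transp Q Q') /\
  #|` fset_set (rat_transp Q Q')| = #|` fset_set (rat_stab A Q')|.
Proof.
move=> lL [g0A g0Q]; have g0u := orth_unit unitA g0A.
have e : rat_transp Q Q' = (fun s => s *m g0) @` rat_stab A Q'.
  apply/seteqP; split=> g.
    move=> [gA gQ]; exists (g *m invmx g0); last by rewrite mulmxKV.
    split; first by apply: orthM => //; exact: (orthV unitA).
    by rewrite -[in LHS]g0Q rat_act_comp mulmxKV.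
  move=> [s [sA sQ] <-]; split; first exact: orthM.
  by rewrite -rat_act_comp g0Q.
have fs := finite_rat_stab lL.
split; first by rewrite e; exact: finite_image.
rewrite e fset_set_image// card_imfset//=.
by move=> s t /(congr1 (mulmx^~ (invmx g0))); rewrite !mulmxK.
Qed.

End Orbits.

(** * Grouping representations by orbits *)

Section WeylSum.
Variables (R : realType) (m n : nat) (A : 'M[int]_m) (B : 'M[int]_n).
Hypothesis hA : pos_def (zmx R A).
Local Notation G := (adelic_borel R A).
Local Notation FrL := (framed_lattice R m n).
Local Notation V := (repr_var A (zmx R B)).
Local Notation unitA := (zmx_unit_num hA rat).
Local Notation SQ := [set g : 'M[rat]_m | orth A g].
Local Notation orbs := (@SB_orbits R m n A B).

(** The very choice made in [weyl_sum], so that the two sums over orbits agree term by term. *)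
Definition orb_rep (O : set FrL) : FrL := xget (0, set0) O.

Lemma orb_repP O : orbs O -> in_SB A B (orb_rep O) /\ rat_orbit A (orb_rep O) = O.
Proof.
move=> [Q QS QO]; have : O (orb_rep O).
  by apply: xgetPex; exists Q; rewrite -QO; exact: rat_orbit_id.
rewrite -QO => -[g gA <-]; split; first exact: in_SB_act.
by rewrite (rat_orbit_act hA).
Qed.

Hypothesis finO : finite_set orbs.

(* Each H in the lattice of a is counted once: the rational isometries carrying
   (H, lat a) to the representative of its orbit form a coset of the stabilizer
   of the latter. *)
Lemma orbit_sum (L : set 'cV[rat]_m) (f : 'M[R]_(m, n) -> R[i]) : genus A L ->
  \sum_(H <- fset_set (int_repr A B L)) f (qmx R H) =
  \sum_(O <- fset_set orbs) (#|` fset_set (rat_stab A (orb_rep O))|%:R)^-1 *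
    \sum_(g <- fset_set (lat_transp A L (orb_rep O).2)) f (qmx R (invmx g) *m (orb_rep O).1).
Proof.
move=> gL; set S := fset_set (int_repr A B L).
have finS : finite_set (int_repr A B L) by apply: (@finite_int_repr R m n A B hA L); case: gL.
pose w (O : set FrL) : R[i] := (#|` fset_set (rat_stab A (orb_rep O))|%:R)^-1.
pose T (O : set FrL) := lat_transp A L (orb_rep O).2.
have latO O : orbs O -> is_lattice (orb_rep O).2.
  by move=> /orb_repP[[[_ [lO _]] _] _].
have finT O : orbs O -> finite_set (T O).
  by move=> OO; apply: (finite_lat_transp hA); exact: latO.
have inO O : O \in fset_set orbs -> orbs O by rewrite in_fset_set// inE.
(* With X the matrix of the representative of O, g^-1 X is the only H with g H = X. Writing its
   contribution as a sum over all H in S makes the sums over H and over (O, g) exchangeable. *)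
have step O g : orbs O -> T O g -> f (qmx R (invmx g) *m (orb_rep O).1) =
    \sum_(H <- S) if qmx R g *m qmx R H == (orb_rep O).1 then f (qmx R H) else 0.
  move=> OO [gA gLO]; have gu := orth_unit unitA gA.
  have gRu : qmx R g \in unitmx by rewrite /qmx map_unitmx.
  have gV := orthV unitA gA; have [QS _] := orb_repP OO.
  have := in_SB_act hA gV QS; have [H HE] := in_SB_rat QS.
  case: (orb_rep O) gLO HE QS => X L' /= gLO HE QS.
  rewrite /rat_act /= HE -qmx_archM -gLO lat_image_comp mulVmx// lat_image1 => QS'.
  have HS : invmx g *m H \in S by rewrite in_fset_set// inE; exact: ((@in_SBP R m n A B L _ gL).1 QS').
  have gH : qmx R g *m qmx R (invmx g *m H) == qmx R H by rewrite -qmx_archM mulKVmx.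
  rewrite (bigD1_seq (invmx g *m H) HS (fset_uniq _)) /= gH big1_seq ?addr0//.
  move=> H' /andP[nH' _]; case: eqP => // e; move/eqP: nH'; case.
  have e' : g *m H' = H by apply: (@qmx_inj R); rewrite qmx_archM.
  by rewrite -e' mulKmx.
transitivity (\sum_(O <- fset_set orbs) \sum_(g <- fset_set (T O)) \sum_(H <- S)
    if qmx R g *m qmx R H == (orb_rep O).1 then w O * f (qmx R H) else 0); last first.
  apply: eq_big_seq => O /inO OO; rewrite mulr_sumr; apply: eq_big_seq => g.
  rewrite in_fset_set; last exact: finT.
  rewrite inE => gT; rewrite (step O g)// mulr_sumr; apply: eq_bigr => H _.
  by case: ifP; rewrite ?mulr0.
under [RHS]eq_bigr do rewrite exchange_big.
rewrite [RHS]exchange_big /=; apply: eq_big_seq => H; rewrite in_fset_set// inE => HL.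
pose Q : FrL := (qmx R H, L).
have QS : in_SB A B Q by exact: ((@in_SBP R m n A B L _ gL).2 HL).
have O0 : orbs (rat_orbit A Q) by exists Q.
have O0' : rat_orbit A Q \in fset_set orbs by rewrite in_fset_set// inE.
have transpE O : orbs O -> rat_transp A Q (orb_rep O) =
    [set g | T O g /\ qmx R g *m qmx R H = (orb_rep O).1].
  move=> OO; apply/seteqP; split=> g.
    by move=> [gA gQ]; rewrite -gQ /T -gQ.
  move=> [[gA gL'] gX]; split=> //; rewrite /rat_act /=.
  by case: (orb_rep O) gL' gX => X' L' /= -> ->.
rewrite (bigD1_seq _ O0' (fset_uniq _)) /= [X in _ + X]big1_seq ?addr0; last first.
  move=> O /andP[nO /inO OO]; rewrite big1_seq// => g; rewrite in_fset_set ?inE; last exact: finT.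
  move=> gT; case: eqP => // gX; move/eqP: nO; case.
  have [_ <-] := orb_repP OO.
  have : rat_transp A Q (orb_rep O) g by rewrite transpE.
  by move=> [gA <-]; rewrite (rat_orbit_act hA).
have [_ OE] := orb_repP O0; have := rat_orbit_id A (orb_rep (rat_orbit A Q)).
rewrite {1}OE; set O := rat_orbit A Q => -[g0 g0A g0Q].
have [finR cardR] := card_rat_transp hA (latO _ O0) (conj g0A g0Q).
rewrite -big_mkcond /= -big_filter big_const_seq count_predT iter_addr_0.
have -> : size [seq g <- fset_set (T O) | qmx R g *m qmx R H == (orb_rep O).1] =
    #|` fset_set (rat_stab A (orb_rep O))|.
  rewrite -cardR; apply: perm_size; apply: uniq_perm; rewrite ?filter_uniq ?fset_uniq//.
  move=> g; rewrite mem_filter !in_fset_set//; last exact: finT.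
  rewrite transpE//; apply/idP/idP.
    by move=> /andP[/eqP h1]; rewrite !inE.
  by rewrite !inE => -[h1 h2]; apply/andP; split; [apply/eqP|rewrite inE].
rewrite -[RHS]mulr_natl /w mulrA mulfV ?mul1r//.
rewrite pnatr_eq0 cardfs_eq0; apply/negP => /eqP e.
have : 1%:M \in fset_set (rat_stab A (orb_rep O)).
  rewrite in_fset_set; last by apply: (finite_rat_stab hA); exact: latO.
  by rewrite inE; split; [exact: orth1|exact: rat_act1].
by rewrite e.
Qed.

End WeylSum.

Lemma expipi_neq0 (R : realType) (z : R[i]) : expipi z != 0.
Proof.
apply/negP => /eqP [] /eqP; rewrite mulf_eq0 gt_eqF ?expR_gt0//= => /eqP c0.
move=> /eqP; rewrite mulf_eq0 gt_eqF ?expR_gt0//= => /eqP s0.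
have := cos2Dsin2 (pi * complex.Re z); rewrite c0 s0 expr0n /= addr0 => /eqP.
by rewrite eq_sym oner_eq0.
Qed.

Lemma siegel_nonempty (R : realType) n : exists Z : 'M[R[i]]_n, siegel Z.
Proof.
exists ((Complex 0 1)%:M); split; first by rewrite tr_scalar_mx.
have -> : map_mx (@complex.Im R) ((Complex 0 1)%:M) = 1%:M :> 'M[R]_n.
  by apply/matrixP => i j; rewrite !mxE; case: eqP.
split; first by rewrite trmx1.
move=> x x0; rewrite mulmx1 mxE.
have ge0 : forall i, true -> 0 <= x^T 0 i * x i 0 by move=> i _; rewrite mxE -expr2 sqr_ge0.
rewrite lt_neqAle sumr_ge0// andbT eq_sym; apply: contra x0; rewrite psumr_eq0// => /allP h.
apply/eqP/matrixP => i j; rewrite ord1 mxE; have := h i (mem_index_enum _).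
by rewrite /= mxE mulf_eq0 orbb => /eqP.
Qed.

Lemma cintegral_restrict (R : realType) (d : measure_display) (T : measurableType d)
    (mu : {measure set T -> \bar R}) (E : set T) (f : T -> R[i]) : measurable E ->
  cintegrable mu E f -> cintegrable mu setT (fun x => if x \in E then f x else 0) /\
  cintegral mu setT (fun x => if x \in E then f x else 0) = cintegral mu E f.
Proof.
move=> mE [f1 f2].
have e1 : (fun x => complex.Re (if x \in E then f x else 0)) = (fun x => complex.Re (f x)) \_ E.
  by apply/funext => x; rewrite patchE; case: ifP.
have e2 : (fun x => complex.Im (if x \in E then f x else 0)) = (fun x => complex.Im (f x)) \_ E.
  by apply/funext => x; rewrite patchE; case: ifP.
split; last by rewrite /cintegral e1 e2 -!Rintegral_mkcond.
split; [rewrite e1|rewrite e2]; rewrite -restrict_EFin.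
  exact: ((integrable_mkcond _ mE).1 f1).
exact: ((integrable_mkcond _ mE).1 f2).
Qed.

(** * The theta coefficient as a Weyl sum *)

Section ThetaCoefficient.
Variables (R : realType) (m n : nat) (A : 'M[int]_m) (B : 'M[int]_n).
Hypothesis hA : pos_def (zmx R A).
Local Notation C := R[i].
Local Notation G := (adelic_borel R A).
Local Notation FrL := (framed_lattice R m n).
Local Notation V := (repr_var A (zmx R B)).
Local Notation unitA := (zmx_unit_num hA rat).
Local Notation orbs := (@SB_orbits R m n A B).

Lemma int_repr_lat (a : G) (H : 'M[rat]_(m, n)) : int_repr A B (lat a) H <->
  repr_var A (zmx rat B) H /\ forall p, padic_int_mx (invmx (fin a p) *m qmx (padic p) H).
Proof.
have e p j : invmx (fin a p) *m qmx (padic p) (col j H) =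
    col j (invmx (fin a p) *m qmx (padic p) H).
  have -> : qmx (padic p) (col j H) = col j (qmx (padic p) H).
    by apply/matrixP => i k; rewrite !mxE.
  by rewrite !colE mulmxA.
split=> -[HB h]; (split; first exact HB).
  by move=> p i j; have := h j p i 0; rewrite e mxE.
by move=> j p i k; rewrite e mxE; exact: (h p).
Qed.

(** The exponential is constant on the H with H^T A H = B, and integrality at all primes places the
    columns of H in [lat a]; positivity of A then leaves finitely many terms. *)
Lemma theta_terms_repr (a : G) (Z : 'M[C]_n) (q : mxpoly R m n) :
  theta_terms (repr_var A (zmx rat B)) a Z q =
  expipi (\tr (zmx C B *m Z)) * \sum_(H <- fset_set (int_repr A B (lat a)))
    peval q (cmx (invmx (arch a) *m qmx R H)).
Proof.
have finS : finite_set (int_repr A B (lat a)).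
  by apply: (@finite_int_repr R m n A B hA); exact: (lat_is_lattice hA).
rewrite /theta_terms (csum_finite_support finS); last 2 first.
- by move=> H [].
- move=> H HB nH; rewrite asboolF ?mulr0// => h; apply: nH; exact/int_repr_lat.
rewrite mulr_sumr; apply: eq_big_seq => H; rewrite in_fset_set// inE => /int_repr_lat[HB h].
rewrite asboolT// mulr1; congr (expipi _ * _).
rewrite HB mxtrace_mulC; congr (\tr (_ *m _)).
by apply/matrixP => i j; rewrite !mxE ratr_int.
Qed.

Variable mu : {measure set G -> \bar R}.
Hypothesis hmu : is_haar mu.
Variable D : set G.
Hypothesis hD : is_fundamental_domain D.
Hypothesis muD : (mu D < +oo)%E.
Variable muB : probability (mx_borel R m n) R.
Hypothesis hmuB : invariant_probability A (zmx R B) muB.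
Variables (lam : set (mxpoly R m n)) (EB : 'M[R]_(m, n)) (p : mxpoly R m n).
Hypothesis VEB : V EB.
Hypothesis hp : reproducing A (zmx R B) muB lam EB p.
Variable phi : FrL -> C.
Hypothesis phi_inv : rat_invariant A B phi.
Hypothesis phi_type : has_arch_type A B lam phi.

Lemma in_LAB_lat (a : G) : in_LAB A B (arch a *m EB, lat a).
Proof.
split; last exact: (genus_lat hA).
by apply: orth_repr_var => //; exact: arch_orth.
Qed.

(** The function unfolded for the orbit O. Extension by 0 off the fibre makes its value at g a
    vanish unless g carries [lat a] to the representative lattice, which leaves finitely many g for
    each a. *)
Let orb_fun (O : set FrL) (b : G) : C :=
  if b \in (lat_fiber (orb_rep O).2 : set G) then
    peval p (cmx (invmx (arch b) *m (orb_rep O).1)) * phi (arch b *m EB, (orb_rep O).2)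
  else 0.

Let orb_fun_integral O : orbs O ->
  cintegrable mu setT (orb_fun O) /\ cintegral mu setT (orb_fun O) = phi (orb_rep O).
Proof.
move=> /(orb_repP hA)[[[VX gL] _] _]; have [q iq qE] := phi_type gL.
have mL := measurable_lat_fiber hA (orb_rep O).2.
have Vb (b : G) : V (arch b *m EB) by have [] := in_LAB_lat b.
have oE (b : G) : peval p (cmx (invmx (arch b) *m (orb_rep O).1)) *
    phi (arch b *m EB, (orb_rep O).2) =
    peval p (cmx (invmx (arch b) *m (orb_rep O).1)) * peval q (cmx (arch b *m EB)).
  by rewrite qE.
have muL : (mu (lat_fiber (orb_rep O).2) < +oo)%E.
  by rewrite (measure_lat_fiber hA hmu gL) ltry.
have int := cnice_integrable mL muL (cnice_archimedean hA p VEB (orb_rep O).2 q VX).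
have [r1 r2] := cintegral_restrict mL int.
have -> : orb_fun O = (fun b => if b \in (lat_fiber (orb_rep O).2 : set G) then
    peval p (cmx (invmx (arch b) *m (orb_rep O).1)) * peval q (cmx (arch b *m EB)) else 0).
  by apply/funext => b; rewrite /orb_fun oE.
split=> //; rewrite r2 (archimedean_integral hA hmuB VEB hp hmu gL VX iq).
by rewrite -qE//; case: (orb_rep O).
Qed.

Lemma Theta_terms_weyl (Z : 'M[C]_n) :
  Theta_terms mu D EB (repr_var A (zmx rat B)) (fun Q => (phi Q)^*) Z p =
  weyl_sum A B phi * expipi (\tr (zmx C B *m Z)).
Proof.
have finO : finite_set orbs.
  by apply: (finite_SB_orbits B hA); exact: (finite_classes hA hmu hD muD).
have mD := proj1 hD.
pose w (O : set FrL) : C := (#|` fset_set (rat_stab A (orb_rep O))|%:R)^-1.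
pose T (O : set FrL) (a : G) := lat_transp A (lat a) (orb_rep O).2.
have latO O : orbs O -> is_lattice (orb_rep O).2.
  by move=> /(orb_repP hA)[[[_ [lO _]] _] _].
have unf O : orbs O ->
    cintegrable mu D (fun a => \sum_(g <- fset_set (T O a)) orb_fun O (rat_trans g a)) /\
    cintegral mu D (fun a => \sum_(g <- fset_set (T O a)) orb_fun O (rat_trans g a)) =
    phi (orb_rep O).
  move=> OO; have [i1 i2] := orb_fun_integral OO; rewrite -i2.
  apply: (unfold_complex hA hmu hD) => // [a|a g|a g gQ nT].
  - by apply: (finite_lat_transp hA); exact: latO.
  - by case.
  rewrite /orb_fun memNset// => h; apply: nT; split=> //.
  by rewrite -h (lat_rat_trans hA).
have inO O : O \in fset_set orbs -> orbs O by rewrite in_fset_set// inE.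
(* The two conjugations of phi cancel. Each remaining term depends on g a only, because a^-1 (g^-1
   X) = (g a)^-1 X and phi takes the same value at a and g a by rational invariance. *)
have pt (a : G) : theta_terms (repr_var A (zmx rat B)) a Z p *
    (pullback EB (fun Q => (phi Q)^*) a)^* =
    expipi (\tr (zmx C B *m Z)) * \sum_(O <- fset_set orbs | O \in fset_set orbs)
      w O * \sum_(g <- fset_set (T O a)) orb_fun O (rat_trans g a).
  rewrite theta_terms_repr /pullback (adelic_actE hA) conjCK -mulrA; congr (_ * _).
  rewrite (orbit_sum hA finO (fun X => peval p (cmx (invmx (arch a) *m X))) (genus_lat hA a)).
  rewrite mulr_suml -big_seq; apply: eq_big_seq => O /inO OO.
  rewrite -mulrA; congr (_ * _); rewrite mulr_suml; apply: eq_big_seq => g.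
  rewrite in_fset_set; last by apply: (finite_lat_transp hA); exact: latO.
  rewrite inE => -[gA gL].
  have gRu : qmx R g \in unitmx by rewrite /qmx map_unitmx (orth_unit unitA).
  rewrite /orb_fun mem_set; last by rewrite /lat_fiber /= (lat_rat_trans hA).
  rewrite arch_rat_trans// (invmxM gRu (arch_unit hA a)).
  have -> : invmx (qmx R g) = qmx R (invmx g) by rewrite /qmx map_invmx.
  rewrite !mulmxA; congr (_ * _).
  by rewrite -(phi_inv gA (in_LAB_lat a)) /rat_act /= gL mulmxA.
rewrite /Theta_terms (eq_cintegral mu (fun a _ => pt a)).
have [c1 c2] := @cintegrable_sum R _ G mu D mD _ (fset_set orbs)
  (fun O => O \in fset_set orbs)
  (fun O a => w O * \sum_(g <- fset_set (T O a)) orb_fun O (rat_trans g a))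
  (fun O OO => cintegrableZ mD (w O) (unf O (inO O OO)).1).
rewrite cintegralZ// c2 mulrC; congr (_ * _).
rewrite /weyl_sum fsbig_finite// -big_seq; apply: eq_big_seq => O /inO OO.
have [u1 u2] := unf O OO.
by rewrite cintegralZ// u2 mulrC.
Qed.

End ThetaCoefficient.

(** [xget] may return any constant satisfying the defining equation; since the exponential never
    vanishes, a single point of the Siegel space determines it. *)
Lemma Theta_coef_eq (R : realType) (m n : nat) (A : 'M[int]_m) (B : 'M[int]_n)
    (mu : {measure set (adelic_borel R A) -> \bar R}) (D : set (adelic_borel R A))
    (EB : 'M[R]_(m, n)) f (q : mxpoly R m n) (c : R[i]) :
  (forall Z, Theta_terms mu D EB (repr_var A (zmx rat B)) f Z q =
    c * expipi (\tr (zmx R[i] B *m Z))) ->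
  Theta_coef B mu D EB f q = c.
Proof.
move=> h; rewrite /Theta_coef; case: xgetP => [c' _ hc'|/(_ c)]; last first.
  by case=> Z _; exact: h.
have [Z sZ] := @siegel_nonempty R n; have := hc' Z sZ; rewrite h.
by move/(mulIf (expipi_neq0 _)).
Qed.

(* Theta is conjugate-linear and the Weyl sum is linear in the automorphic form,
   so <Theta(phi)(lambda, B), p> = W(phi, B) can only hold for every member of an
   orthonormal basis if the latter is real valued; this is the second conjunct.
   For an arbitrary complex basis, the identity reads
   <Theta(conj phi)(lambda, B), p> = W(phi, B); this is the first conjunct. *)
Theorem theorem6p5 (R : realType) (m n : nat) (hmn : (n <= m)%N)
    (A : 'M[int]_m) (hA : pos_def (zmx R A))
    (B : 'M[int]_n) (hB : pos_def (zmx R B))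
    (E : 'M[R]_(m, n)) (hE : repr_var A 1%:M E)
    (sqrtB : 'M[R]_n) (hsqrtB : sqrtB \in unitmx)
    (hsqrtB2 : sqrtB^T *m sqrtB = zmx R B)
    (muB : probability (mx_borel R m n) R)
    (hmuB : invariant_probability A (zmx R B) muB)
    (mu : {measure set (adelic_borel R A) -> \bar R}) (hmu : is_haar mu)
    (D : set (adelic_borel R A)) (hD : is_fundamental_domain D)
    (I : eqType) (phi : I -> framed_lattice R m n -> R[i])
    (hphi : automorphic_basis B mu D (E *m sqrtB) phi)
    (lam : set (mxpoly R m n)) (hlam : irreducible_harmonic A lam)
    (p : mxpoly R m n) (hp : reproducing A (zmx R B) muB lam (E *m sqrtB) p)
    (i : I) (hi : has_arch_type A B lam (phi i)) :
  Theta_coef B mu D (E *m sqrtB) (fun Q => (phi i Q)^*) p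
    = weyl_sum A B (phi i)
  /\ ((forall Q, in_LAB A B Q -> complex.Im (phi i Q) = 0) ->
      Theta_coef B mu D (E *m sqrtB) (phi i) p = weyl_sum A B (phi i)).
Proof.
have VEB : repr_var A (zmx R B) (E *m sqrtB).
  rewrite /repr_var /= trmx_mul !mulmxA -(mulmxA _ E^T) -(mulmxA _ (E^T *m _)) hE.
  by rewrite mulmx1.
have [inv orthn _ _] := hphi; have [phi_inv _] := inv i.
(* [L2dot] divides by [fine (mu D)], which is 0 if [mu D] is infinite. *)
have muD : (mu D < +oo)%E.
  rewrite ltey; apply/negP => /eqP muD; have := orthn i i.
  rewrite /L2dot muD /= invr0 mulr0 eqxx => /eqP.
  by rewrite eq_sym oner_eq0.
have main : Theta_coef B mu D (E *m sqrtB) (fun Q => (phi i Q)^*) p = weyl_sum A B (phi i).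
  by apply: Theta_coef_eq => Z; exact: (Theta_terms_weyl hA hmu hD muD hmuB VEB hp phi_inv hi).
split=> // real_phi; apply: Theta_coef_eq => Z.
rewrite -(Theta_terms_weyl hA hmu hD muD hmuB VEB hp phi_inv hi).
apply: eq_cintegral => a _; congr (_ * _^*); rewrite /pullback (adelic_actE hA).
have := real_phi _ (in_LAB_lat hA VEB a).
by case: (phi i _) => u v /= ->; congr Complex; rewrite oppr0.
Qed.
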